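(* Let $V:\mathbb{R}^m\to\mathbb{R}$ be a potential and let $\psi_h$, $h>0$, be an integrator for the Hamiltonian system of $V$ that is equivariant, volume preserving and reversible, and suppose that, for the potential $V$ in $\mathbb{R}^m$, Conditions 1 and 2 (stated in the context) hold, with exponent $\nu>0$ and leading coefficient $\alpha(q,p)$. Let $\lambda_i>0$, $i=1,2,\dots$, be scaling constants such that, for some constants $\gamma>0$ and $0<K<\infty$, $$\lim_{d\to\infty} d^{-\gamma}\sum_{i=1}^d \frac{1}{\lambda_i^{2\nu}} = K ,\qquad \lim_{d\to\infty} d^{-\gamma}\max_{i=1,\dots,d}\frac{1}{\lambda_i^{2\nu}}=0 .$$ For a constant $\ell>0$ choose $h_d=\ell/d^{\gamma/(2\nu)}$. For each $d\ge 1$ consider the product target $\propto\prod_{i=1}^d\exp(-V(q_i/\lambda_i))$ on $\mathbb{R}^{dm}$, its extended Hamiltonian $\mathcal{H}(Q,P)$ and the energy error $\Delta_d(Q,P,h)$ (see the context). Then, when $(Q,P)$ has density $\propto\exp(-\mathcal{H}(Q,P))$ on $\mathbb{R}^{dm}\times\mathbb{R}^{dm}$, the expectation $\mathbb{E}(a_d)$ of the acceptance probability $$a_d=\min\bigl(1,\exp(-\Delta_d(Q,P,h_d))\bigr)$$ converges, as $d\to\infty$, to $$A = 2\,\Phi\left(-\frac{\ell^{\nu}\sqrt{K\Sigma}}{2}\right),$$ where $\Phi$ is the cumulative distribution function of $N(0,1)$ and $\Sigma=\mathbb{E}(\alpha(q,p)^2)$, the last expectation being taken with respect to the density $\propto\exp(-H(q,p))$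 on $\mathbb{R}^m\times\mathbb{R}^m$, $H(q,p)=\frac12\|p\|^2+V(q)$.
   Context: $\|\cdot\|$ is the Euclidean norm. $V:\mathbb{R}^m\to\mathbb{R}$ is a differentiable function with $\exp(-V)$ integrable; $H(q,p)=\frac12\|p\|^2+V(q)$ on $\mathbb{R}^m\times\mathbb{R}^m$, with Hamiltonian equations $\dot q=p$, $\dot p=-\nabla V(q)$. Integrator: a family of maps $\psi_h:\mathbb{R}^m\times\mathbb{R}^m\to\mathbb{R}^m\times\mathbb{R}^m$, $h>0$ (depending on the potential), such that for some $\eta\ge 0$ and every solution $(q(t),p(t))$ of the Hamiltonian equations, $\psi_h(q(0),p(0))-(q(h),p(h))=o(h^\eta)$ as $h\to0$. Write $(q^\star,p^\star)=\psi_h(q,p)$. Volume preserving: $|\det\psi_h'(q,p)|=1$ for all $(q,p)$, where $\psi_h'$ is the Jacobian matrix. Reversible: for all $(q,p)$, $\psi_h(q,p)=(q^\star,p^\star)\Leftrightarrow\psi_h(q^\star,-p^\star)=(q,-p)$. Equivariant: for every $\lambda>0$, if $\psi_h^\lambda$ denotes the integrator applied to the scaled potential $V^\lambda(q)=V(q/\lambda)$ (Hamiltonian $H^\lambda(q,p)=\frac12\|p\|^2+V(q/\lambda)$), then $(q^\star,p^\star)=\psi_h^\lambda(q,p)\Leftrightarrow(q^\star/\lambda,p^\star)=\psi_{h/\lambda}(q/\lambda,p)$. Energy errors: $\Delta(q,p,h)=H(\psi_h(q,p))-H(q,p)$ and $\Delta^\lambda(q,p,h)=H^\lambda(\psi^\lambda_h(q,p))-H^\lambda(q,p)$.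 Condition 1: there exist real functions $\alpha(q,p)$, $\rho(q,p,h)$ and a constant $\nu>0$ such that $\Delta(q,p,h)=h^\nu\alpha(q,p)+h^\nu\rho(q,p,h)$ with $\lim_{h\to0}\rho(q,p,h)=0$ for each $(q,p)$. Condition 2: there exists a real function $D(q,p)$, integrable with respect to the probability density $\propto\exp(-H(q,p))$, such that $\sup_{0<h\le1}|\Delta(q,p,h)|^3/h^{3\nu}\le D(q,p)$. Product setting: for $d\ge1$ write $Q=(q_1,\dots,q_d)$, $P=(p_1,\dots,p_d)$ with $q_i,p_i\in\mathbb{R}^m$, and $\mathcal{H}(Q,P)=\frac12\sum_{i=1}^d\|p_i\|^2+\sum_{i=1}^dV(q_i/\lambda_i)$. The integrator for $\mathcal{H}$ acts componentwise, $(q_i^\star,p_i^\star)=\psi_h^{\lambda_i}(q_i,p_i)$, and $\Delta_d(Q,P,h)=\mathcal{H}(Q^\star,P^\star)-\mathcal{H}(Q,P)=\sum_{i=1}^d\Delta^{\lambda_i}(q_i,p_i,h)$. *)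

(* Defs.v *)
From HB Require Import structures.
From mathcomp Require Import all_boot all_order all_algebra.
From mathcomp Require Import all_classical all_reals all_analysis.

Set Implicit Arguments.
Unset Strict Implicit.
Unset Printing Implicit Defensive.

Import Order.TTheory GRing.Theory Num.Theory.
Import numFieldNormedType.Exports.

Local Open Scope classical_set_scope.
Local Open Scope ring_scope.

Lemma pushforward_sigma_additive d1 d2 (T1 : measurableType d1)
    (T2 : measurableType d2) (R : realType)
    (mu : {measure set T1 -> \bar R}) (f : T1 -> T2) :
  measurable_fun setT f -> semi_sigma_additive (pushforward mu f).
Proof.
move=> mf F mF tF mUF; rewrite /pushforward preimage_bigcup.
apply: measure_semi_sigma_additive.
- by move=> n; rewrite -[X in measurable X]setTI; exact: mf.
- apply/trivIsetP => /= i j _ _ ij; rewrite -preimage_setI.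
  by move/trivIsetP : tF => /(_ _ _ _ _ ij) ->//; rewrite preimage_set0.
- by rewrite -preimage_bigcup -[X in measurable X]setTI; exact: mf.
Qed.

Lemma pushforward_sigma_finite d1 d2 (T1 : measurableType d1)
    (T2 : measurableType d2) (R : realType)
    (mu : set T1 -> \bar R) (f : T1 -> T2) (g : T2 -> T1) :
  measurable_fun setT g -> cancel f g ->
  sigma_finite setT mu -> sigma_finite setT (pushforward mu f).
Proof.
move=> mg fK [F UF mF].
exists (fun k => g @^-1` F k); first by rewrite -preimage_bigcup -UF.
move=> k; have [mFk Fk] := mF k; split.
  by rewrite -[X in measurable X]setTI; exact: mg.
rewrite /pushforward -comp_preimage (_ : g \o f = id) ?preimage_id//.
by apply/funext => x /=.
Qed.

(* The library proves this, but its canonical instance is shadowed by the one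
   for products of subprobabilities. *)
Lemma product_measure1_sigma_finite d1 d2 (T1 : measurableType d1)
    (T2 : measurableType d2) (R : realType)
    (m1 : {sigma_finite_measure set T1 -> \bar R})
    (m2 : {sigma_finite_measure set T2 -> \bar R}) :
  sigma_finite setT (m1 \x m2)%E.
Proof.
have /sigma_finiteP[F [TF ndF Foo]] := sigma_finiteT m1.
have /sigma_finiteP[G [TG ndG Goo]] := sigma_finiteT m2.
exists (fun n => F n `*` G n).
  rewrite -setXTT TF TG predeqE => -[x y]; split.
    move=> [/= [n _ Fnx] [k _ Gky]]; exists (maxn n k) => //; split.
    - by move: x Fnx; exact/subsetPset/ndF/leq_maxl.
    - by move: y Gky; exact/subsetPset/ndG/leq_maxr.
  by move=> [n _ []/= ? ?]; split; exists n.
move=> k; have [? ?] := Foo k; have [? ?] := Goo k.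
split; first exact: measurableX.
by rewrite product_measure1E// lte_mul_pinfty// ge0_fin_numE.
Qed.

(* The n-fold power of a sigma-finite measure, on the library's product
   sigma-algebra of n.-tuple T. *)
Section tuple_measure.
Context d (T : measurableType d) (R : realType).
Variable mu : {sigma_finite_measure set T -> \bar R}.

Definition cons_tuple n (x : T * n.-tuple T) : n.+1.-tuple T :=
  [the n.+1.-tuple T of x.1 :: x.2].

Definition uncons_tuple n (t : n.+1.-tuple T) : T * n.-tuple T :=
  (tnth t ord0, [tuple of behead t]).

Lemma cons_tupleK n : cancel (@cons_tuple n) (@uncons_tuple n).
Proof. by case=> x t; congr pair; apply/val_inj. Qed.

Lemma measurable_cons_tuple n : measurable_fun setT (@cons_tuple n).
Proof. exact: measurable_cons measurable_fst measurable_snd. Qed.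

Lemma measurable_uncons_tuple n : measurable_fun setT (@uncons_tuple n).
Proof.
apply/measurable_fun_pairP; split.
  exact: (measurable_tnth ord0).
exact: measurable_behead.
Qed.

Section step.
Variables (n : nat) (nu : {sigma_finite_measure set (n.-tuple T) -> \bar R}).
Local Open Scope ereal_scope.

Definition tuple_measureS : set (n.+1.-tuple T) -> \bar R :=
  pushforward (mu \x nu) (@cons_tuple n).

Let tuple_measureS0 : tuple_measureS set0 = 0.
Proof. by rewrite /tuple_measureS /pushforward preimage_set0 measure0. Qed.

Let tuple_measureS_ge0 A : 0 <= tuple_measureS A.
Proof. by rewrite /tuple_measureS /pushforward; exact: measure_ge0. Qed.

Let tuple_measureS_sigma_additive : semi_sigma_additive tuple_measureS.
Proof. exact: pushforward_sigma_additive (@measurable_cons_tuple n). Qed.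

HB.instance Definition _ := isMeasure.Build _ _ _ tuple_measureS
  tuple_measureS0 tuple_measureS_ge0 tuple_measureS_sigma_additive.

Let tuple_measureS_sigma_finite : sigma_finite setT tuple_measureS.
Proof.
apply: pushforward_sigma_finite (@measurable_uncons_tuple n) (@cons_tupleK n) _.
exact: product_measure1_sigma_finite.
Qed.

HB.instance Definition _ := Measure_isSigmaFinite.Build _ _ _ tuple_measureS
  tuple_measureS_sigma_finite.
End step.

Fixpoint tuple_measure n : {sigma_finite_measure set (n.-tuple T) -> \bar R} :=
  match n with
  | 0 => \d_[tuple]
  | n'.+1 => tuple_measureS (tuple_measure n')
  end.

End tuple_measure.

Section matrix_tuple.
Context (T : Type) (n m : nat).

Definition tuple_of_mx (M : 'M[T]_(n, m)) : n.-tuple (m.-tuple T) :=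
  [tuple [tuple M i j | j < m] | i < n].

Definition mx_of_tuple (t : n.-tuple (m.-tuple T)) : 'M[T]_(n, m) :=
  \matrix_(i, j) tnth (tnth t i) j.

Lemma mx_of_tupleK : cancel mx_of_tuple tuple_of_mx.
Proof.
move=> t; apply/eq_from_tnth => i; apply/eq_from_tnth => j.
by rewrite !tnth_mktuple mxE.
Qed.

Lemma tuple_of_mxK : cancel tuple_of_mx mx_of_tuple.
Proof. by move=> M; apply/matrixP => i j; rewrite mxE !tnth_mktuple. Qed.

End matrix_tuple.

(* The sigma-algebra on real matrices that makes the bijection with tuples of
   tuples bimeasurable, i.e. the one generated by the entries; it is the Borel
   sigma-algebra of 'M[R]_(n, m). *)
Section measurable_matrix.
Context (R : realType) (n m : nat).

Let tomx : 'M[R]_(n, m) -> n.-tuple (m.-tuple (measurableTypeR R)) :=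
  @tuple_of_mx R n m.

Definition measurable_mx : set (set 'M[R]_(n, m)) :=
  preimage_set_system setT tomx measurable.

Let measurable_mx0 : measurable_mx set0.
Proof. by exists set0 => //; rewrite preimage_set0 setI0. Qed.

Let measurable_mxC A : measurable_mx A -> measurable_mx (~` A).
Proof.
move=> [B mB <-]; exists (~` B); first exact: measurableC.
by rewrite !setTI preimage_setC.
Qed.

Let measurable_mx_bigcup (F : (set 'M[R]_(n, m))^nat) :
  (forall i, measurable_mx (F i)) -> measurable_mx (\bigcup_i F i).
Proof.
move=> mF; have /choice[G GF] : forall i, exists B, measurable B /\
    setT `&` tomx @^-1` B = F i.
  by move=> i; have [B mB BF] := mF i; exists B.
exists (\bigcup_i G i); first by apply: bigcupT_measurable => i; have [] := GF i.
rewrite setTI preimage_bigcup; apply: eq_bigcupr => i _.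
by have [_ <-] := GF i; rewrite setTI.
Qed.

HB.instance Definition _ := @isMeasurable.Build default_measure_display
  'M[R]_(n, m) measurable_mx measurable_mx0 measurable_mxC measurable_mx_bigcup.

Lemma measurable_tuple_of_mx : measurable_fun setT tomx.
Proof. by move=> _ B mB; exists B. Qed.

Lemma measurable_mx_of_tuple : measurable_fun setT
  (@mx_of_tuple R n m : n.-tuple (m.-tuple (measurableTypeR R)) -> _).
Proof.
move=> _ _ [B mB <-]; rewrite !setTI -comp_preimage.
rewrite (_ : tomx \o _ = id) ?preimage_id//.
by apply/funext => t /=; exact: mx_of_tupleK.
Qed.

End measurable_matrix.

(* Lebesgue measure on the n by m real matrices, that is, on R^(n m); see
   lebesgue_mx_box. *)
Section lebesgue_mx.
Context (R : realType).
Local Open Scope ereal_scope.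

Local Notation leb := (@lebesgue_measure R).

Definition lebesgue_mx (n m : nat) : set 'M[R]_(n, m) -> \bar R :=
  pushforward (tuple_measure (tuple_measure leb m) n) (@mx_of_tuple R n m).

Section instances.
Variables n m : nat.

Let lebesgue_mx0 : @lebesgue_mx n m set0 = 0.
Proof. by rewrite /lebesgue_mx /pushforward preimage_set0 measure0. Qed.

Let lebesgue_mx_ge0 A : 0 <= @lebesgue_mx n m A.
Proof. by rewrite /lebesgue_mx /pushforward; exact: measure_ge0. Qed.

Let lebesgue_mx_sigma_additive : semi_sigma_additive (@lebesgue_mx n m).
Proof. exact: pushforward_sigma_additive (@measurable_mx_of_tuple R n m). Qed.

HB.instance Definition _ := isMeasure.Build _ _ _ (@lebesgue_mx n m)
  lebesgue_mx0 lebesgue_mx_ge0 lebesgue_mx_sigma_additive.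

Let lebesgue_mx_sigma_finite : sigma_finite setT (@lebesgue_mx n m).
Proof.
apply: pushforward_sigma_finite (@measurable_tuple_of_mx R n m)
  (@mx_of_tupleK _ n m) _.
exact: sigma_finiteT.
Qed.

HB.instance Definition _ := Measure_isSigmaFinite.Build _ _ _
  (@lebesgue_mx n m) lebesgue_mx_sigma_finite.

End instances.

Lemma tuple_measure_box d (T : measurableType d)
    (mu : {sigma_finite_measure set T -> \bar R}) n (A : 'I_n -> set T) :
  (forall i, measurable (A i)) ->
  measurable [set t : n.-tuple T | forall i, A i (tnth t i)] /\
  tuple_measure mu n [set t : n.-tuple T | forall i, A i (tnth t i)] =
  \prod_(i < n) mu (A i).
Proof.
elim: n A => [|n IH] A mA.
  rewrite big_ord0 (_ : [set _ | _] = setT).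
    by split => //=; rewrite diracT.
  by apply/seteqP; split => // t _ [].
have [mB muB] := IH (A \o lift ord0) (fun i => mA _).
split.
  rewrite (_ : [set _ | _] =
      \bigcap_i [set t : n.+1.-tuple T | A i (tnth t i)]); last first.
    by apply/seteqP; split => [t At i _|t At i]; exact: At.
  apply: fin_bigcap_measurable => // i _.
  have := @measurable_tnth _ T n.+1 i measurableT _ (mA i).
  by rewrite setTI.
rewrite big_ord_recl -muB -product_measure1E//.
rewrite /= /tuple_measureS /pushforward; congr (_ _).
apply/seteqP; split => -[x t] /=.
  by move=> Axt; split => [|i]; [exact: Axt ord0|
    have := Axt (lift ord0 i); rewrite tnthS].
by move=> [Ax At] i; case: (unliftP ord0 i) => [j ->|->]//; rewrite tnthS; exact: At.
Qed.

Lemma lebesgue_mx_box n m (A : 'I_n -> 'I_m -> set R) :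
  (forall i j, measurable (A i j)) ->
  lebesgue_mx [set M : 'M[R]_(n, m) | forall i j, A i j (M i j)] =
  \prod_(i < n) \prod_(j < m) lebesgue_measure (A i j).
Proof.
move=> mA.
pose B i := [set t : m.-tuple (measurableTypeR R) | forall j, A i j (tnth t j)].
have mB i : measurable (B i) /\
    tuple_measure leb m (B i) = \prod_(j < m) lebesgue_measure (A i j).
  exact: (@tuple_measure_box _ (measurableTypeR R) leb m (A i) (mA i)).
rewrite -(eq_bigr _ (fun i _ => (mB i).2)).
rewrite -(tuple_measure_box (tuple_measure leb m) (fun i => (mB i).1)).2.
rewrite /lebesgue_mx /pushforward; congr (tuple_measure _ _ _).
apply/seteqP; split => t /= Bt i j; first by have := Bt i j; rewrite mxE.
by rewrite mxE; exact: Bt.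
Qed.

End lebesgue_mx.

(* Points (q, p) are pairs of row vectors.  States of the product system are
   pairs (Q, P) of d by m matrices whose i-th rows are q_i and p_i. *)
Definition phase (R : realType) (d m : nat) : Type :=
  ('M[R]_(d, m) * 'M[R]_(d, m))%type.

Definition lebesgue_phase (R : realType) (d m : nat) :
    {measure set ('M[R]_(d, m) * 'M[R]_(d, m)) -> \bar R} :=
  (@lebesgue_mx R d m \x @lebesgue_mx R d m)%E.

Section density.
Context d (T : measurableType d) (R : realType).
Variables (mu : {measure set T -> \bar R}) (E : T -> R).

(* The probability density proportional to exp(-E) with respect to mu. *)
Definition gibbs_density (x : T) : R :=
  expR (- E x) / \int[mu]_y expR (- E y).

Definition gibbs_integrable (f : T -> R) : Prop :=
  mu.-integrable setT (fun x => (f x * gibbs_density x)%:E).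

Definition gibbs_expectation (f : T -> R) : R :=
  \int[mu]_x (f x * gibbs_density x).

End density.

Section hamiltonian.
Context (R : realType) (m : nat).
Implicit Types (V : 'rV[R]_m -> R) (f : phase R 1 m -> phase R 1 m).

(* The norm that the library puts on matrices is the maximum norm. *)
Definition enorm (p : 'rV[R]_m) : R := Num.sqrt (\sum_j p 0 j ^+ 2).

Definition gradient V (q : 'rV[R]_m) : 'rV[R]_m :=
  \row_j 'D_(delta_mx 0 j) V q.

Definition hamiltonian V (z : phase R 1 m) : R :=
  2^-1 * enorm z.2 ^+ 2 + V z.1.

Definition scaled V (l : R) (q : 'rV[R]_m) : R := V (l^-1 *: q).

Definition hamiltonian_solution V (q p : R -> 'rV[R]_m) : Prop :=
  \forall t \near (0 : R),
    is_derive t (1 : R) q (p t) /\ is_derive t (1 : R) p (- gradient V (q t)).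

Definition is_integrator V (psi : R -> phase R 1 m -> phase R 1 m) : Prop :=
  exists2 eta : R, 0 <= eta &
    forall q p : R -> 'rV[R]_m, hamiltonian_solution V q p ->
      (fun h => psi h (q 0, p 0) - (q h, p h)) =o_ (0^'+)
      (fun h => h `^ eta : R^o).

(* A map of the phase space, read on R^(2 m); 'J is the transpose of the usual
   Jacobian matrix, which does not change the determinant. *)
Definition row_phase f (x : 'rV[R]_(m + m)) : 'rV[R]_(m + m) :=
  row_mx (f (lsubmx x, rsubmx x)).1 (f (lsubmx x, rsubmx x)).2.

Definition volume_preserving (psi : R -> phase R 1 m -> phase R 1 m) : Prop :=
  forall h, 0 < h -> forall x,
    differentiable (row_phase (psi h)) x /\
    `|\det ('J (row_phase (psi h)) x)| = 1.

Definition reversible (psi : R -> phase R 1 m -> phase R 1 m) : Prop :=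
  forall h, 0 < h -> forall q p q' p',
    psi h (q, p) = (q', p') <-> psi h (q', - p') = (q, - p).

(* Psi maps a potential to the integrator for that potential. *)
Definition equivariant V
    (Psi : ('rV[R]_m -> R) -> R -> phase R 1 m -> phase R 1 m) : Prop :=
  forall l, 0 < l -> forall h, 0 < h -> forall q p q' p',
    (q', p') = Psi (scaled V l) h (q, p) <->
    (l^-1 *: q', p') = Psi V (h / l) (l^-1 *: q, p).

Definition energy_error V (psi : R -> phase R 1 m -> phase R 1 m)
    (h : R) (z : phase R 1 m) : R :=
  hamiltonian V (psi h z) - hamiltonian V z.

Definition condition1 V (psi : R -> phase R 1 m -> phase R 1 m)
    (nu : R) (alpha : phase R 1 m -> R) : Prop :=
  exists rho : R -> phase R 1 m -> R,
    (forall h, 0 < h -> forall z,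
      energy_error V psi h z = h `^ nu * alpha z + h `^ nu * rho h z) /\
    (forall z, rho h z @[h --> 0^'+] --> (0 : R)).

Definition condition2 V (psi : R -> phase R 1 m -> phase R 1 m)
    (nu : R) : Prop :=
  exists2 D : phase R 1 m -> R,
    gibbs_integrable (lebesgue_phase R 1 m) (hamiltonian V) D &
    forall z, (ereal_sup
      [set (`|energy_error V psi h z| ^+ 3 / h `^ (3 * nu))%:E | h in `]0%R, 1%R]]
      <= (D z)%:E)%E.

End hamiltonian.

(* In the product setting the constant lambda_(i+1) of the 1-based sequence is
   lam i, so that the first d of them are indexed by 'I_d. *)
Section product.
Context (R : realType) (m : nat) (V : 'rV[R]_m -> R).
Variable Psi : ('rV[R]_m -> R) -> R -> phase R 1 m -> phase R 1 m.
Variable lam : nat -> R.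

Definition product_hamiltonian (d : nat) (Z : phase R d m) : R :=
  2^-1 * \sum_(i < d) enorm (row i Z.2) ^+ 2 +
  \sum_(i < d) scaled V (lam i) (row i Z.1).

Definition product_step (d : nat) (h : R) (Z : phase R d m) : phase R d m :=
  let z (i : 'I_d) := Psi (scaled V (lam i)) h (row i Z.1, row i Z.2) in
  (\matrix_(i < d) (z i).1, \matrix_(i < d) (z i).2).

Definition product_energy_error (d : nat) (h : R) (Z : phase R d m) : R :=
  product_hamiltonian (product_step h Z) - product_hamiltonian Z.

Definition acceptance_probability (d : nat) (h : R) (Z : phase R d m) : R :=
  Num.min 1 (expR (- product_energy_error h Z)).

Lemma product_energy_errorE (d : nat) (h : R) (Z : phase R d m) :
  product_energy_error h Z =
  \sum_(i < d) energy_error (scaled V (lam i)) (Psi (scaled V (lam i))) h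
                 (row i Z.1, row i Z.2).
Proof.
rewrite /product_energy_error /product_hamiltonian !mulr_sumr -!big_split /=.
rewrite -sumrB; apply: eq_bigr => i _.
by rewrite /energy_error /hamiltonian !rowK.
Qed.

End product.

Definition normal_cdf (R : realType) (x : R) : R :=
  fine (normal_prob (0 : R) 1 `]-oo, x]).

(* Main.v *)
(* Composed with the momentum flip, one step of the integrator is an involution
   T with unimodular derivative; hence T preserves Lebesgue measure, and it
   changes the sign of the energy error D.  Therefore e^(-D/2) e^(-H) is
   T-invariant: for the tilted law proportional to it the sine integrals of D
   vanish, and its cosine integrals are those of the even function
   2 cos(t D) / (e^(D/2) + e^(-D/2)) against the Gibbs law.  Conditions 1 and 2
   give, by dominated convergence,
     1 - E[cos(t D) e^(-D/2)] ~ h^(2 nu) (t^2/2 + 1/8) Sigma,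
   so that the product over the components converges to
   e^(-s^2/8) e^(-t^2 s^2/2) with s = ell^nu sqrt(K Sigma).
   Since min(1, e^(-x)) = e^(-|x|/2) e^(-x/2), the expected acceptance
   probability is the integral of e^(-|x|/2) under the tilted law of the total
   energy error.  Levy's continuity theorem, for this one test function, gives
   the limit e^(-s^2/8) E[e^(-|s Z|/2)] = 2 Phi(-s/2) with Z standard normal. *)
Require Import Defs.
From HB Require Import structures.
From mathcomp Require Import all_boot all_order all_algebra.
From mathcomp Require Import all_classical all_reals all_analysis.
From mathcomp Require Import perm measurable_realfun.
From mathcomp Require Import ring lra.

Import Order.TTheory GRing.Theory Num.Theory.
Import numFieldNormedType.Exports.

Local Open Scope classical_set_scope.
Local Open Scope ring_scope.

Set Implicit Arguments.
Unset Strict Implicit.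
Unset Printing Implicit Defensive.

(** * Coordinate boxes and measure-preserving maps *)

(** Why tilt at all: under the Gibbs law itself the mean of the energy error enters at order
    [h^(2 nu)], like its variance, whereas Condition 1 describes the error only up to [o(h^nu)]; a
    direct central limit argument would lose the drift. Under the tilted weight every odd integral
    of the error vanishes exactly, so only even second-order quantities remain, and the leading
    coefficient determines them. The drift survives as lost mass: the tilted law keeps the Gibbs
    normalization, hence is a sub-probability, and the coefficient 1/8, which comes from
    [cosh (y / 2) ~ 1 + y^2 / 8], makes the mass of the product tend to [e^(-s^2/8)]. The other
    obstacle is that the integrator is merely differentiable at each point, with no continuity of
    its Jacobian, so the change of variables for C^1 maps does not apply. Invariance of Lebesgue
    measure is obtained by bisecting boxes down to a point and using the affine approximation there;
    the effect of a matrix on volume is in turn derived from the uniqueness of translation-invariant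
    measures. *)

Section coordinate_boxes.
Context d (T : measurableType d) (R : realType) (I : finType).
Variable f : I -> T -> R.

Definition coordinate_box (a b : I -> R) : set T :=
  [set x | forall i, a i < f i x <= b i].

(* The sigma-algebra of T is the one generated by the coordinates f i. *)
Definition coordinate_generated := forall G : set (set T),
  sigma_algebra setT G ->
  (forall i B, measurable B -> G (f i @^-1` B)) -> measurable `<=` G.

Hypothesis mf : forall i, measurable_fun setT (f i).
Hypothesis gen : coordinate_generated.

Lemma measurable_coordinate_box a b : measurable (coordinate_box a b).
Proof.
rewrite (_ : coordinate_box a b = \bigcap_i (f i @^-1` `]a i, b i])).
  apply: fin_bigcap_measurable => // i _; rewrite -[X in measurable X]setTI.
  exact: mf.
by apply/seteqP; split => [x h i _|x h i]; have := h i; rewrite /= in_itv/=; apply.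
Qed.

Lemma coordinate_box_cover :
  \bigcup_k coordinate_box (fun=> - k%:R) (fun=> k%:R) = setT.
Proof.
apply/seteqP; split => // x _.
have /cid[k hk] : exists k : nat, forall i, `|f i x| < k%:R.
  exists (\max_i (Num.truncn `|f i x|).+1) => i.
  have := truncnS_gt `|f i x|; move=> /lt_le_trans; apply.
  by rewrite ler_nat; exact: leq_bigmax.
exists k => // i; have := hk i; rewrite ltr_norml => /andP[-> /ltW ->]//.
Qed.

(** The preimage of an interval under one coordinate is not a box, but it is the countable union
    over [k] of the boxes whose other sides are []-k, k]]. *)
Lemma measurable_coordinate_boxE : 
  measurable = <<s [set A | exists a b, A = coordinate_box a b] >>.
Proof.
apply/seteqP; split; last first.
  apply: smallest_sub; first exact: sigma_algebra_measurable.
  by move=> _ [a [b ->]]; exact: measurable_coordinate_box.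
set G := [set A | _].
apply: gen; first exact: smallest_sigma_algebra.
move=> i; pose H := [set B : set R | <<s G >> (f i @^-1` B)].
suff : @measurable _ R `<=` H by [].
apply: smallest_sub.
  split.
  - by rewrite /H /= preimage_set0; exact: sigma_algebra0.
  - move=> B HB; rewrite /H /= setTD preimage_setC -setTD.
    exact: sigma_algebraCD.
  - move=> F HF; rewrite /H /= preimage_bigcup; exact: sigma_algebra_bigcup.
move=> _ [[a b] _ <-]; rewrite /H /=.
rewrite (_ : f i @^-1` _ = \bigcup_k coordinate_box
    (fun j => if j == i then a else - k%:R) (fun j => if j == i then b else k%:R)).
  by apply: sigma_algebra_bigcup => k; apply: sub_sigma_algebra; eexists; eexists.
apply/seteqP; split => [x /= xab|x [k _] /(_ i)]; last first.
  by rewrite eqxx /= in_itv.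
have : (\bigcup_k coordinate_box (fun=> - k%:R) (fun=> k%:R)) x.
  by rewrite coordinate_box_cover.
move=> [k _ xk]; exists k => // j; case: eqP => [->|_].
  by move: xab; rewrite in_itv.
exact: xk.
Qed.

(** Boxes form a pi-system that generates the sigma-algebra and exhausts the space by sets of finite
    measure, so the uniqueness theorem for measures applies. *)
Lemma eq_measure_coordinate_box (m1 m2 : {measure set T -> \bar R}) :
  (forall a b, (m1 (coordinate_box a b) < +oo)%E) ->
  (forall a b, m1 (coordinate_box a b) = m2 (coordinate_box a b)) ->
  forall A, measurable A -> m1 A = m2 A.
Proof.
move=> moo mE A mA.
apply: (measure_unique [set A | exists a b, A = coordinate_box a b]
  (fun k => coordinate_box (fun=> - k%:R) (fun=> k%:R))) => //.
- exact: measurable_coordinate_boxE.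
- move=> _ _ [a [b ->]] [a' [b' ->]].
  exists (fun i => Num.max (a i) (a' i)), (fun i => Num.min (b i) (b' i)).
  apply/seteqP; split => [x [h h'] i|x h].
    by rewrite gt_max le_min; have /andP[-> ->] := h i; have /andP[-> ->] := h' i.
  by split=> i; have := h i; rewrite gt_max le_min => /andP[/andP[? ?] /andP[? ?]]; apply/andP.
- by move=> k; eexists; eexists.
- exact: coordinate_box_cover.
- by move=> _ [a [b ->]].
Qed.

Lemma measurable_fun_coordinateP d' (T' : measurableType d') (g : T' -> T) :
  (forall i, measurable_fun setT (f i \o g)) -> measurable_fun setT g.
Proof.
move=> mg _; suff : measurable `<=` [set A | measurable (setT `&` g @^-1` A)] by [].
apply: gen.
  split.
  - by rewrite /= preimage_set0 setI0.
  - move=> B; rewrite /= !setTI setTD preimage_setC => mB; exact: measurableC.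
  - move=> F mF; rewrite /= setTI preimage_bigcup.
    by apply: bigcupT_measurable => i; have := mF i; rewrite /= setTI.
by move=> i B mB /=; rewrite -comp_preimage; exact: mg.
Qed.

End coordinate_boxes.

Section matrix_coordinates.
Context (R : realType) (n m : nat).

Definition mx_coord (ij : 'I_n * 'I_m) (M : 'M[R]_(n, m)) : R := M ij.1 ij.2.

Lemma measurable_mx_coord ij : measurable_fun setT (mx_coord ij).
Proof.
have := measurableT_comp (measurable_tnth ij.2)
  (measurableT_comp (measurable_tnth ij.1) (@measurable_tuple_of_mx R n m)).
apply: eq_measurable_fun => M _ /=; by rewrite !tnth_mktuple.
Qed.

(** When the matrices carry [G] as sigma-algebra, [tuple_of_mx] is measurable because its entries
    are; since the measurable sets of matrices are its preimages, they all lie in [G]. *)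
Lemma mx_coord_generated : coordinate_generated mx_coord.
Proof.
move=> G sG hG _ [B mB <-].
rewrite -(sigma_algebra_id sG).
have mt : measurable_fun setT
    (@tuple_of_mx R n m : g_sigma_algebraType G -> n.-tuple (m.-tuple (measurableTypeR R))).
  apply/measurable_fun_tnthP => i; apply/measurable_fun_tnthP => j _ C mC.
  rewrite setTI; apply: sub_sigma_algebra.
  have := hG (i, j) C mC; congr (G _); apply/seteqP.
  by split => M /=; rewrite !tnth_mktuple.
exact: mt.
Qed.

End matrix_coordinates.

Lemma measurable_fun_mx d (T : measurableType d) (R : realType) n m
    (g : T -> 'M[R]_(n, m)) :
  (forall i j, measurable_fun setT (fun x => g x i j)) -> measurable_fun setT g.
Proof.
move=> mg; apply: (measurable_fun_coordinateP (@mx_coord_generated R n m)).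
by move=> -[i j]; exact: mg.
Qed.

Lemma measurable_mx_ball (R : realType) n m (x : 'M[R]_(n, m)) (e : R) :
  measurable (ball x e).
Proof.
have [e0|e0] := ltP 0 e; last first.
  rewrite (_ : ball x e = set0)//; apply/seteqP; split => // y [].
  by rewrite ltNge e0.
rewrite (_ : ball x e =
    \bigcap_ij (mx_coord ij @^-1` (ball (x ij.1 ij.2) e))).
  apply: fin_bigcap_measurable => // ij _; rewrite -[X in measurable X]setTI.
  by apply: measurable_mx_coord => //; apply: open_measurable; exact: ball_open.
apply/seteqP; split => [y [_ xy] ij _|y xy]; first exact: xy.
by split => // i j; exact: (xy (i, j)).
Qed.

(** Second countability links the topology to the sigma-algebra: an open set is the union of the
    balls with rational centre and radius [1 / (k + 1)] that it contains. *)
Lemma open_measurable_mx (R : realType) n m (U : set 'M[R]_(n, m)) :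
  open U -> measurable U.
Proof.
move=> oU.
pose q (M : 'M[rat]_(n, m)) : 'M[R]_(n, m) := map_mx ratr M.
pose B (Mk : 'M[rat]_(n, m) * nat) := ball (q Mk.1) (Mk.2.+1%:R^-1).
rewrite (_ : U = \bigcup_Mk (if `[< B Mk `<=` U >] then B Mk else set0)).
  apply: countable_bigcupT_measurable => // Mk.
  by case: ifP => // _; exact: measurable_mx_ball.
apply/seteqP; split => [x Ux|x [Mk _]]; last by case: asboolP => // + ?; apply.
have /nbhs_ballP[e /= e0 xeU] : nbhs x U by exact: open_nbhs_nbhs.
pose k := Num.truncn (2 / e).
have ke : k.+1%:R^-1 < e / 2.
  rewrite -[e / 2]invrK ltf_pV2 ?posrE ?invr_gt0 ?divr_gt0 ?invf_div//.
  exact: truncnS_gt.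
have /choice[M hM] : forall ij : 'I_n * 'I_m, exists r : rat,
    ball (x ij.1 ij.2) k.+1%:R^-1 (ratr r).
  move=> ij; have [] := @dense_rat R (ball (x ij.1 ij.2) k.+1%:R^-1).
  - by exists (x ij.1 ij.2); apply: ballxx; rewrite invr_gt0.
  - exact: ball_open.
  by move=> y [xy [r _ ry]]; exists r; rewrite ry.
exists (\matrix_(i, j) M (i, j), k) => //.
have xB : ball x k.+1%:R^-1 (q (\matrix_(i, j) M (i, j))).
  by split=> [|i j]; [rewrite invr_gt0|rewrite !mxE; exact: (hM (i, j))].
case: asboolP => [_|]; first exact: ball_sym.
case=> y /= By; apply: xeU; rewrite (splitr e).
apply: (@ball_triangle _ _ (q (\matrix_(i, j) M (i, j)))).
  by apply: le_ball xB; exact: ltW.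
by apply: le_ball By; exact: ltW.
Qed.

Lemma continuous_measurable_mx (R : realType) n m (f : 'M[R]_(n, m) -> R) :
  continuous f -> measurable_fun setT f.
Proof.
move=> /continuousP cf; apply: (measurability _ (RGenOpens.measurableE R)).
move=> _ [_ [a [b ->] <-]]; rewrite setTI; apply: open_measurable_mx.
by apply: cf; exact: interval_open.
Qed.

Section lebesgue_mx_coordinate.
Context (R : realType) (n m : nat).
Local Open Scope ereal_scope.

Lemma lebesgue_mx_coordinate_box (a b : 'I_n * 'I_m -> R) :
  lebesgue_mx (coordinate_box (@mx_coord R n m) a b) =
  \prod_(i < n) \prod_(j < m) (Num.max 0 (b (i, j) - a (i, j)))%:E.
Proof.
rewrite (_ : coordinate_box _ a b =
    [set M : 'M[R]_(n, m) | forall i j, `]a (i, j), b (i, j)]%classic (M i j)]).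
  rewrite (lebesgue_mx_box (A := fun i j => `]a (i, j), b (i, j)]%classic)); last by move=> i j; exact: measurable_itv.
  apply: eq_bigr => i _; apply: eq_bigr => j _.
  rewrite lebesgue_measure_itv /= lte_fin; case: ltP => [ab|ba].
    by rewrite max_r ?subr_ge0 1?ltW.
  by rewrite max_l// subr_le0.
apply/seteqP; split=> M h; first by move=> i j /=; rewrite in_itv; exact: (h (i, j)).
by move=> [i j]; have := h i j; rewrite /= in_itv.
Qed.

End lebesgue_mx_coordinate.

Section phase_coordinates.
Context (R : realType) (d m : nat).

Definition phase_coord (s : 'I_d * 'I_m + 'I_d * 'I_m) (Z : 'M[R]_(d, m) * 'M[R]_(d, m)) : R :=
  match s with inl ij => mx_coord ij Z.1 | inr ij => mx_coord ij Z.2 end.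

Lemma measurable_phase_coord s : measurable_fun setT (phase_coord s).
Proof.
case: s => ij; apply: measurableT_comp; [|exact: measurable_fst| |exact: measurable_snd];
exact: measurable_mx_coord.
Qed.

Lemma phase_coord_generated : coordinate_generated phase_coord.
Proof.
move=> G sG hG; rewrite -(sigma_algebra_id sG).
apply: smallest_sub; first exact: smallest_sigma_algebra.
have sGG : sigma_algebra setT <<s G>> by exact: smallest_sigma_algebra.
move=> _ [|] [A mA <-]; rewrite setTI.
  suff : measurable `<=` [set A : set 'M[R]_(d, m) |
     <<s G>> ((fst : 'M[R]_(d, m) * 'M[R]_(d, m) -> _) @^-1` A)] by apply.
  apply: mx_coord_generated.
    split.
    - by rewrite /= preimage_set0; exact: sigma_algebra0.
    - by move=> B ?; rewrite /= setTD preimage_setC -setTD; exact: sigma_algebraCD.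
    - by move=> F ?; rewrite /= preimage_bigcup; exact: sigma_algebra_bigcup.
  by move=> ij B mB; apply: sub_sigma_algebra; exact: (hG (inl ij)).
suff : measurable `<=` [set A : set 'M[R]_(d, m) |
   <<s G>> ((snd : 'M[R]_(d, m) * 'M[R]_(d, m) -> _) @^-1` A)] by apply.
apply: mx_coord_generated.
  split.
  - by rewrite /= preimage_set0; exact: sigma_algebra0.
  - by move=> B ?; rewrite /= setTD preimage_setC -setTD; exact: sigma_algebraCD.
  - by move=> F ?; rewrite /= preimage_bigcup; exact: sigma_algebra_bigcup.
by move=> ij B mB; apply: sub_sigma_algebra; exact: (hG (inr ij)).
Qed.

Lemma lebesgue_phase_coordinate_box (a b : 'I_d * 'I_m + 'I_d * 'I_m -> R) :
  (lebesgue_phase R d m (coordinate_box phase_coord a b) =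
  lebesgue_mx (coordinate_box (@mx_coord R d m) (a \o inl) (b \o inl)) *
  lebesgue_mx (coordinate_box (@mx_coord R d m) (a \o inr) (b \o inr)))%E.
Proof.
rewrite /lebesgue_phase -product_measure1E; [|exact: measurable_coordinate_box (@measurable_mx_coord R d m) _ _..].
congr (_ _); apply/seteqP; split => [Z h|Z [h h']].
  by split=> ij; [exact: (h (inl ij))|exact: (h (inr ij))].
by case=> ij; [exact: h|exact: h'].
Qed.

End phase_coordinates.

(** * Maps that transport one measure to another *)

Section measure_preserving.
Context d1 d2 (T1 : measurableType d1) (T2 : measurableType d2) (R : realType).

(** Two measures are allowed, so that one set of transfer lemmas serves self-maps, identifications
    of different spaces, and dilations, for which [mu2] is a multiple of Lebesgue measure. *)
Definition measure_preserving (mu1 : set T1 -> \bar R) (mu2 : set T2 -> \bar R)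
    (F : T1 -> T2) :=
  measurable_fun setT F /\ forall A, measurable A -> mu1 (F @^-1` A) = mu2 A.

Section maps.
Variables (mu1 : {measure set T1 -> \bar R}) (mu2 : {measure set T2 -> \bar R}).
Variable F : T1 -> T2.

Lemma measure_preserving_boxes (I : finType) (f : I -> T2 -> R) :
  (forall i, measurable_fun setT (f i)) -> coordinate_generated f ->
  measurable_fun setT F ->
  (forall a b, (mu2 (coordinate_box f a b) < +oo)%E) ->
  (forall a b, mu1 (F @^-1` coordinate_box f a b) = mu2 (coordinate_box f a b)) ->
  measure_preserving mu1 mu2 F.
Proof.
move=> mf gf mF fin h; split => // A mA.
pose m : {measure set T2 -> \bar R} :=
  measure_function_pushforward__canonical__measure_function_Measure mu1 mF.
suff : mu2 A = m A by [].
by apply: (@eq_measure_coordinate_box _ _ _ _ _ mf gf mu2 m) => // a b; rewrite -h.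
Qed.

Hypothesis FP : measure_preserving mu1 mu2 F.
Local Open Scope ereal_scope.

Lemma ge0_integral_measure_preserving (f : T2 -> \bar R) :
  measurable_fun setT f -> (forall y, 0 <= f y) ->
  \int[mu2]_y f y = \int[mu1]_x f (F x).
Proof.
case: FP => mF mE mf f0.
rewrite (@eq_measure_integral _ _ _ _ (pushforward mu1 F)); last first.
  by move=> A mA _; apply/esym; exact: mE.
by rewrite ge0_integral_pushforward// preimage_setT.
Qed.

Lemma integrable_measure_preserving (f : T2 -> \bar R) :
  measurable_fun setT f ->
  mu2.-integrable setT f <-> mu1.-integrable setT (f \o F).
Proof.
move=> mf; have [mF _] := FP.
have mfF : measurable_fun setT (f \o F) by exact: measurableT_comp.
have E : \int[mu2]_y `|f y| = \int[mu1]_x `|f (F x)|.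
  apply: (@ge0_integral_measure_preserving (abse \o f)) => [|y].
    exact: measurableT_comp.
  exact: abse_ge0.
split=> /integrableP[_ h]; apply/integrableP; split => //.
  by rewrite /= -E.
by rewrite E.
Qed.

Lemma integral_measure_preserving (f : T2 -> \bar R) :
  measurable_fun setT f -> mu2.-integrable setT f ->
  \int[mu2]_y f y = \int[mu1]_x f (F x).
Proof.
move=> mf intf; have [mF mE] := FP.
rewrite (@eq_measure_integral _ _ _ _ (pushforward mu1 F)); last first.
  by move=> A mA _; apply/esym; exact: mE.
rewrite integral_pushforward// preimage_setT//.
exact/integrable_measure_preserving.
Qed.

End maps.
End measure_preserving.

Section lebesgue_phase_sigma_finite.
Context (R : realType) (d m : nat).

(* Phase-space Lebesgue measure again, under a name of its own so that its
   sigma-finiteness can be registered as an instance. *)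
Definition phase_measure : set ('M[R]_(d, m) * 'M[R]_(d, m)) -> \bar R :=
  lebesgue_phase R d m.

HB.instance Definition _ := Measure.copy phase_measure (lebesgue_phase R d m).
HB.instance Definition _ := Measure_isSigmaFinite.Build _ _ _ phase_measure
  (product_measure1_sigma_finite (@lebesgue_mx R d m) (@lebesgue_mx R d m)).

End lebesgue_phase_sigma_finite.

Section box_finite.
Context (R : realType) (d m : nat).

Lemma lebesgue_mx_coordinate_box_lty (a b : 'I_d * 'I_m -> R) :
  (lebesgue_mx (coordinate_box (@mx_coord R d m) a b) < +oo)%E.
Proof.
rewrite lebesgue_mx_coordinate_box.
under eq_bigr do rewrite prodEFin.
by rewrite prodEFin ltry.
Qed.

Lemma lebesgue_phase_coordinate_box_lty (a b : 'I_d * 'I_m + 'I_d * 'I_m -> R) :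
  (lebesgue_phase R d m (coordinate_box (@phase_coord R d m) a b) < +oo)%E.
Proof.
by rewrite lebesgue_phase_coordinate_box lte_mul_pinfty//
  ?ge0_fin_numE// lebesgue_mx_coordinate_box_lty.
Qed.

End box_finite.

(** * Identifications and dilations of phase space *)

Section merge.
Context (R : realType) (d m : nat).
Local Notation mxpair d := ('M[R]_(d, m) * 'M[R]_(d, m))%type.

(** This stacking of one component on top of [d] others drives the induction on the number of
    components: integrals over [d.+1] rows become integrals over a product measure. *)
Definition phase_cons (zZ : (phase R 1 m * phase R d m)%type) : phase R d.+1 m :=
  ((col_mx zZ.1.1 zZ.2.1 : 'M[R]_(1 + d, m)), (col_mx zZ.1.2 zZ.2.2 : 'M[R]_(1 + d, m))).

Lemma measurable_phase_cons : measurable_fun setT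
  (phase_cons : (mxpair 1 * mxpair d)%type -> mxpair d.+1).
Proof.
apply/measurable_fun_pairP; split; apply: measurable_fun_mx => i j.
  have : measurable_fun [set: mxpair 1 * mxpair d]
    (fun zZ => (col_mx zZ.1.1 zZ.2.1 : 'M[R]_(1 + d, m)) i j); last by apply.
  rewrite -(@splitK 1 d i); case: (@fintype.split 1 d i) => k /=.
    under eq_fun do rewrite col_mxEu.
    by apply: (measurableT_comp (measurable_mx_coord (k, j))); apply: measurableT_comp.
  under eq_fun do rewrite col_mxEd.
  by apply: (measurableT_comp (measurable_mx_coord (k, j))); apply: measurableT_comp.
have : measurable_fun [set: mxpair 1 * mxpair d]
  (fun zZ => (col_mx zZ.1.2 zZ.2.2 : 'M[R]_(1 + d, m)) i j); last by apply.
rewrite -(@splitK 1 d i); case: (@fintype.split 1 d i) => k /=.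
  under eq_fun do rewrite col_mxEu.
  by apply: (measurableT_comp (measurable_mx_coord (k, j))); apply: measurableT_comp.
under eq_fun do rewrite col_mxEd.
by apply: (measurableT_comp (measurable_mx_coord (k, j))); apply: measurableT_comp.
Qed.

Lemma measure_preserving_phase_cons :
  measure_preserving (@phase_measure R 1 m \x @phase_measure R d m)%E
    (@phase_measure R d.+1 m) phase_cons.
Proof.
apply: (measure_preserving_boxes (@measurable_phase_coord R d.+1 m)
  (@phase_coord_generated R d.+1 m)).
- exact: measurable_phase_cons.
- exact: lebesgue_phase_coordinate_box_lty.
move=> a b.
pose up (c : 'I_d.+1 * 'I_m + 'I_d.+1 * 'I_m -> R)
    (s : 'I_1 * 'I_m + 'I_1 * 'I_m) : R :=
  match s with inl ij => c (inl (lshift d ij.1, ij.2))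
    | inr ij => c (inr (lshift d ij.1, ij.2)) end.
pose dn (c : 'I_d.+1 * 'I_m + 'I_d.+1 * 'I_m -> R)
    (s : 'I_d * 'I_m + 'I_d * 'I_m) : R :=
  match s with inl ij => c (inl (rshift 1 ij.1, ij.2))
    | inr ij => c (inr (rshift 1 ij.1, ij.2)) end.
rewrite (_ : phase_cons @^-1` _ =
   coordinate_box (@phase_coord R 1 m) (up a) (up b) `*`
   coordinate_box (@phase_coord R d m) (dn a) (dn b)); last first.
  apply/seteqP; split.
    move=> [[q p] [Q P]] h; split=> -[] [i j] /=.
    - by rewrite /mx_coord /= -(col_mxEu q Q); exact: (h (inl (lshift d i, j))).
    - by rewrite /mx_coord /= -(col_mxEu p P); exact: (h (inr (lshift d i, j))).
    - by rewrite /mx_coord /= -(col_mxEd q Q); exact: (h (inl (rshift 1 i, j))).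
    - by rewrite /mx_coord /= -(col_mxEd p P); exact: (h (inr (rshift 1 i, j))).
  move=> [[q p] [Q P]] [/= h1 h2] [] [i j] /=; rewrite /mx_coord /=.
    rewrite -(@splitK 1 d i); case: (@fintype.split 1 d i) => k /=.
      by have := h1 (inl (k, j)); rewrite /= /mx_coord /= -(col_mxEu q Q).
    by have := h2 (inl (k, j)); rewrite /= /mx_coord /= -(col_mxEd q Q).
  rewrite -(@splitK 1 d i); case: (@fintype.split 1 d i) => k /=.
    by have := h1 (inr (k, j)); rewrite /= /mx_coord /= -(col_mxEu p P).
  by have := h2 (inr (k, j)); rewrite /= /mx_coord /= -(col_mxEd p P).
rewrite [LHS]product_measure1E; [|exact: measurable_coordinate_box (@measurable_phase_coord R _ m) _ _..].
rewrite /= /phase_measure !lebesgue_phase_coordinate_box !lebesgue_mx_coordinate_box.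
rewrite ![in RHS]big_ord_recl ![in LHS]big_ord_recl !big_ord0 !mule1.
have E : lshift d (@ord0 0) = ord0 by exact/val_inj.
have E1 (k : 'I_d) : rshift 1 k = lift ord0 k by exact/val_inj.
rewrite muleACA; congr (_ * _ * (_ * _))%E; apply: eq_bigr => k _; rewrite /= ?E//;
by apply: eq_bigr => j _; rewrite E1.
Qed.

End merge.

Section phase_row.
Context (R : realType) (m : nat).
Local Notation mxpair d := ('M[R]_(d, m) * 'M[R]_(d, m))%type.

Definition phase_of_row (x : 'rV[R]_(m + m)) : phase R 1 m := (lsubmx x, rsubmx x).

Lemma measurable_phase_of_row :
  measurable_fun setT (phase_of_row : 'rV[R]_(m + m) -> mxpair 1).
Proof.
apply/measurable_fun_pairP; split; apply: measurable_fun_mx => i j.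
  have := @measurable_mx_coord R 1 (m + m) (i, lshift m j).
  by apply: eq_measurable_fun => x _; rewrite /= mxE.
have := @measurable_mx_coord R 1 (m + m) (i, rshift m j).
by apply: eq_measurable_fun => x _; rewrite /= mxE.
Qed.

(** Jacobians are taken on row vectors of length [m + m], while integrals are over pairs; this
    identification carries invariance from the former to the latter. *)
Lemma measure_preserving_phase_of_row :
  measure_preserving (@lebesgue_mx R 1 (m + m)) (@phase_measure R 1 m) phase_of_row.
Proof.
apply: (measure_preserving_boxes (@measurable_phase_coord R 1 m)
  (@phase_coord_generated R 1 m)).
- exact: measurable_phase_of_row.
- exact: lebesgue_phase_coordinate_box_lty.
move=> a b.
pose un (c : 'I_1 * 'I_m + 'I_1 * 'I_m -> R) (ij : 'I_1 * 'I_(m + m)) : R :=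
  match fintype.split ij.2 with inl j => c (inl (ij.1, j)) | inr j => c (inr (ij.1, j)) end.
rewrite (_ : phase_of_row @^-1` _ =
   coordinate_box (@mx_coord R 1 (m + m)) (un a) (un b)); last first.
  apply/seteqP; split => x h.
    move=> [i j]; rewrite /un /=; case: fintype.splitP => k jk.
      have -> : j = lshift m k by exact/val_inj.
      by have := h (inl (i, k)); rewrite /= /mx_coord /= mxE.
    have -> : j = rshift m k by exact/val_inj.
    by have := h (inr (i, k)); rewrite /= /mx_coord /= mxE.
  move=> [] [i k]; rewrite /= /mx_coord /= mxE.
    by have := h (i, lshift m k); rewrite /un /= (unsplitK (inl k)).
  by have := h (i, rshift m k); rewrite /un /= (unsplitK (inr k)).
rewrite /phase_measure lebesgue_phase_coordinate_box !lebesgue_mx_coordinate_box.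
rewrite [LHS]lebesgue_mx_coordinate_box.
rewrite !big_ord1 !prodEFin -EFinM; congr (_%:E).
rewrite big_split_ord /un /=; congr (_ * _); apply: eq_bigr => k _.
  by rewrite (unsplitK (inl k)).
by rewrite (unsplitK (inr k)).
Qed.

End phase_row.

Section phase_scale.
Context (R : realType) (m : nat).
Local Notation mxpair d := ('M[R]_(d, m) * 'M[R]_(d, m))%type.

Definition phase_scale (l : R) (z : phase R 1 m) : phase R 1 m := (l^-1 *: z.1, z.2).

Lemma measurable_phase_scale l :
  measurable_fun setT (phase_scale l : mxpair 1 -> mxpair 1).
Proof.
apply/measurable_fun_pairP; split; last exact: measurable_snd.
apply: measurable_fun_mx => i j; under eq_fun do rewrite mxE.
apply: measurable_funM => //; apply: (measurableT_comp (measurable_mx_coord (i, j))).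
exact: measurable_fst.
Qed.

(** Only the [m] position coordinates are divided by [l], so the preimage of a box has [l ^+ m]
    times its volume. *)
Lemma measure_preserving_phase_scale l (l0 : 0 < l) :
  measure_preserving (@phase_measure R 1 m)
    (mscale (NngNum (exprn_ge0 m (ltW l0))) (@phase_measure R 1 m)) (phase_scale l).
Proof.
apply: (measure_preserving_boxes (@measurable_phase_coord R 1 m)
  (@phase_coord_generated R 1 m)).
- exact: measurable_phase_scale.
- move=> a b; rewrite /= /mscale lte_mul_pinfty ?ltry//= ?lee_fin ?exprn_ge0 1?ltW//.
  exact: lebesgue_phase_coordinate_box_lty.
move=> a b.
pose sc (c : 'I_1 * 'I_m + 'I_1 * 'I_m -> R) (s : 'I_1 * 'I_m + 'I_1 * 'I_m) : R :=
  match s with inl _ => l * c s | inr _ => c s end.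
rewrite (_ : phase_scale l @^-1` _ =
   coordinate_box (@phase_coord R 1 m) (sc a) (sc b)); last first.
  apply/seteqP; split => -[q p] h [] [i j].
  - have := h (inl (i, j)); rewrite /= /mx_coord /= mxE.
    by rewrite ltr_pdivlMl// ler_pdivrMl.
  - exact: (h (inr (i, j))).
  - have := h (inl (i, j)); rewrite /= /mx_coord /= mxE.
    by rewrite ltr_pdivlMl// ler_pdivrMl.
  - exact: (h (inr (i, j))).
rewrite /= /mscale /= /phase_measure !lebesgue_phase_coordinate_box !lebesgue_mx_coordinate_box.
rewrite !big_ord1 /= muleA; congr (_ * _)%E; rewrite !prodEFin -EFinM; congr (_%:E).
rewrite -[m in l ^+ m]card_ord -prodr_const -big_split /=; apply: eq_bigr => j _.
by rewrite -mulrBr maxr_pMr ?mulr0 1?ltW.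
Qed.

End phase_scale.

(** * Lebesgue measure under linear maps *)

Section translation.
Context (R : realType) (n m : nat).
Local Notation M := 'M[R]_(n, m).

Lemma measurable_mxD d (T : measurableType d) (f g : T -> M) :
  measurable_fun setT f -> measurable_fun setT g ->
  measurable_fun setT (fun x => f x + g x).
Proof.
move=> mf mg; apply: measurable_fun_mx => i j; under eq_fun do rewrite mxE.
by apply: measurable_funD; apply: (measurableT_comp (measurable_mx_coord (i, j))).
Qed.

Lemma measurable_mxN d (T : measurableType d) (f : T -> M) :
  measurable_fun setT f -> measurable_fun setT (fun x => - f x).
Proof.
move=> mf; apply: measurable_fun_mx => i j; under eq_fun do rewrite mxE.
by apply: measurableT_comp => //; apply: (measurableT_comp (measurable_mx_coord (i, j))).
Qed.

Lemma measure_preserving_translation (v : M) :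
  measure_preserving (@lebesgue_mx R n m) (@lebesgue_mx R n m) (fun x => x + v).
Proof.
apply: (measure_preserving_boxes (@measurable_mx_coord R n m) (@mx_coord_generated R n m)).
- by apply: measurable_mxD; [exact: measurable_id|exact: measurable_cst].
- exact: lebesgue_mx_coordinate_box_lty.
move=> a b; rewrite (_ : _ @^-1` _ = coordinate_box (@mx_coord R n m)
    (fun ij => a ij - mx_coord ij v) (fun ij => b ij - mx_coord ij v)).
  rewrite [LHS]lebesgue_mx_coordinate_box [RHS]lebesgue_mx_coordinate_box.
  apply: eq_bigr => i _; apply: eq_bigr => j _; congr (Num.max _ _)%:E; ring.
apply/seteqP; split => x h ij; have := h ij; rewrite /= /mx_coord /= mxE.
  by rewrite ltrBlDr lerBrDr.
by rewrite ltrBlDr lerBrDr.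
Qed.

Definition translation_invariant (mu : set M -> \bar R) :=
  forall v, measure_preserving mu mu (fun x : M => x + v).

(* Uniqueness of Haar measure: compare [\int\int 1_A(x) 1_B(y) dmu(x) dleb(y)]
   with its image under the substitutions [y -> y - x] and then [x -> x + y]. *)
Lemma translation_invariant_unique (mu : {sigma_finite_measure set M -> \bar R})
    (A B : set M) :
  translation_invariant mu -> measurable A -> measurable B ->
  (forall x, B (- x) <-> B x) ->
  (mu A * lebesgue_mx B = mu B * lebesgue_mx A)%E.
Proof.
move=> muT mA mB BN; pose leb := @lebesgue_mx R n m.
have mAB d (T : measurableType d) (f g : T -> M) : measurable_fun setT f -> measurable_fun setT g ->
    measurable_fun setT (fun z => (\1_A (f z) * \1_B (g z))%:E).
  move=> mf mg; apply/measurable_EFinP; apply: measurable_funM.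
    by apply: measurableT_comp => //; exact: measurable_indic.
  by apply: measurableT_comp => //; exact: measurable_indic.
have mI d (T : measurableType d) (C : set M) (f : T -> M) (k : R) : measurable C -> measurable_fun setT f ->
    measurable_fun setT (fun z => (k * \1_C (f z))%:E).
  move=> mC mf; apply/measurable_EFinP; apply: measurable_funM => //.
  by apply: measurableT_comp => //; exact: measurable_indic.
have intI (nu : {measure set M -> \bar R}) (C : set M) (k : R) : measurable C -> 0 <= k ->
    (\int[nu]_x (k * \1_C x)%:E = k%:E * nu C)%E.
  move=> mC k0; under eq_integral do rewrite EFinM.
  rewrite ge0_integralZl//.
  - by rewrite integral_indic// setIT.
  - by apply/measurable_EFinP; exact: measurable_indic.
transitivity (\int[mu]_x \int[leb]_y (\1_A x * \1_B y)%:E)%E.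
  under eq_integral do rewrite intI//.
  rewrite ge0_integralZr//=.
  - by rewrite integral_indic// setIT.
  - by apply/measurable_EFinP; exact: measurable_indic.
transitivity (\int[mu]_x \int[leb]_y (\1_A x * \1_B (y - x))%:E)%E.
  apply: eq_integral => x _.
  rewrite (ge0_integral_measure_preserving (measure_preserving_translation (- x))
    (f := fun y => (\1_A x * \1_B y)%:E)) //.
  exact: mI.
rewrite (@fubini_tonelli _ _ _ _ _ mu leb (fun z => (\1_A z.1 * \1_B (z.2 - z.1))%:E)); last 2 first.
- apply: mAB; first exact: measurable_fst.
  by apply: measurable_mxD => //; apply: measurable_mxN.
- by move=> z; rewrite lee_fin mulr_ge0.
transitivity (\int[leb]_y \int[mu]_x (\1_A (x + y) * \1_B (- x))%:E)%E.
  apply: eq_integral => y _.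
  rewrite (ge0_integral_measure_preserving (muT y)
    (f := fun x => (\1_A x * \1_B (y - x))%:E)).
  - by apply: eq_integral => x _; rewrite opprD [- x - y]addrC addNKr.
  - apply: mAB; first exact: measurable_id.
    apply: measurable_mxD; first exact: measurable_cst.
    by apply: measurable_mxN; exact: measurable_id.
  - by move=> z; rewrite lee_fin mulr_ge0.
rewrite -(@fubini_tonelli _ _ _ _ _ mu leb (fun z => (\1_A (z.1 + z.2) * \1_B (- z.1))%:E)); last 2 first.
- by apply: mAB; [apply: measurable_mxD|apply: measurable_mxN].
- by move=> z; rewrite lee_fin mulr_ge0.
transitivity (\int[mu]_x ((\1_B x)%:E * leb A))%E; last first.
  rewrite ge0_integralZr//=.
  - by rewrite integral_indic// setIT.
  - by apply/measurable_EFinP; exact: measurable_indic.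
apply: eq_integral => x _.
(* The substitutions end with [B (- x)]; this is where the symmetry of [B] enters. *)
have -> : \1_B x = \1_B (- x) :> R.
  rewrite !indicE; suff -> : (x \in B) = (- x \in B) by [].
  by apply/idP/idP; rewrite !inE => /BN.
rewrite -[RHS](intI (@lebesgue_mx R n m : {measure set M -> \bar R}))//.
rewrite (ge0_integral_measure_preserving (measure_preserving_translation x)
  (f := fun y => (\1_B (- x) * \1_A y)%:E)).
- by apply: eq_integral => y _; rewrite mulrC addrC.
- exact: mI.
- by move=> y; rewrite lee_fin mulr_ge0.
Qed.

End translation.

Section linear_scaling.
Context (R : realType) (n : nat).
Local Notation N := n.+1.
Local Notation rV := 'rV[R]_N.
Local Notation leb := (@lebesgue_mx R 1 N).

Definition cube (r : R) : set rV := [set x | forall i j, x i j \in `[- r, r]].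

Lemma measurable_cube r : measurable (cube r).
Proof.
rewrite (_ : cube r = \bigcap_ij (mx_coord ij @^-1` `[- r, r])).
  apply: fin_bigcap_measurable => // ij _; rewrite -[X in measurable X]setTI.
  exact: measurable_mx_coord.
by apply/seteqP; split => [x h ij _|x h i j]; [exact: h|exact: (h (i, j))].
Qed.

Lemma lebesgue_cube r : 0 <= r -> leb (cube r) = ((r *+ 2) ^+ N)%:E.
Proof.
move=> r0; rewrite (lebesgue_mx_box (A := fun _ _ => `[- r, r]%classic)); last first.
  by move=> _ _; exact: measurable_itv.
rewrite big_ord1 lebesgue_measure_itv /= lte_fin.
have -> : (if - r < r then (r%:E - (- r)%:E)%E else 0%E) = (r *+ 2)%:E.
  case: ltP => rr; first by rewrite -EFinB opprK mulr2n.
  have -> : r = 0 by lra.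
  by rewrite mul0rn.
by rewrite prodEFin prodr_const card_ord.
Qed.

Lemma measurable_mulmx d (T : measurableType d) (f : T -> rV) (A : 'M[R]_N) :
  measurable_fun setT f -> measurable_fun setT (fun x => f x *m A).
Proof.
move=> mf; apply: measurable_fun_mx => i j; under eq_fun do rewrite mxE.
apply: measurable_sum => k; apply: measurable_funM => //.
exact: (measurableT_comp (measurable_mx_coord (i, k))).
Qed.

(** The image of Lebesgue measure under [x |-> x *m A] is again translation invariant, because a
    shift by [v] after [A] is a shift by [v *m invmx A] before it. Uniqueness then gives
    proportionality, and the cube serves as the symmetric reference set. *)
Lemma lebesgue_mulmx (A : 'M[R]_N) (B : set rV) : A \in unitmx -> measurable B ->
  (leb ((mulmx^~ A) @^-1` B) * leb (cube 1) = leb ((mulmx^~ A) @^-1` cube 1) * leb B)%E.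
Proof.
move=> uA mB.
have mA (C : 'M[R]_N) : measurable_fun setT (fun x : rV => x *m C).
  exact: (@measurable_mulmx _ _ id).
have sA : sigma_finite setT (pushforward leb (fun x : rV => x *m A)).
  by apply: (pushforward_sigma_finite (mA (invmx A)) (mulmxK uA)); exact: sigma_finiteT.
pose mu0 : {measure set rV -> \bar R} :=
  measure_function_pushforward__canonical__measure_function_Measure leb (mA A).
pose mu : {sigma_finite_measure set rV -> \bar R} :=
  HB.pack (mu0 : set rV -> \bar R) mu0
    (Measure_isSigmaFinite.Build _ _ _ (mu0 : set rV -> \bar R) sA).
apply: (@translation_invariant_unique R 1 N mu) => //.
- move=> v; split; first by apply: measurable_mxD; [exact: measurable_id|exact: measurable_cst].
  move=> C mC; rewrite /= /pushforward.
  have [_ h] := measure_preserving_translation (v *m invmx A).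
  rewrite -[RHS]h; last by rewrite -[X in measurable X]setTI; exact: (mA A).
  congr (leb _); apply/seteqP; split => x /=; by rewrite mulmxDl mulmxKV.
- exact: measurable_cube.
- move=> x; split => h i j; have := h i j; rewrite ?mxE !in_itv /= => /andP[? ?];
  apply/andP; split; lra.
Qed.

(** The factor by which taking preimages under [A] multiplies volume, read off the unit cube of
    volume [2 ^ N]; it turns out to be [1 / |det A|]. *)
Definition lscale (A : 'M[R]_N) : R :=
  fine (leb ((mulmx^~ A) @^-1` cube 1)) / (1 *+ 2) ^+ N.

Lemma measurable_mulmx_preimage (A : 'M[R]_N) (B : set rV) : measurable B ->
  measurable ((mulmx^~ A) @^-1` B).
Proof.
by move=> mB; rewrite -[X in measurable X]setTI; exact: (@measurable_mulmx _ _ id).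
Qed.

Lemma lebesgue_cube_gt0 : 0 < ((1 : R) *+ 2) ^+ N.
Proof. by rewrite exprn_gt0. Qed.

(** Writing [x] as [x *m A *m invmx A] bounds its entries by the sum of those of [invmx A] in
    absolute value, so the preimage lies in a larger cube. *)
Lemma mulmx_preimage_cube_lty (A : 'M[R]_N) : A \in unitmx ->
  (leb ((mulmx^~ A) @^-1` cube 1) < +oo)%E.
Proof.
move=> uA; pose r := \sum_k \sum_j `|invmx A k j|.
have r0 : 0 <= r by rewrite sumr_ge0// => k _; rewrite sumr_ge0.
apply: (@le_lt_trans _ _ (leb (cube r))); last by rewrite lebesgue_cube// ltry.
apply: le_measure; rewrite ?inE.
- by apply: measurable_mulmx_preimage; exact: measurable_cube.
- exact: measurable_cube.
move=> x /= h i j; rewrite in_itv /= -ler_norml.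
rewrite -(mulmxK uA x) mxE; apply: le_trans (ler_norm_sum _ _ _) _.
apply: ler_sum => k _; rewrite normrM.
apply: (@le_trans _ _ `|invmx A k j|).
  rewrite ler_piMl//; have := h i k; by rewrite in_itv /= -ler_norml.
by rewrite (bigD1 j)//= lerDl sumr_ge0.
Qed.

Lemma lscale_cube (A : 'M[R]_N) : A \in unitmx ->
  leb ((mulmx^~ A) @^-1` cube 1) = (lscale A * (1 *+ 2) ^+ N)%:E.
Proof.
move=> uA; rewrite divfK ?gt_eqF ?lebesgue_cube_gt0// fineK//.
by rewrite ge0_fin_numE// mulmx_preimage_cube_lty.
Qed.

Lemma lebesgue_mulmx_preimage (A : 'M[R]_N) (B : set rV) :
  A \in unitmx -> measurable B ->
  leb ((mulmx^~ A) @^-1` B) = ((lscale A)%:E * leb B)%E.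
Proof.
move=> uA mB; have := lebesgue_mulmx uA mB.
rewrite lscale_cube// lebesgue_cube// => h.
have : (leb ((mulmx^~ A) @^-1` B) * ((1 *+ 2) ^+ N)%:E * ((1 *+ 2) ^- N)%:E =
   (lscale A)%:E * leb B)%E.
  rewrite h EFinM -!muleA; congr (_ * _)%E.
  by rewrite muleC -muleA -EFinM mulVf ?mule1// gt_eqF// lebesgue_cube_gt0.
by rewrite -muleA -EFinM divff ?mule1// gt_eqF// lebesgue_cube_gt0.
Qed.

Lemma lscaleM (A B : 'M[R]_N) : A \in unitmx -> B \in unitmx ->
  lscale (A *m B) = lscale A * lscale B.
Proof.
move=> uA uB; apply: (mulIf (lt0r_neq0 lebesgue_cube_gt0)); apply/EFin_inj.
rewrite -lscale_cube ?unitmx_mul ?uA// -mulrA EFinM -lscale_cube//.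
rewrite -lebesgue_mulmx_preimage//; last by apply: measurable_mulmx_preimage; exact: measurable_cube.
by congr (leb _); apply/seteqP; split => x; rewrite /= mulmxA.
Qed.

Lemma lscale_le (A : 'M[R]_N) r : A \in unitmx -> 0 <= r ->
  (mulmx^~ A) @^-1` cube 1 `<=` cube r -> lscale A <= r ^+ N.
Proof.
move=> uA r0 h.
have : (leb ((mulmx^~ A) @^-1` cube 1) <= leb (cube r))%E.
  apply: le_measure => //; rewrite ?inE; last exact: measurable_cube.
  by apply: measurable_mulmx_preimage; exact: measurable_cube.
rewrite lscale_cube// lebesgue_cube// lee_fin.
by rewrite -(mulr_natl r) -mulr_natl mulr1 exprMn mulrC ler_pM2l// exprn_gt0.
Qed.

Lemma lscale_ge (A : 'M[R]_N) r : A \in unitmx -> 0 <= r ->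
  cube r `<=` (mulmx^~ A) @^-1` cube 1 -> r ^+ N <= lscale A.
Proof.
move=> uA r0 h.
have : (leb (cube r) <= leb ((mulmx^~ A) @^-1` cube 1))%E.
  apply: le_measure => //; rewrite ?inE; first exact: measurable_cube.
  by apply: measurable_mulmx_preimage; exact: measurable_cube.
rewrite lscale_cube// lebesgue_cube// lee_fin.
by rewrite -(mulr_natl r) -mulr_natl mulr1 exprMn [leRHS]mulrC ler_pM2l// exprn_gt0.
Qed.

Lemma lscale_eq1 (A : 'M[R]_N) : A \in unitmx ->
  (forall x : rV, cube 1 (x *m A) <-> cube 1 x) -> lscale A = 1.
Proof.
move=> uA h; have := @lscale_le A 1 uA ler01; have := @lscale_ge A 1 uA ler01.
rewrite expr1n => h1 h2; apply/eqP; rewrite eq_le; apply/andP; split.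
  by apply: h2 => x /h.
by apply: h1 => x /h.
Qed.

Lemma lscale1 : lscale 1%:M = 1.
Proof. by apply: lscale_eq1; rewrite ?unitmx1// => x; rewrite mulmx1. Qed.

Lemma lscale_perm (A : 'M[R]_N) : is_perm_mx A -> lscale A = 1.
Proof.
move=> /is_perm_mxP[s ->]; apply: lscale_eq1; first exact: unitmx_perm.
move=> x; have E i j : (x *m perm_mx s) i (s j) = x i j.
  by rewrite -[s]invgK -col_permE mxE invgK permK.
split => h i j; first by rewrite -E; exact: h.
by rewrite -(permKV s j) E; exact: h.
Qed.

Lemma lscale_diag (v : rV) : (forall j, v 0 j != 0) ->
  lscale (diag_mx v) = `|\det (diag_mx v)|^-1.
Proof.
move=> v0.
have uv : diag_mx v \in unitmx.
  by rewrite unitmxE det_diag unitfE; apply/prodf_neq0 => j _.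
apply: (mulIf (lt0r_neq0 lebesgue_cube_gt0)); apply/EFin_inj.
rewrite -lscale_cube//.
have -> : (mulmx^~ (diag_mx v)) @^-1` cube 1 =
    [set M : rV | forall i j, `[- `|v 0 j|^-1, `|v 0 j|^-1]%classic (M i j)].
  have E (y w : R) : w != 0 -> (y * w \in `[-1, 1]) = (y \in `[- `|w|^-1, `|w|^-1]).
    move=> w0; rewrite !in_itv /= -!ler_norml normrM.
    by rewrite -[X in _ = X](ler_pM2r (_ : 0 < `|w|)) ?normr_gt0// mulVf// normr_eq0.
  apply/seteqP; split => x /= h i j; have := h i j; rewrite mul_mx_diag mxE.
    by rewrite E.
  by rewrite E.
rewrite (lebesgue_mx_box (A := fun _ j => `[- `|v 0 j|^-1, `|v 0 j|^-1]%classic)); last first.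
  by move=> ? ?; exact: measurable_itv.
rewrite big_ord1 det_diag normr_prod -prodfV -[N in _ ^+ N]card_ord -prodr_const.
rewrite -big_split /= -prodEFin; apply: eq_bigr => j _.
have vj : 0 < `|v 0 j|^-1 by rewrite invr_gt0 normr_gt0.
rewrite lebesgue_measure_itv /= lte_fin gtrN// -EFinB; congr (_%:E); ring.
Qed.

(** In the maximum norm [x *m A] differs from [x] by at most [N * eta] times the norm of [x], so the
    preimage of the unit cube lies between the cubes of radius [1 / (1 + N eta)] and
    [1 / (1 - N eta)]. *)
Lemma lscale_near1 (A : 'M[R]_N) (eta : R) : A \in unitmx -> 0 <= eta ->
  N%:R * eta < 1 ->
  (forall i j, `|A i j - (i == j)%:R| <= eta) ->
  (1 + N%:R * eta) ^- N <= lscale A <= (1 - N%:R * eta) ^- N.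
Proof.
move=> uA eta0 Neta hA.
have dist (x : rV) i j s : (forall j, `|x i j| <= s) -> `|(x *m A) i j - x i j| <= N%:R * eta * s.
  move=> xs.
  have -> : (x *m A) i j - x i j = \sum_k x i k * (A k j - (k == j)%:R).
    rewrite mxE; under [RHS]eq_bigr do rewrite mulrBr.
    rewrite sumrB; congr (_ - _); rewrite (bigD1 j)//= eqxx mulr1 big1 ?addr0//.
    by move=> k /negPf ->; rewrite mulr0.
  apply: le_trans (ler_norm_sum _ _ _) _.
  rewrite -mulrA mulr_natl -[N in _ *+ N]card_ord -sumr_const; apply: ler_sum => k _.
  by rewrite normrM mulrC; apply: ler_pM.
rewrite -!exprVn; apply/andP; split.
  apply: lscale_ge => //.
    by rewrite invr_ge0 addr_ge0// mulr_ge0.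
  move=> x h i j /=; rewrite in_itv /= -ler_norml.
  have p0 : 0 < 1 + N%:R * eta by rewrite ltr_wpDr// mulr_ge0.
  have h' k : `|x i k| <= (1 + N%:R * eta)^-1.
    by have := h i k; rewrite in_itv /= -ler_norml.
  have := dist x i j _ h'; have := h' j.
  set t := (1 + _)^-1 => ht hd.
  have -> : 1 = t + N%:R * eta * t by rewrite -[X in X + _]mul1r -mulrDl divff// gt_eqF.
  rewrite -[(x *m A) i j](subrK (x i j)) addrC.
  by apply: le_trans (ler_normD _ _) _; exact: lerD.
apply: lscale_le => //; first by rewrite invr_ge0 subr_ge0 ltW.
move=> x h i j /=; rewrite in_itv /= -ler_norml.
have p0 : 0 < 1 - N%:R * eta by rewrite subr_gt0.
pose s := \big[Num.max/0]_k `|x i k|.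
have xs k : `|x i k| <= s by exact: le_bigmax.
have s0 : 0 <= s by exact: bigmax_ge_id.
apply: le_trans (xs j) _.
rewrite -div1r ler_pdivlMr// mulrBr mulr1 lerBlDr.
apply: bigmax_le => [|k _]; first by rewrite addr_ge0 ?mulr_ge0// ?mulr_ge0.
rewrite (_ : x i k = (x *m A) i k - ((x *m A) i k - x i k)); last by ring.
apply: le_trans (ler_normB _ _) _; apply: lerD; last by rewrite mulrC; exact: dist.
by have := h i k; rewrite in_itv /= -ler_norml.
Qed.

(** Being multiplicative, [lscale] is constant on conjugacy classes; if the class comes arbitrarily
    close to the identity, the previous two-sided bound squeezes the value to 1. *)
Lemma lscale_conj_eq1 (A : 'M[R]_N) : A \in unitmx ->
  (forall eta : R, 0 < eta -> exists2 D : 'M[R]_N, D \in unitmx &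
     forall i j, `|(D *m A *m invmx D) i j - (i == j)%:R| <= eta) ->
  lscale A = 1.
Proof.
move=> uA hA.
have h (eta : R) : 0 < eta -> N%:R * eta < 1 ->
    (1 + N%:R * eta) ^- N <= lscale A <= (1 - N%:R * eta) ^- N.
  move=> eta0 Neta; have [D uD hD] := hA _ eta0.
  have -> : lscale A = lscale (D *m A *m invmx D).
    rewrite !lscaleM ?unitmx_mul ?uD ?uA ?unitmx_inv// mulrAC -lscaleM ?unitmx_inv//.
    by rewrite mulmxV// lscale1 mul1r.
  by apply: lscale_near1 => //; [rewrite !unitmx_mul uD uA unitmx_inv|exact: ltW].
have near0 : \forall eta \near (0 : R)^'+, 0 < eta /\ N%:R * eta < 1.
  have N0 : (0 : R) < N%:R^-1 by rewrite invr_gt0.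
  apply: filterS2 (nbhs_right_gt (0 : R)) (nbhs_right_lt N0) => eta eta0 etaN.
  by split => //; rewrite mulrC -ltr_pdivlMr// div1r.
have c1 (f : R -> R) : continuous f -> f 0 = 1 -> (f eta) ^- N @[eta --> (0 : R)^'+] --> (1 : R).
  move=> cf f0; have -> : (1 : R) = (f 0 ^+ N)^-1 by rewrite f0 expr1n invr1.
  apply: cvgV; first by rewrite f0 expr1n oner_neq0.
  by apply: cvg_at_right_filter; exact: (cvg_comp _ _ (cf 0) (@exprn_continuous R N (f 0))).
have cM : continuous (fun eta : R => N%:R * eta) by move=> x; exact: mulrl_continuous.
apply/eqP; rewrite eq_le; apply/andP; split.
  apply: (cvgr_to_ge (c1 (fun eta => 1 - N%:R * eta) _ _)).
  - by move=> x; apply: continuousB; [exact: cvg_cst|exact: cM].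
  - by rewrite mulr0 subr0.
  - by apply: filterS near0 => eta [eta0 etaN]; have /andP[] := h eta eta0 etaN.
apply: (cvgr_to_le (c1 (fun eta => 1 + N%:R * eta) _ _)).
- by move=> x; apply: continuousD; [exact: cvg_cst|exact: cM].
- by rewrite mulr0 addr0.
- by apply: filterS near0 => eta [eta0 etaN]; have /andP[] := h eta eta0 etaN.
Qed.

Lemma conj_diag_mxE (v : rV) (A : 'M[R]_N) i j : (forall j, v 0 j != 0) ->
  (diag_mx v *m A *m invmx (diag_mx v)) i j = v 0 i * A i j / v 0 j.
Proof.
move=> v0.
have uv : diag_mx v \in unitmx.
  by rewrite unitmxE det_diag unitfE; apply/prodf_neq0 => k _.
have /matrixP/(_ i j) : diag_mx v *m A *m invmx (diag_mx v) *m diag_mx v = diag_mx v *m A.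
  by rewrite mulmxKV.
rewrite mul_mx_diag [X in X = _]mxE mul_diag_mx [X in _ = X]mxE => <-.
by rewrite mulfK.
Qed.

(* Conjugating by [diag (t ^ w i)] multiplies the off-diagonal entries by
   positive powers of t, so the conjugates tend to the identity. *)
Lemma lscale_unitriangular (A : 'M[R]_N) (w : 'I_N -> nat) : A \in unitmx ->
  (forall i, A i i = 1) -> (forall i j, i != j -> A i j != 0 -> (w j < w i)%N) ->
  lscale A = 1.
Proof.
move=> uA A1 hw; apply: lscale_conj_eq1 => // eta eta0.
pose S := \sum_k \sum_l `|A k l|.
have S0 : 0 <= S by rewrite sumr_ge0// => k _; rewrite sumr_ge0.
have S1 : 0 < S + 1 by rewrite ltr_wpDl.
(* The bound [t <= 1] makes every positive power of [t] at most [t], and [t * S <= eta] then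
   controls every off-diagonal entry; [S + 1] avoids a division by zero. *)
pose t := Num.min 1 (eta / (S + 1)).
have t0 : 0 < t by rewrite lt_min ltr01 divr_gt0.
have t1 : t <= 1 by rewrite ge_min lexx.
have tS : t * S <= eta.
  apply: (@le_trans _ _ (eta / (S + 1) * S)); first by rewrite ler_wpM2r// ge_min lexx orbT.
  by rewrite mulrAC ler_pdivrMr// ler_wpM2l// ?lerDl// ltW.
pose v : rV := \row_i t ^+ w i.
have v0 j : v 0 j != 0 by rewrite mxE gt_eqF// exprn_gt0.
exists (diag_mx v).
  by rewrite unitmxE det_diag unitfE; apply/prodf_neq0 => k _.
move=> i j; rewrite conj_diag_mxE//; have [->|ij] := eqVneq i j.
  by rewrite A1 mulr1 divff// subrr normr0 ltW.
rewrite subr0; have [->|Aij] := eqVneq (A i j) 0.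
  by rewrite mulr0 mul0r normr0 ltW.
rewrite !mxE mulrAC -exprB ?unitfE ?gt_eqF//; last by rewrite ltnW// hw.
rewrite normrM (ger0_norm (exprn_ge0 _ (ltW t0))).
apply: (le_trans _ tS); apply: ler_pM => //; first by rewrite exprn_ge0// ltW.
  have : (0 < w i - w j)%N by rewrite subn_gt0 hw.
  by case: (w i - w j)%N => // k _; rewrite exprS ler_piMr ?(ltW t0)// exprn_ile1// (ltW t0).
rewrite /S (bigD1 i)//= (bigD1 j)//= -addrA lerDl addr_ge0// ?sumr_ge0//.
by move=> k _; rewrite sumr_ge0.
Qed.

(** By the decomposition [P A = L U], with the diagonal factored out of [U], everything reduces to
    four kinds of matrices: a permutation and two unitriangular ones, with factor 1, and a diagonal
    one, for which the preimage of the cube is an explicit box. *)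
Lemma lscale_det (A : 'M[R]_N) : A \in unitmx -> lscale A = `|\det A|^-1.
Proof.
move=> uA.
have := cormen_lup_correct A; have := cormen_lup_perm A.
have := cormen_lup_detL A; have := @cormen_lup_lower _ _ A; have := @cormen_lup_upper _ _ A.
case: cormen_lup => [[P L] U] /= hU hL detL permP PA.
have uP : P \in unitmx by case/is_perm_mxP: permP => s ->; exact: unitmx_perm.
have uL : L \in unitmx by rewrite unitmxE detL unitr1.
have UE : U = invmx L *m (P *m A) by rewrite [P *m A]PA mulKmx.
have uU : U \in unitmx by rewrite UE !unitmx_mul unitmx_inv uL uP.
have detU : \det U = \prod_i U i i.
  rewrite -det_tr det_trig; first by apply: eq_bigr => i _; rewrite mxE.
  by apply/is_trig_mxP => i j ij; rewrite mxE hU.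
have U0 i : U i i != 0.
  by move: uU; rewrite unitmxE unitfE detU => /prodf_neq0; apply.
pose v : rV := \row_i U i i.
have v0 j : v 0 j != 0 by rewrite mxE.
have uv : diag_mx v \in unitmx.
  by rewrite unitmxE det_diag unitfE; apply/prodf_neq0 => k _.
pose U1 := invmx (diag_mx v) *m U.
have UU1 : U = diag_mx v *m U1 by rewrite mulKVmx.
have U1E i j : U1 i j = U i j / U i i.
  have /matrixP/(_ i j) := UU1; rewrite mul_diag_mx [X in _ = X -> _]mxE => ->.
  by rewrite [v 0 i]mxE mulrAC divff// mul1r.
have uU1 : U1 \in unitmx by rewrite unitmx_mul unitmx_inv uv.
have cU1 : lscale U1 = 1.
  (* The weights must decrease from row to column index at nonzero off-diagonal entries, so they are
     reversed for the upper triangular factor, where [i < j]; for [L] below, the index itself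
     works. *)
  apply: (@lscale_unitriangular _ (fun i => N - i)%N) => //.
    by move=> i; rewrite U1E divff.
  move=> i j ij; rewrite U1E; case: (ltngtP i j) => [lij _|ji|/val_inj e].
  - by apply: ltn_sub2l => //; exact: ltn_ord.
  - by rewrite hU// mul0r eqxx.
  - by rewrite e eqxx in ij.
have cL : lscale L = 1.
  apply: (@lscale_unitriangular _ (fun i => i)%N) => //.
    by move=> i; rewrite hL// eqxx.
  move=> i j ij; case: (ltnP j i) => // le_ij.
  by rewrite hL// (negPf ij) eqxx.
have <- : lscale (P *m A) = lscale A by rewrite lscaleM// lscale_perm// mul1r.
rewrite [P *m A]PA lscaleM// cL mul1r UU1 lscaleM// cU1 mulr1 lscale_diag//.
congr (_^-1); have : `|\det (P *m A)| = `|\det U|.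
  by rewrite [P *m A]PA; have := det_mulmx L U; rewrite detL mul1r => ->.
rewrite det_mulmx normrM; case/is_perm_mxP: permP => s ->.
rewrite det_perm normrX normrN1 expr1n mul1r => ->.
by rewrite detU det_diag; congr `|_|; apply: eq_bigr => i _; rewrite mxE.
Qed.

Lemma measure_preserving_mulmx (A : 'M[R]_N) : `|\det A| = 1 ->
  measure_preserving leb leb (mulmx^~ A).
Proof.
move=> dA; have uA : A \in unitmx.
  by rewrite unitmxE unitfE -normr_gt0 dA.
split; first exact: (@measurable_mulmx _ _ id).
by move=> B mB; rewrite lebesgue_mulmx_preimage// lscale_det// dA invr1 mul1e.
Qed.

End linear_scaling.

(** * Involutions with unimodular derivative *)

Section bisection.
Context d (X : measurableType d) (R : realType) (I : finType) (f : I -> X -> R).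
Hypothesis mf : forall i, measurable_fun setT (f i).
Variables (c : I -> R) (c0 : forall i, 0 < c i).

Definition dyadic_box (a : I -> R) (k : nat) : set X :=
  coordinate_box f a (fun i => a i + c i * 2^-1 ^+ k).

(** [B] collects the coordinates in which the upper half of the side is kept. *)
Definition subbox_corner (a : I -> R) (k : nat) (B : {set I}) (i : I) : R :=
  if i \in B then a i + c i * 2^-1 ^+ k.+1 else a i.

Lemma dyadic_box_split a k :
  dyadic_box a k = \bigcup_B dyadic_box (subbox_corner a k B) k.+1.
Proof.
have half i : c i * 2^-1 ^+ k = c i * 2^-1 ^+ k.+1 + c i * 2^-1 ^+ k.+1.
  by rewrite exprS; field.
have p0 i : 0 < c i * 2^-1 ^+ k.+1 by rewrite mulr_gt0// exprn_gt0// invr_gt0.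
apply/seteqP; split => x.
  move=> xa; exists (finset (fun i => a i + c i * 2^-1 ^+ k.+1 < f i x)) => // i.
  rewrite /subbox_corner inE; have := xa i; rewrite half.
  move: (c i * 2^-1 ^+ k.+1) => e.
  by case: (ltP (a i + e)) => h /andP[h1 h2]; apply/andP; split; lra.
move=> [B _ xB] i; have := xB i; rewrite /subbox_corner half.
have := p0 i; move: (c i * 2^-1 ^+ k.+1) => e.
by case: ifP => _ h /andP[h1 h2]; apply/andP; split; lra.
Qed.

Lemma dyadic_box_trivIset a k :
  trivIset setT (fun B => dyadic_box (subbox_corner a k B) k.+1).
Proof.
move=> B C _ _ [x [xB xC]]; apply/setP => i.
have := xB i; have := xC i; rewrite /subbox_corner.
move: (c i * 2^-1 ^+ k.+1) => e.
by case: (i \in B); case: (i \in C) => //= /andP[h1 h2] /andP[h3 h4]; exfalso; lra.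
Qed.

Lemma measurable_dyadic_box a k : measurable (dyadic_box a k).
Proof. exact: measurable_coordinate_box. Qed.

Lemma measure_dyadic_box_split (mu : {measure set X -> \bar R}) a k :
  mu (dyadic_box a k) =
  (\sum_(B \in [set: {set I}]) mu (dyadic_box (subbox_corner a k B) k.+1))%E.
Proof.
rewrite {1}dyadic_box_split measure_fin_bigcup//.
- exact: finite_finset.
- exact: dyadic_box_trivIset.
- by move=> B _; exact: measurable_dyadic_box.
Qed.

(* If the inequality fails on a box, it fails on one of the 2^|I| boxes into
   which halving its sides divides it, and so on down to a point, where the
   local estimate applies. *)
Lemma dyadic_box_le (mu1 mu2 : {measure set X -> \bar R}) (K : R) (a0 : I -> R) :
  0 <= K ->
  (forall x : I -> R, exists k0, forall a,
    (forall i, a i <= x i <= a i + c i * 2^-1 ^+ k0) ->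
    (mu1 (dyadic_box a k0) <= K%:E * mu2 (dyadic_box a k0))%E) ->
  (mu1 (dyadic_box a0 0) <= K%:E * mu2 (dyadic_box a0 0))%E.
Proof.
move=> K0 H; apply: contrapT => bad.
pose P a k := ~ (mu1 (dyadic_box a k) <= K%:E * mu2 (dyadic_box a k))%E.
have step (ak : (I -> R) * nat) : exists a', P ak.1 ak.2 -> P a' ak.2.+1 /\
    (forall i, ak.1 i <= a' i /\ a' i + c i * 2^-1 ^+ ak.2.+1 <= ak.1 i + c i * 2^-1 ^+ ak.2).
  case: ak => a k /=; have [Pak|] := pselect (P a k); last by exists a.
  have [B PB] : exists B, P (subbox_corner a k B) k.+1.
    apply: contrapT => /forallNP hB; apply: Pak.
    rewrite !measure_dyadic_box_split !fsbig_finite//=.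
    rewrite ge0_sume_distrr//; apply: lee_sum => B _.
    by have /contrapT := hB B.
  exists (subbox_corner a k B) => _; split => // i.
  have p0 : 0 < c i * 2^-1 ^+ k.+1 by rewrite mulr_gt0// exprn_gt0// invr_gt0.
  have half : c i * 2^-1 ^+ k = c i * 2^-1 ^+ k.+1 + c i * 2^-1 ^+ k.+1.
    by rewrite exprS; field.
  rewrite half /subbox_corner; move: (c i * 2^-1 ^+ k.+1) p0 => e p0.
  by case: ifP => _; split; lra.
have [F hF] := choice step.
pose A := fix A k := if k is k'.+1 then F (A k', k') else a0.
have PA k : P (A k) k.
  by elim: k => [|k IH]; [exact: bad|exact: (hF (A k, k) IH).1].
have AS k i := (hF (A k, k) (PA k)).2 i.
have Ale i : {homo A^~ i : k l / (k <= l)%N >-> k <= l}.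
  apply: homo_leq => [x|x y z|k]; [exact: lexx|exact: le_trans|exact: (AS k i).1].
have Age i : {homo (fun k => - (A k i + c i * 2^-1 ^+ k)) : k l / (k <= l)%N >-> k <= l}.
  apply: homo_leq => [x|x y z|k]; [exact: lexx|exact: le_trans|].
  by rewrite lerN2; exact: (AS k i).2.
have p0 i k : 0 <= c i * 2^-1 ^+ k by rewrite mulr_ge0// ?exprn_ge0 ?invr_ge0// ltW.
have Aub i k l : A k i <= A l i + c i * 2^-1 ^+ l.
  have [kl|/ltnW lk] := leqP k l.
    by apply: le_trans (Ale i _ _ kl) _; rewrite lerDl.
  apply: (@le_trans _ _ (A k i + c i * 2^-1 ^+ k)); first by rewrite lerDl.
  by have := Age i _ _ lk; rewrite lerN2.
(* Lower corners increase and upper corners decrease, so this point lies in the closure of every box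
   of the chain. It may miss the half-open boxes themselves, which is why the local hypothesis has
   weak inequalities on both sides. *)
pose x i := sup (range (A^~ i)).
have [k0 hk0] := H x.
apply: (PA k0); apply: hk0 => i; apply/andP; split.
  apply: ub_le_sup; last by exists k0.
  by exists (A 0%N i + c i * 2^-1 ^+ 0) => _ [k _ <-]; exact: Aub.
by apply: ge_sup; [exists (A 0%N i), 0%N|move=> _ [k _ <-]; exact: Aub].
Qed.

End bisection.

Section max_norm.
Context (R : realType) (n m : nat).

Lemma mx_norm_leP (x : 'M[R]_(n, m)) (r : R) : 0 <= r ->
  `|x| <= r <-> forall i j, `|x i j| <= r.
Proof.
move=> r0; rewrite [`|x|]/Num.norm /= mx_normrE; split => [/bigmax_leP[_ h] i j|h].
  exact: (h (i, j)).
by apply/bigmax_leP; split => // -[i j] _; exact: h.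
Qed.

Lemma mx_norm_coord (x : 'M[R]_(n, m)) i j : `|x i j| <= `|x|.
Proof. by have /(mx_norm_leP x (normr_ge0 _)) := lexx `|x|; apply. Qed.

Lemma mx_norm_mulmx p (A : 'M[R]_(m, p)) :
  exists2 C : R, 0 < C & forall x : 'M[R]_(n, m), `|x *m A| <= C * `|x|.
Proof.
(* The [+ 1] keeps the constant positive even for a zero matrix; it is used later as a divisor. *)
exists (\sum_k \sum_j `|A k j| + 1).
  by rewrite ltr_wpDl// sumr_ge0// => k _; rewrite sumr_ge0.
have S0 : 0 <= \sum_k \sum_j `|A k j| by rewrite sumr_ge0// => k _; rewrite sumr_ge0.
move=> x; rewrite [`|x *m A|]/Num.norm /= mx_normrE.
apply/bigmax_leP; split => [|[i j] _]; first by rewrite mulr_ge0// addr_ge0.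
rewrite /= mxE; apply: le_trans (ler_norm_sum _ _ _) _.
apply: (@le_trans _ _ ((\sum_k \sum_j `|A k j|) * `|x|)); last first.
  by rewrite ler_wpM2r// lerDl.
rewrite mulr_suml; apply: ler_sum => k _; rewrite normrM mulrC.
apply: ler_pM => //; last exact: mx_norm_coord.
by rewrite (bigD1 j)//= lerDl sumr_ge0.
Qed.

End max_norm.

Section differentiable_involution.
Context (R : realType) (n : nat).
Local Notation N := n.+1.
Local Notation rV := 'rV[R]_N.
Local Notation leb := (@lebesgue_mx R 1 N).
Local Notation coord := (@mx_coord R 1 N).

(** Differentiability at one point, with [r] depending on that point. This matches the bisection,
    which ends at a single point. [J] acts on the right, since points are rows. *)
Definition unimodular_at (T : rV -> rV) (x : rV) := exists2 J : 'M[R]_N,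
  `|\det J| = 1 & forall e, 0 < e -> exists2 r, 0 < r &
    forall y, `|y - x| < r -> `|T y - T x - (y - x) *m J| <= e * `|y - x|.

Variables (T : rV -> rV) (TK : involutive T) (mT : measurable_fun setT T).
Hypothesis dT : forall x, unimodular_at T x.

Lemma affine_preimage (J : 'M[R]_N) (v w : rV) (B : set rV) : `|\det J| = 1 ->
  measurable B -> measurable [set x | B ((x + v) *m J + w)] /\
  leb [set x | B ((x + v) *m J + w)] = leb B.
Proof.
move=> dJ mB.
have [m1 h1] := measure_preserving_translation w.
have [m2 h2] := measure_preserving_mulmx dJ.
have [m3 h3] := measure_preserving_translation v.
have mB1 : measurable ((fun x : rV => x + w) @^-1` B).
  by rewrite -[X in measurable X]setTI; exact: m1.
have mB2 : measurable ((mulmx^~ J) @^-1` ((fun x : rV => x + w) @^-1` B)).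
  by rewrite -[X in measurable X]setTI; exact: m2.
split.
  have := m3 measurableT _ mB2; rewrite setTI; exact.
by have := h3 _ mB2; rewrite [in RHS]h2// [in RHS]h1.
Qed.

(** Moving both ends of a side by a fraction [tau] multiplies its length by [1 + tau *+ 2] or
    [1 - tau *+ 2]; by continuity at [tau = 0] the volumes of the dilated and contracted boxes are
    within the factor [1 + eps]. *)
Lemma dilation_small (eps : R) : 0 < eps -> exists tau : R,
  [/\ 0 < tau, tau *+ 2 < 1, (1 + tau *+ 2) ^+ N <= 1 + eps &
   1 <= (1 + eps) * (1 - tau *+ 2) ^+ N].
Proof.
move=> eps0.
have c1 (b : R) : (1 + b * tau) ^+ N @[tau --> (0 : R)^'+] --> (1 : R).
  have E : (1 : R) = (1 + b * 0) ^+ N by rewrite mulr0 addr0 expr1n.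
  rewrite [X in _ --> X]E; apply: cvg_at_right_filter.
  have h : (1 + b * tau) @[tau --> (0 : R)] --> 1 + b * 0.
    by apply: cvgD; [exact: cvg_cst|exact: mulrl_continuous].
  exact: (@cvg_comp _ _ _ (fun t : R => 1 + b * t) (fun y : R => y ^+ N) _ _ _ h (@exprn_continuous R N (1 + b * 0))).
have e1 : 1 < 1 + eps by rewrite ltrDl.
have e2 : (1 + eps)^-1 < 1 by rewrite invf_lt1// ltr_wpDl.
have n1 : \forall t \near (0 : R)^'+, (1 + 2 * t) ^+ N < 1 + eps.
  exact: (cvgr_lt _ (c1 2)).
have n2 : \forall t \near (0 : R)^'+, (1 + eps)^-1 < (1 + - 2 * t) ^+ N.
  exact: (cvgr_gt _ (c1 (- 2))).
have h0 : (0 : R) < 4^-1 by rewrite invr_gt0.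
have n3 := nbhs_right_lt h0; have n4 := nbhs_right_gt (0 : R).
have [tau [[[t1 t2] t3] t4]] := filter_ex (filterI (filterI (filterI n1 n2) n3) n4).
exists tau; split => //.
- by rewrite -(mulr_natl tau); lra.
- by move: t1; rewrite -(mulr_natl tau) => /ltW.
- rewrite -ler_pdivrMl ?(lt_trans ltr01)// mulr1; apply/ltW; move: t2.
  by rewrite -(mulr_natl tau) -mulNr.
Qed.

Lemma lebesgue_box_width (a w : 'I_1 * 'I_N -> R) : (forall i, 0 <= w i) ->
  leb (coordinate_box coord a (fun i => a i + w i)) = (\prod_j w (ord0, j))%:E.
Proof.
move=> w0; rewrite lebesgue_mx_coordinate_box big_ord1 -prodEFin.
by apply: eq_bigr => j _; rewrite addrAC subrr add0r max_r.
Qed.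

Section local_estimates.
Variables (c : 'I_1 * 'I_N -> R) (c0 : forall i, 0 < c i) (eps : R).
Hypothesis eps0 : 0 < eps.
Local Notation Q := (dyadic_box coord c).

Lemma width_bounds : exists cm cM : R,
  [/\ 0 < cm, 0 < cM & forall i, cm <= c i <= cM].
Proof.
exists (\big[Num.min/1]_i c i), (\sum_i c i); split.
- by apply/bigmin_gtP; split.
- apply: (lt_le_trans (c0 (ord0, ord0))); rewrite (bigD1 (ord0, ord0))//= lerDl.
  by rewrite sumr_ge0// => i _; exact: ltW.
- move=> i; rewrite bigmin_le_cond//= (bigD1 i)//= lerDl.
  by rewrite sumr_ge0// => ? _; exact: ltW.
Qed.

Lemma lebesgue_dyadic_box a k : leb (Q a k) = (\prod_j (c (ord0, j) * 2^-1 ^+ k))%:E.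
Proof.
by rewrite lebesgue_box_width// => i; rewrite mulr_ge0 ?exprn_ge0 ?invr_ge0// ltW.
Qed.

Lemma lebesgue_dilated_box a k (tau : R) : -1 <= tau *+ 2 ->
  leb (coordinate_box coord (fun i => a i - tau * (c i * 2^-1 ^+ k))
    (fun i => a i + c i * 2^-1 ^+ k + tau * (c i * 2^-1 ^+ k))) =
  (((1 + tau *+ 2) ^+ N)%:E * leb (Q a k))%E.
Proof.
move=> tau1.
have E i : a i + c i * 2^-1 ^+ k + tau * (c i * 2^-1 ^+ k) =
    a i - tau * (c i * 2^-1 ^+ k) + (1 + tau *+ 2) * (c i * 2^-1 ^+ k).
  by rewrite -mulr_natl; ring.
rewrite (funext E).
rewrite lebesgue_box_width; last first.
  move=> i; rewrite mulr_ge0//; first by lra.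
  by rewrite mulr_ge0 ?exprn_ge0 ?invr_ge0// ltW.
rewrite lebesgue_dyadic_box -EFinM; congr (_%:E).
by rewrite big_split /= prodr_const card_ord.
Qed.

Lemma pow2_small (r : R) : 0 < r -> exists k, 2^-1 ^+ k < r.
Proof.
move=> r0; have [|k _ hk] := cvgr_lt _ (@cvg_expr R 2^-1 _) _ r0.
  by rewrite ger0_norm; lra.
by exists k; exact: hk (leqnn k).
Qed.

(* On small boxes near x the map T is close to an affine map, which preserves
   volume as its determinant is +-1; so T^-1 of a box lies in the affine
   preimage of a slightly dilated box, and contains that of a contracted one. *)
Lemma preimage_box_le (x : rV) : exists k, forall a,
  (forall i, a i <= coord i x <= a i + c i * 2^-1 ^+ k) ->
  (leb (T @^-1` Q a k) <= (1 + eps)%:E * leb (Q a k))%E.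
Proof.
have [cm [cM [cm0 cM0 hc]]] := width_bounds.
have [tau [tau0 tau1 htau _]] := dilation_small eps0.
have [J dJ hJ] := dT x.
have dJ' : `|\det (invmx J)| = 1 by rewrite det_inv normfV dJ invr1.
have uJ : J \in unitmx by rewrite unitmxE unitfE -normr_gt0 dJ.
have [C C0 hC] := @mx_norm_mulmx R 1 N N (invmx J).
(* Chosen so that the linearization error, at most this constant times [cM * s], is still at most
   [tau * cm * s] after multiplication by [invmx J], that is, a fraction [tau] of the shortest
   side. *)
have e0 : 0 < tau * cm / (C * cM) by rewrite divr_gt0// mulr_gt0.
have [r r0 hr] := hJ _ e0.
have [k hk] : exists k, 2^-1 ^+ k < r / cM by apply: pow2_small; rewrite divr_gt0.
exists k => a ha; set s := 2^-1 ^+ k in hk ha *.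
have s0 : 0 < s by rewrite exprn_gt0// invr_gt0.
pose G := coordinate_box coord (fun i => a i - tau * (c i * s))
   (fun i => a i + c i * s + tau * (c i * s)).
have mG : measurable G by apply: measurable_coordinate_box; exact: measurable_mx_coord.
have mQ : measurable (Q a k) by apply: measurable_coordinate_box; exact: measurable_mx_coord.
have [mG' GE] := @affine_preimage (invmx J) (- T x) x G dJ' mG.
apply: (@le_trans _ _ (leb G)); last first.
  rewrite lebesgue_dilated_box; last by rewrite -mulr_natl; lra.
  by apply: lee_wpmul2r => //; rewrite lee_fin.
rewrite -GE; apply: le_measure; rewrite ?inE//.
  by rewrite -[X in measurable X]setTI; exact: mT.
move=> w Qw; set y := T w in Qw *.
have xy : `|y - x| <= cM * s.
  apply/mx_norm_leP; first by rewrite mulr_ge0// ltW.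
  move=> i j; rewrite !mxE; have /andP[h1 h2] := ha (i, j); have /andP[h3 h4] := Qw (i, j).
  have /andP[_ hcM] := hc (i, j).
  have : c (i, j) * s <= cM * s by rewrite ler_wpM2r// ltW.
  rewrite /mx_coord /= in h1 h2 h3 h4; rewrite -/s in h4.
  by move=> hh; rewrite ler_norml; apply/andP; split; lra.
have yr : `|y - x| < r.
  by apply: le_lt_trans xy _; rewrite mulrC -ltr_pdivlMr.
(* The involution replaces an inverse function here: linearizing [T] at [x] and evaluating at
   [y = T w] gives back [w]. *)
have := hr _ yr; rewrite /y TK -/y => hw.
have err : `|(w - T x) *m invmx J + x - y| <= tau * (cm * s).
  have -> : (w - T x) *m invmx J + x - y = (w - T x - (y - x) *m J) *m invmx J.
    by rewrite [RHS]mulmxBl mulmxK// opprB addrA.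
  apply: le_trans (hC _) _; apply: le_trans (_ : C * (tau * cm / (C * cM) * (cM * s)) <= _).
    rewrite ler_pM2l//; apply: le_trans hw _; rewrite ler_pM2l//.
  by rewrite le_eqVlt; apply/orP; left; apply/eqP; field; rewrite !gt_eqF.
move=> [i j]; have /andP[h3 h4] := Qw (i, j); have /andP[hcm _] := hc (i, j).
have /(le_trans (mx_norm_coord _ i j)) := err; rewrite !mxE ler_norml => /andP[h5 h6].
have h7 : tau * (cm * s) <= tau * (c (i, j) * s) by rewrite ler_pM2l// ler_wpM2r// ltW.
rewrite /mx_coord /= in h3 h4 *; rewrite -/s in h4; rewrite !mxE.
by apply/andP; split; lra.
Qed.

Lemma box_le_preimage (x : rV) : exists k, forall a,
  (forall i, a i <= coord i x <= a i + c i * 2^-1 ^+ k) ->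
  (leb (Q a k) <= (1 + eps)%:E * leb (T @^-1` Q a k))%E.
Proof.
have [cm [cM [cm0 cM0 hc]]] := width_bounds.
have [tau [tau0 tau1 _ htau]] := dilation_small eps0.
(* The preimage of a box around [x] lies near [T x], so [T] is linearized there. The candidate
   points [w] satisfy [|w - T x| <= C * (cM * s)], which explains the extra [C] in the choice of
   [k]. *)
have [J dJ hJ] := dT (T x).
have uJ : J \in unitmx by rewrite unitmxE unitfE -normr_gt0 dJ.
have [C C0 hC] := @mx_norm_mulmx R 1 N N (invmx J).
have e0 : 0 < tau * cm / (C * cM) by rewrite divr_gt0// mulr_gt0.
have [r r0 hr] := hJ _ e0.
have [k hk] : exists k, 2^-1 ^+ k < r / (C * cM).
  by apply: pow2_small; rewrite divr_gt0// mulr_gt0.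
exists k => a ha; set s := 2^-1 ^+ k in hk ha *.
have s0 : 0 < s by rewrite exprn_gt0// invr_gt0.
pose G := coordinate_box coord (fun i => a i - - tau * (c i * s))
   (fun i => a i + c i * s + - tau * (c i * s)).
have mG : measurable G by apply: measurable_coordinate_box; exact: measurable_mx_coord.
have mQ : measurable (Q a k) by apply: measurable_coordinate_box; exact: measurable_mx_coord.
have [mG' GE] := @affine_preimage J (- T x) x G dJ mG.
apply: (@le_trans _ _ ((1 + eps)%:E * leb G)%E).
  rewrite lebesgue_dilated_box; last by rewrite mulNrn lerN2 ltW.
  rewrite muleA -EFinM -[leLHS]mul1e; apply: lee_wpmul2r => //.
  by rewrite lee_fin mulNrn.
apply: lee_wpmul2l; first by rewrite lee_fin addr_ge0// ltW.
rewrite -GE; apply: le_measure; rewrite ?inE//.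
  by rewrite -[X in measurable X]setTI; exact: mT.
move=> w /=; set u := (w - T x) *m J + x => Gu.
have wE : w - T x = (u - x) *m invmx J by rewrite /u addrK mulmxK.
have ux : `|u - x| <= cM * s.
  apply/mx_norm_leP; first by rewrite mulr_ge0// ltW.
  move=> i j; have /andP[h1 h2] := ha (i, j); have /andP[h3 h4] := Gu (i, j).
  have /andP[_ hcM] := hc (i, j).
  have hh : c (i, j) * s <= cM * s by rewrite ler_wpM2r// ltW.
  have ht : 0 < tau * (c (i, j) * s) by rewrite !mulr_gt0.
  rewrite [(u - x) i j]mxE [(- x) i j]mxE.
  rewrite /mx_coord /= !mulNr in h1 h2 h3 h4.
  by rewrite ler_norml; apply/andP; split; lra.
have wx : `|w - T x| <= C * (cM * s).
  by rewrite wE; apply: le_trans (hC _) _; rewrite ler_pM2l.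
have wr : `|w - T x| < r.
  by apply: le_lt_trans wx _; rewrite mulrA mulrC -ltr_pdivlMr// mulr_gt0.
have := hr _ wr; rewrite TK => hw.
have err : `|T w - u| <= tau * (cm * s).
  have -> : T w - u = T w - x - (w - T x) *m J by rewrite /u opprD addrA addrAC.
  apply: le_trans hw _; apply: le_trans (_ : tau * cm / (C * cM) * (C * (cM * s)) <= _).
    by rewrite ler_pM2l.
  by rewrite le_eqVlt; apply/orP; left; apply/eqP; field; rewrite !gt_eqF.
move=> [i j]; have /andP[h3 h4] := Gu (i, j); have /andP[hcm _] := hc (i, j).
have /(le_trans (mx_norm_coord _ i j)) := err.
rewrite [(T w - u) i j]mxE [(- u) i j]mxE ler_norml => /andP[h5 h6].
have h7 : tau * (cm * s) <= tau * (c (i, j) * s) by rewrite ler_pM2l// ler_wpM2r// ltW.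
rewrite /mx_coord /= !mulNr in h3 h4 *; rewrite -/s.
by apply/andP; split; lra.
Qed.

End local_estimates.

(** It suffices to compare a box with its preimage. Bisection globalizes the two local estimates
    into inequalities with a factor [1 + eps] in both directions, and [eps] is arbitrary. *)
Theorem measure_preserving_involution : measure_preserving leb leb T.
Proof.
apply: (measure_preserving_boxes (@measurable_mx_coord R 1 N) (@mx_coord_generated R 1 N)) => //.
  exact: lebesgue_mx_coordinate_box_lty.
move=> a b.
(* A box with a nonpositive side is empty, and bisection requires positive sides. *)
have [ab|] := pselect (forall i, a i < b i); last first.
  move=> /existsNP[i /negP]; rewrite -leNgt => ba.
  rewrite (_ : coordinate_box _ a b = set0) ?preimage_set0 ?measure0//.
  apply/seteqP; split => // x /(_ i) /andP[h1 h2].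
  by have := lt_le_trans h1 (le_trans h2 ba); rewrite ltxx.
pose c i := b i - a i.
have c0 i : 0 < c i by rewrite subr_gt0.
have -> : coordinate_box coord a b = dyadic_box coord c a 0.
  by congr (coordinate_box _ _ _); apply/funext => i; rewrite expr0 mulr1 /c addrC subrK.
pose row_of (x : 'I_1 * 'I_N -> R) : rV := \row_j x (ord0, j).
have row_ofE x i : coord i (row_of x) = x i.
  by case: i => i j; rewrite /mx_coord /= mxE (ord1 i).
pose muT : {measure set rV -> \bar R} :=
  measure_function_pushforward__canonical__measure_function_Measure leb mT.
have fin : (leb (dyadic_box coord c a 0) < +oo)%E by exact: lebesgue_mx_coordinate_box_lty.
have lim (u v : \bar R) : (0 <= v)%E -> (v < +oo)%E ->
    (forall eps : R, 0 < eps -> (u <= (1 + eps)%:E * v)%E) -> (u <= v)%E.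
  case: v => // v v0 _ h; apply/lee_addgt0Pr => e e0; rewrite lee_fin in v0.
  have v1 : 0 < v + 1 by rewrite ltr_wpDl.
  have e' : 0 < e / (v + 1) by rewrite divr_gt0.
  apply: le_trans (h _ e') _; rewrite -EFinM -EFinD lee_fin mulrDl mul1r lerD2l.
  by rewrite mulrAC ler_pdivrMr// ler_wpM2l ?lerDl// ltW.
have le1 : (leb (T @^-1` dyadic_box coord c a 0) <= leb (dyadic_box coord c a 0))%E.
  apply: lim => // eps eps0.
  apply: (@dyadic_box_le _ _ _ _ coord (@measurable_mx_coord R 1 N) c c0 muT leb).
    by rewrite addr_ge0// ltW.
  move=> x; have [k hk] := preimage_box_le c0 eps0 (row_of x).
  by exists k => a' ha'; apply: hk => i; rewrite row_ofE.
apply/eqP; rewrite eq_le; apply/andP; split; first exact: le1.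
apply: lim => //; first exact: le_lt_trans le1 fin.
move=> eps eps0.
apply: (@dyadic_box_le _ _ _ _ coord (@measurable_mx_coord R 1 N) c c0 leb muT).
  by rewrite addr_ge0// ltW.
move=> x; have [k hk] := box_le_preimage c0 eps0 (row_of x).
by exists k => a' ha'; apply: hk => i; rewrite row_ofE.
Qed.

End differentiable_involution.

Section jacobian_approximation.
Context (R : realType) (n m : nat).

Lemma jacobian_approx (f : 'rV[R]_n -> 'rV[R]_m) (x : 'rV[R]_n) :
  differentiable f x -> forall e, 0 < e -> exists2 r, 0 < r &
    forall y, `|y - x| < r -> `|f y - f x - (y - x) *m 'J f x| <= e * `|y - x|.
Proof.
move=> /diff_locally /eqaddoP h e e0.
have /nbhs_normP[r /= r0 hr] := h e e0.
exists r => // y yx.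
have := hr (y - x); rewrite /ball_ /= sub0r normrN => /(_ yx).
by rewrite /jacobian mul_rV_lin1 !fctE /= subrK opprD addrA.
Qed.

End jacobian_approximation.

(** * The integrator step followed by the momentum flip *)

Section flow.
Context (R : realType) (m : nat).
Local Notation mxpair d := ('M[R]_(d, m) * 'M[R]_(d, m))%type.
Variable psi : phase R 1 m -> phase R 1 m.
Hypothesis m0 : (0 < m)%N.
Hypothesis psi_diff : forall x, differentiable (row_phase psi) x /\
  `|\det ('J (row_phase psi) x)| = 1.
Hypothesis psi_rev : forall q p q' p',
  psi (q, p) = (q', p') <-> psi (q', - p') = (q, - p).

Definition flip_flow (z : phase R 1 m) : phase R 1 m := ((psi z).1, - (psi z).2).

Lemma flip_flowK : involutive flip_flow.
Proof.
move=> [q p]; rewrite /flip_flow; case E : (psi (q, p)) => [q' p'] /=.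
by have /psi_rev -> := E; rewrite opprK.
Qed.

Definition row_flip_flow (x : 'rV[R]_(m + m)) : 'rV[R]_(m + m) :=
  row_mx (flip_flow (phase_of_row x)).1 (flip_flow (phase_of_row x)).2.

Lemma phase_of_row_flip_flow x :
  phase_of_row (row_flip_flow x) = flip_flow (phase_of_row x).
Proof.
by rewrite {1}/phase_of_row row_mxKl row_mxKr; case: (flip_flow _).
Qed.

Lemma row_flip_flowK : involutive row_flip_flow.
Proof.
move=> x; rewrite {1}/row_flip_flow phase_of_row_flip_flow flip_flowK.
exact: hsubmxK.
Qed.

Definition flip_mx : 'M[R]_(m + m) := block_mx 1%:M 0 0 (- 1%:M).

Lemma row_flip_flowE x : row_flip_flow x = row_phase psi x *m flip_mx.
Proof.
rewrite /row_flip_flow /flip_flow /row_phase /= mul_row_block.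
by rewrite !mulmx0 !mulmx1 mulmxN mulmx1 addr0 add0r.
Qed.

Lemma row_flip_flow_unimodular x : exists2 J : 'M[R]_(m + m),
  `|\det J| = 1 & forall e, 0 < e -> exists2 r, 0 < r &
    forall y, `|y - x| < r ->
     `|row_flip_flow y - row_flip_flow x - (y - x) *m J| <= e * `|y - x|.
Proof.
have [dpsi detpsi] := psi_diff x.
exists ('J (row_phase psi) x *m flip_mx).
  rewrite det_mulmx normrM detpsi mul1r det_ublock det1 mul1r.
  by rewrite -scaleN1r detZ det1 mulr1 normrX normrN1 expr1n.
have [C C0 hC] := @mx_norm_mulmx R 1 _ _ flip_mx.
move=> e e0; have [r r0 hr] := jacobian_approx dpsi (divr_gt0 e0 C0).
exists r => // y yx; rewrite !row_flip_flowE mulmxA -!mulmxBl.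
apply: le_trans (hC _) _; rewrite mulrC -ler_pdivlMr// mulrAC; exact: hr.
Qed.

Lemma measurable_row_flip_flow : measurable_fun setT row_flip_flow.
Proof.
apply: measurable_fun_mx => i j; under eq_fun do rewrite row_flip_flowE mxE.
apply: measurable_sum => k; apply: measurable_funM => //.
apply: continuous_measurable_mx => x; have [dpsi _] := psi_diff x.
exact: (cvg_comp _ _ (differentiable_continuous dpsi) (@coord_continuous _ _ _ i k _)).
Qed.

Lemma measure_preserving_flip_flow :
  measure_preserving (@phase_measure R 1 m) (@phase_measure R 1 m) flip_flow.
Proof.
have [mP hP] := measure_preserving_phase_of_row R m.
have mr : measurable_fun setT (fun z : mxpair 1 => row_mx z.1 z.2).
  apply: measurable_fun_mx => i j; rewrite -(splitK j).
  case: (fintype.split j) => k /=; under eq_fun do rewrite (row_mxEl, row_mxEr).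
    by apply: (measurableT_comp (measurable_mx_coord (i, k))).
  by apply: (measurableT_comp (measurable_mx_coord (i, k))).
have mF : measurable_fun setT (flip_flow : mxpair 1 -> mxpair 1).
  have := measurableT_comp mP (measurableT_comp measurable_row_flip_flow mr).
  apply: eq_measurable_fun => -[q p] _ /=; rewrite phase_of_row_flip_flow.
  by rewrite /phase_of_row row_mxKl row_mxKr.
have [mT hT] : measure_preserving (@lebesgue_mx R 1 (m + m)) (@lebesgue_mx R 1 (m + m)) row_flip_flow.
  have := row_flip_flow_unimodular; have := measurable_row_flip_flow; have := row_flip_flowK.
  (* The theorem on involutions is stated in dimension [n.+1]; for [m = m'.+1] the dimension [m + m]
     is [(m' + m'.+1).+1] by computation. *)
  move: row_flip_flow; clear -m0; case: m m0 => // m' _ T TK mT dT.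
  by apply: (@measure_preserving_involution R (m' + m'.+1)).
split; first exact: mF.
move=> A mA.
have mFA : measurable (flip_flow @^-1` A) by rewrite -[X in measurable X]setTI; exact: mF.
have mPA : measurable (@phase_of_row R m @^-1` A) by rewrite -[X in measurable X]setTI; exact: mP.
rewrite -hP// -[RHS]hP// -[RHS]hT//.
congr (lebesgue_mx _); apply/seteqP; split => x /=; by rewrite phase_of_row_flip_flow.
Qed.

End flow.

Section Rintegral_tools.
Context d (T : measurableType d) (R : realType) (mu : {measure set T -> \bar R}).
Implicit Types f g : T -> R.

Lemma le_integrableR f g : measurable_fun setT f ->
  (forall x, `|f x| <= g x) -> mu.-integrable setT (EFin \o g) ->
  mu.-integrable setT (EFin \o f).
Proof.
move=> mf fg; apply: le_integrable => //; first exact/measurable_EFinP.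
by move=> x _ /=; rewrite lee_fin (le_trans (fg x))// ler_norm.
Qed.

Lemma dominated_cvgR (f_ : nat -> T -> R) f g :
  (forall n, measurable_fun setT (f_ n)) ->
  (forall x, f_ n x @[n --> \oo] --> f x) ->
  mu.-integrable setT (EFin \o g) ->
  (forall n x, `|f_ n x| <= g x) ->
  \int[mu]_x f_ n x @[n --> \oo] --> \int[mu]_x f x.
Proof.
move=> mf ff ig fg.
have mf' n : measurable_fun setT (EFin \o f_ n) by exact/measurable_EFinP.
have ff' : forall x, setT x -> (EFin \o f_ n) x @[n --> \oo] --> (EFin \o f) x.
  by move=> x _; apply: cvg_EFin; [exact: nearW|exact: ff].
have [intf _ h] := @dominated_convergence _ _ _ mu _ measurableT
  (fun n => EFin \o f_ n) (EFin \o f) (EFin \o g) mf'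
  (emeasurable_fun_cvg _ _ mf' ff') (aeW _ ff') ig
  (aeW _ (fun x n _ => fg n x)).
by apply: fine_cvg; rewrite fineK//; exact: integrable_fin_num.
Qed.

End Rintegral_tools.

Lemma Rintegral_measure_preserving d1 d2 (T1 : measurableType d1) (T2 : measurableType d2)
    (R : realType) (mu1 : {measure set T1 -> \bar R}) (mu2 : {measure set T2 -> \bar R})
    (F : T1 -> T2) (f : T2 -> R) : measure_preserving mu1 mu2 F ->
  measurable_fun setT f -> mu2.-integrable setT (EFin \o f) ->
  \int[mu2]_z f z = \int[mu1]_z f (F z).
Proof.
move=> FP mf intf; rewrite /Rintegral; congr fine.
by rewrite (integral_measure_preserving FP)//; exact/measurable_EFinP.
Qed.

(** * Detailed balance and the energy error at stationarity *)

Section tilted_cosine.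
Context (R : realType).

(** This is [2 cosh (y / 2)]. *)
Definition cosh2 (y : R) : R := expR (y / 2) + expR (- (y / 2)).

Lemma cosh2_ge2 y : 2 <= cosh2 y.
Proof.
rewrite -subr_ge0; have -> : cosh2 y - 2 = (expR (y / 4) - expR (- (y / 4))) ^+ 2.
  rewrite sqrrB -!expRM_natl -expRD subrr expR0 /cosh2.
  rewrite (_ : 2%:R * (y / 4) = y / 2); last by field.
  rewrite (_ : 2%:R * - (y / 4) = - (y / 2)); last by field.
  by rewrite addrAC.
exact: sqr_ge0.
Qed.

Lemma cosh2_gt0 y : 0 < cosh2 y.
Proof. exact: lt_le_trans (cosh2_ge2 y). Qed.

Lemma cosh2N y : cosh2 (- y) = cosh2 y.
Proof. by rewrite /cosh2 mulNr opprK addrC. Qed.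

Lemma continuous_cosh2 : continuous cosh2.
Proof.
move=> x.
have h1 : y / 2 @[y --> x] --> x / 2 by apply: cvgM; [exact: cvg_id|exact: cvg_cst].
have h2 : - (y / 2) @[y --> x] --> - (x / 2) by exact: cvgN.
apply: cvgD; first exact: (cvg_comp _ _ h1 (@continuous_expR R _)).
exact: (cvg_comp _ _ h2 (@continuous_expR R _)).
Qed.

(** Equal to [cos (t y) / cosh (y / 2)]. Unlike [cos (t y) e^(-y/2)], which has the same integral by
    detailed balance, it is even, bounded by 1, and has no first-order term at 0. *)
Definition tilted_cos (t y : R) : R := cos (t * y) / cosh2 y *+ 2.

Lemma tilted_cosN t y : tilted_cos t (- y) = tilted_cos t y.
Proof. by rewrite /tilted_cos cosh2N mulrN cosN. Qed.

Lemma tilted_cos_norm_le1 t y : `|tilted_cos t y| <= 1.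
Proof.
rewrite /tilted_cos normrMn normrM normfV (gtr0_norm (cosh2_gt0 y)) -mulr_natl.
rewrite mulrA ler_pdivrMr ?cosh2_gt0// mul1r.
apply: le_trans (cosh2_ge2 y).
have : `|cos (t * y)| <= 1 by rewrite ler_norml cos_geN1 cos_le1.
lra.
Qed.

(** The second-order coefficient in [tilted_cos t y = 1 - tilt_rate t * y^2 + o(y^2)]: the cosine
    contributes [t^2 / 2] and the hyperbolic cosine [1 / 8]. *)
Definition tilt_rate (t : R) : R := t ^+ 2 / 2 + 8^-1.

(** The value at 0 is the limit, so that the factorization by [y ^+ 2] holds everywhere, including
    points where the energy error vanishes, and the quotient is continuous at 0. *)
Definition tilt_quotient (t y : R) : R :=
  if y == 0 then tilt_rate t else (1 - tilted_cos t y) / y ^+ 2.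

Lemma tilt_quotientE t y : 1 - tilted_cos t y = y ^+ 2 * tilt_quotient t y.
Proof.
rewrite /tilt_quotient; case: eqP => [->|/eqP y0].
  rewrite expr0n mul0r /tilted_cos /cosh2 mulr0 cos0 mul0r oppr0 expR0.
  by rewrite -mulr_natl mulrA mulr1 -mulr2n divff// subrr.
by rewrite mulrCA divff ?mulr1// expf_neq0.
Qed.

Lemma derive_quotient0 (g : R -> R) (d : R) : is_derive (0 : R) (1 : R) g d -> g 0 = 0 ->
  g y / y @[y --> 0^'] --> d.
Proof.
move=> [dg <-] g0; move: dg; rewrite /derivable /derive => dg.
apply: cvg_trans dg; apply: near_eq_cvg; near=> y => /=.
by rewrite g0 subr0 addr0 [y *: 1]mulr1 [_ *: _]mulrC.
Unshelve. all: by end_near. Qed.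

Lemma is_derive1_scale (f : R -> R) (a x d : R) : is_derive (a * x) (1 : R) f d ->
  is_derive x (1 : R) (fun y => f (a * y)) (a * d).
Proof.
move=> df; have dg : is_derive x (1 : R) (a *: (@id R)) (a *: (1 : R)).
  exact: is_deriveZ.
have := @is_derive1_comp R f (a *: (@id R)) x _ _ df dg.
by rewrite [a *: (1 : R)]mulr1 mulrC.
Qed.

(** The numerator [2 cosh (y/2) - 2 cos (t y)] is a sum of squares,
    [(e^(y/4) - e^(-y/4))^2 + 4 sin(t y/2)^2], so two first derivatives at 0 replace a second-order
    expansion. *)
Lemma tilt_quotient_cvg0 t : tilt_quotient t y @[y --> 0^'] --> tilt_rate t.
Proof.
pose g1 (y : R) := expR (4^-1 * y) - expR (- 4^-1 * y).
pose g2 (y : R) := sin (t / 2 * y).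
have d1 : is_derive (0 : R) (1 : R) g1 2^-1.
  have -> : 2^-1 = 4^-1 * expR (4^-1 * 0) - (- 4^-1) * expR (- 4^-1 * 0) :> R.
    by rewrite !mulr0 expR0; field.
  by apply: is_deriveB; apply: is_derive1_scale.
have d2 : is_derive (0 : R) (1 : R) g2 (t / 2).
  have -> : t / 2 = t / 2 * cos (t / 2 * 0) by rewrite mulr0 cos0 mulr1.
  by apply: is_derive1_scale.
have g10 : g1 0 = 0 by rewrite /g1 !mulr0 subrr.
have g20 : g2 0 = 0 by rewrite /g2 mulr0 sin0.
have c1 := derive_quotient0 d1 g10; have c2 := derive_quotient0 d2 g20.
have ch : (cosh2 y)^-1 @[y --> 0^'] --> (cosh2 0)^-1.
  apply: cvgV; first by rewrite gt_eqF// cosh2_gt0.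
  by apply: cvg_within_filter; exact: continuous_cosh2.
have E1 := cvg_comp _ _ c1 (@exprn_continuous R 2 _).
have E2 := cvg_comp _ _ c2 (@exprn_continuous R 2 _).
have -> : tilt_rate t = (2^-1 ^+ 2 + ((t / 2) ^+ 2 *+ 4)) * (cosh2 0)^-1.
  by rewrite /cosh2 mul0r oppr0 expR0 /tilt_rate -mulr_natl; field.
have Z : ((g1 y / y) ^+ 2 + (g2 y / y) ^+ 2 *+ 4) / cosh2 y @[y --> 0^'] -->
    (2^-1 ^+ 2 + ((t / 2) ^+ 2 *+ 4)) / cosh2 0.
  by apply: cvgM ch; apply: (cvgD E1); exact: (cvgMn E2).
apply: cvg_trans Z.
apply: near_eq_cvg; near=> y => /=.
have y0 : y != 0 by near: y; exact: nbhs_dnbhs_neq.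
have cy := cosh2_gt0 y.
rewrite /tilt_quotient (negPf y0).
have -> : 1 - tilted_cos t y = (g1 y ^+ 2 + g2 y ^+ 2 *+ 4) / cosh2 y.
  apply: (mulIf (lt0r_neq0 cy)); rewrite divfK ?gt_eqF//.
  rewrite /tilted_cos mulrBl mul1r -mulrnAl divfK ?gt_eqF//.
  rewrite (_ : t * y = (t / 2 * y) *+ 2); last by rewrite -mulr_natl; field.
  rewrite cos_mulr2n cos2sin2 /g2 /g1 sqrrB -!expRM_natl -expRD -mulrDl subrr mul0r expR0 /cosh2.
  rewrite (_ : 2%:R * (4^-1 * y) = y / 2); last by field.
  rewrite (_ : 2%:R * (- 4^-1 * y) = - (y / 2)); last by field.
  by ring.
field.
by rewrite y0 gt_eqF.
Unshelve. all: by end_near. Qed.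

(** Near 0 the limit gives the bound; away from 0 the numerator is at most 2 and [y ^+ 2] at least
    [e ^+ 2]. *)
Lemma tilt_quotient_bounded t : exists2 C : R, 0 <= C & forall y, `|tilt_quotient t y| <= C.
Proof.
have : \forall y \near (0 : R)^', `|tilt_quotient t y| <= `|tilt_rate t| + 1.
  have h : `|tilt_quotient t y| @[y --> 0^'] --> `|tilt_rate t|.
    exact: cvg_norm (@tilt_quotient_cvg0 t).
  have lt1 : `|tilt_rate t| < `|tilt_rate t| + 1 by rewrite ltrDl.
  exact: (cvgr_le _ h _ lt1).
rewrite near_withinE => /nbhs_ballP[e /= e0 he].
exists (`|tilt_rate t| + 1 + 2 / e ^+ 2).
  by rewrite !addr_ge0// divr_ge0// sqr_ge0.
move=> y; have [->|y0] := eqVneq y 0.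
  by rewrite /tilt_quotient eqxx -addrA lerDl addr_ge0// divr_ge0// sqr_ge0.
have [ye|ye] := ltP `|y| e.
  apply: le_trans (he y _ y0) _; first by rewrite /ball /= sub0r normrN.
  by rewrite lerDl divr_ge0// sqr_ge0.
apply: (@le_trans _ _ (2 / e ^+ 2)); last by rewrite lerDr addr_ge0.
rewrite /tilt_quotient (negPf y0) normrM normfV normrX.
apply: ler_pM => //.
  apply: le_trans (ler_normB _ _) _; rewrite normr1; have := tilted_cos_norm_le1 t y; lra.
by rewrite lef_pV2 ?posrE ?exprn_gt0 ?normr_gt0// ler_sqr ?nnegrE// ltW.
Qed.

Lemma continuous_tilt_quotient0 t (u : nat -> R) :
  u n @[n --> \oo] --> (0 : R) -> tilt_quotient t (u n) @[n --> \oo] --> tilt_rate t.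
Proof.
move=> u0; apply: (cvg_comp _ _ u0).
have -> : tilt_rate t = tilt_quotient t 0 by rewrite /tilt_quotient eqxx.
apply/continuous_withinNx; rewrite {2}/tilt_quotient eqxx; exact: tilt_quotient_cvg0.
Qed.

Lemma measurable_tilted_cos t : measurable_fun setT (tilted_cos t).
Proof.
apply: continuous_measurable_fun => x; apply: cvgMn; apply: cvgM.
  apply: (cvg_comp (fun y => t * y) cos _ (@continuous_cos R (t * x))).
  by apply: cvgM; [exact: cvg_cst|exact: cvg_id].
by apply: cvgV; [rewrite gt_eqF// cosh2_gt0|exact: continuous_cosh2].
Qed.

End tilted_cosine.

Section detailed_balance.
Context d (X : measurableType d) (R : realType) (mu : {measure set X -> \bar R}).
Variables (H D : X -> R) (T : X -> X).
Hypotheses (mH : measurable_fun setT H) (mD : measurable_fun setT D).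
Hypothesis TP : measure_preserving mu mu T.
Hypotheses (HT : forall z, H (T z) = H z + D z) (DT : forall z, D (T z) = - D z).
Hypothesis iH : mu.-integrable setT (fun z => (expR (- H z))%:E).

Lemma measurable_boltzmann : measurable_fun setT (fun z => expR (- H z)).
Proof. by apply: measurableT_comp => //; apply: measurableT_comp. Qed.

(* Detailed balance: tilting by half of the energy error makes the Boltzmann
   weight invariant under T. *)
Definition tilted_weight (z : X) : R := expR (- (D z / 2)) * expR (- H z).

Lemma measurable_tilted_weight : measurable_fun setT tilted_weight.
Proof.
apply: measurable_funM; last exact: measurable_boltzmann.
apply: measurableT_comp => //; apply: measurableT_comp => //.
exact: measurable_funM.
Qed.

Lemma tilted_weight_ge0 z : 0 <= tilted_weight z.
Proof. by rewrite mulr_ge0 ?expR_ge0. Qed.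

Lemma integrable_reflected_boltzmann :
  mu.-integrable setT (fun z => (expR (- (H z + D z)))%:E).
Proof.
have := iH; rewrite (integrable_measure_preserving TP); last first.
  by apply/measurable_EFinP; exact: measurable_boltzmann.
by apply: eq_integrable => // z _ /=; rewrite HT.
Qed.

(** The tilted weight is the geometric mean of [e^(-H)] and its reflection [e^(-H - D)], hence at
    most their sum; the reflection is integrable by invariance of [mu]. *)
Lemma integrable_tilted_weight : mu.-integrable setT (EFin \o tilted_weight).
Proof.
apply: (@le_integrableR _ _ _ _ _ (fun z => expR (- H z) + expR (- (H z + D z)))).
- exact: measurable_tilted_weight.
- move=> z; rewrite ger0_norm ?tilted_weight_ge0// /tilted_weight opprD expRD.
  set a := expR (- H z); set b := expR (- (D z / 2)).
  have -> : expR (- D z) = b ^+ 2 by rewrite -expRM_natl; congr expR; field.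
  have a0 : 0 <= a by exact: expR_ge0.
  have := sqr_ge0 (b - 2^-1); have : 0 <= b by exact: expR_ge0.
  nra.
- have -> : EFin \o (fun z => expR (- H z) + expR (- (H z + D z))) =
     (fun z => (expR (- H z))%:E + (expR (- (H z + D z)))%:E)%E by apply/funext.
  by apply: integrableD => //; exact: integrable_reflected_boltzmann.
Qed.

Lemma integrable_bounded_tilted (k : X -> R) : measurable_fun setT k ->
  (forall z, `|k z| <= 1) ->
  mu.-integrable setT (EFin \o (fun z => k z * tilted_weight z)).
Proof.
move=> mk k1; apply: (le_integrableR _ _ integrable_tilted_weight).
  by apply: measurable_funM => //; exact: measurable_tilted_weight.
move=> z; rewrite normrM (ger0_norm (tilted_weight_ge0 z)).
by rewrite ler_piMl ?tilted_weight_ge0.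
Qed.

Lemma tilted_weightT z : tilted_weight (T z) = tilted_weight z.
Proof.
by rewrite /tilted_weight HT DT -!expRD; congr expR; field.
Qed.

Lemma tilted_sin_eq0 t : \int[mu]_z (sin (t * D z) * tilted_weight z) = 0.
Proof.
have mf : measurable_fun setT (fun z => sin (t * D z)).
  apply: measurableT_comp; first exact: continuous_measurable_fun (@continuous_sin R).
  exact: measurable_funM.
have intf := integrable_bounded_tilted mf
  (fun z => (_ : `|sin (t * D z)| <= 1)).
have {}intf : mu.-integrable setT (EFin \o (fun z => sin (t * D z) * tilted_weight z)).
  by apply: intf => z; rewrite ler_norml sin_geN1 sin_le1.
have : \int[mu]_z (sin (t * D z) * tilted_weight z) =
    (-1) * \int[mu]_z (sin (t * D z) * tilted_weight z).
  rewrite {1}(Rintegral_measure_preserving TP)//; last first.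
    by apply: measurable_funM => //; exact: measurable_tilted_weight.
  rewrite -RintegralZl//; apply: eq_Rintegral => z _.
  by rewrite tilted_weightT DT mulrN sinN mulN1r mulNr.
lra.
Qed.

Lemma integrable_bounded_boltzmann (k : X -> R) (C : R) : measurable_fun setT k ->
  (forall z, `|k z| <= C) ->
  mu.-integrable setT (EFin \o (fun z => k z * expR (- H z))).
Proof.
move=> mk kC; apply: (@le_integrableR _ _ _ _ _ (fun z => C * expR (- H z))).
- by apply: measurable_funM => //; exact: measurable_boltzmann.
- by move=> z; rewrite normrM (ger0_norm (expR_ge0 _)) ler_wpM2r// expR_ge0.
- have -> : EFin \o (fun z => C * expR (- H z)) = (fun z => C%:E * (expR (- H z))%:E)%E.
    by apply/funext.
  exact: integrableZl.
Qed.

(** Since [tilted_cos t] is even and [D] changes sign under [T], its integrals against [e^(-H)] and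
    [e^(-H - D)] agree. The average of these two weights is the tilted weight times [cosh (D / 2)],
    which cancels the denominator. *)
Lemma tilted_cosE t : \int[mu]_z (cos (t * D z) * tilted_weight z) =
  \int[mu]_z (tilted_cos t (D z) * expR (- H z)).
Proof.
have mk : measurable_fun setT (fun z => tilted_cos t (D z)).
  by apply: measurableT_comp => //; exact: measurable_tilted_cos.
have i1 := integrable_bounded_boltzmann mk (fun z => tilted_cos_norm_le1 t (D z)).
have mf : measurable_fun setT (fun z => tilted_cos t (D z) * expR (- H z)).
  by apply: measurable_funM => //; exact: measurable_boltzmann.
have E := Rintegral_measure_preserving TP mf i1.
have i2 : mu.-integrable setT (EFin \o (fun z => tilted_cos t (D (T z)) * expR (- H (T z)))).
  have := i1; rewrite (integrable_measure_preserving TP)//.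
  exact/measurable_EFinP.
have : \int[mu]_z (cos (t * D z) * tilted_weight z) =
  2^-1 * (\int[mu]_z (tilted_cos t (D z) * expR (- H z)) +
          \int[mu]_z (tilted_cos t (D (T z)) * expR (- H (T z)))).
  rewrite -RintegralD// -RintegralZl//; last first.
    have -> : EFin \o (fun z => tilted_cos t (D z) * expR (- H z) + tilted_cos t (D (T z)) * expR (- H (T z))) =
      (fun z => (tilted_cos t (D z) * expR (- H z))%:E + (tilted_cos t (D (T z)) * expR (- H (T z)))%:E)%E.
      by apply/funext.
    exact: integrableD.
  apply: eq_Rintegral => z _; rewrite DT HT tilted_cosN /tilted_weight.
  set b := expR (- (D z / 2)).
  have -> : expR (- (H z + D z)) = b ^+ 2 * expR (- H z).
    by rewrite -expRM_natl -expRD; congr expR; field.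
  have ab : expR (D z / 2) * b = 1 by rewrite -expRD subrr expR0.
  have cE : tilted_cos t (D z) * (expR (D z / 2) + b) = cos (t * D z) *+ 2.
    by rewrite /tilted_cos -/(cosh2 (D z)) -mulrnAl divfK// gt_eqF// cosh2_gt0.
  have -> : cos (t * D z) = tilted_cos t (D z) * (expR (D z / 2) + b) / 2.
    by rewrite cE; field.
  move: (tilted_cos _ _) (expR (D z / 2)) ab (expR (- H z)) => c a ab e.
  have -> : c * (a + b) / 2 * (b * e) = 2^-1 * (c * (a * b) * e + c * (b ^+ 2 * e)).
    by field.
  by rewrite ab mulr1.
by rewrite -E => ->; field.
Qed.

End detailed_balance.

(** * Small-step asymptotics of the tilted cosine integrals *)

Section tilt_asymptotics.
Context d (X : measurableType d) (R : realType) (mu : {measure set X -> \bar R}).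
Variables (H : X -> R) (D rho : R -> X -> R) (alpha G : X -> R) (nu : R).
Hypotheses (mH : measurable_fun setT H)
  (mD : forall h, 0 < h -> measurable_fun setT (D h)).
Hypothesis iH : mu.-integrable setT (fun z => (expR (- H z))%:E).
Hypothesis iG : mu.-integrable setT (fun z => (G z * expR (- H z))%:E).
Hypothesis nu0 : 0 < nu.
Hypothesis DE : forall h, 0 < h -> forall z,
  D h z = h `^ nu * alpha z + h `^ nu * rho h z.
Hypothesis rho0 : forall z, rho h z @[h --> 0^'+] --> (0 : R).
Hypothesis DG : forall h, 0 < h <= 1 -> forall z,
  `|D h z| ^+ 3 / h `^ (3 * nu) <= G z.

Lemma powR_sqr_nu (h : R) : h `^ (2 * nu) = (h `^ nu) ^+ 2.
Proof. by rewrite mulrC powRrM powR_mulrn// powR_ge0. Qed.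

Lemma powR_cvg0 (u : nat -> R) : (forall n, 0 < u n) -> u n @[n --> \oo] --> (0 : R) ->
  u n `^ nu @[n --> \oo] --> (0 : R).
Proof.
move=> u0 uc; apply/cvgrPdist_lt => e e0.
have e'0 : 0 < e `^ (nu^-1) by rewrite powR_gt0.
have /cvgrPdist_lt/(_ _ e'0) := uc.
apply: filterS => n; rewrite !sub0r !normrN ger0_norm ?(ltW (u0 n))// => h.
rewrite ger0_norm ?powR_ge0//.
have -> : e = (e `^ nu^-1) `^ nu by rewrite -powRrM mulVf ?gt_eqF// powRr1// ltW.
by apply: gt0_ltr_powR; rewrite ?nnegrE// ltW.
Qed.

Section along_sequence.
Variables (t : R) (u : nat -> R).
Hypotheses (u01 : forall n, 0 < u n <= 1) (u0 : u n @[n --> \oo] --> (0 : R)).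

(** For [y >= 0] one has [y^2 <= 1 + y^3]. This converts the cubic bound into a majorant of squares
    that is integrable against the Boltzmann weight. *)
Lemma scaled_energy_bound h z : 0 < h <= 1 -> (D h z / h `^ nu) ^+ 2 <= 1 + G z.
Proof.
move=> h01; have := DG h01 z; have /andP[h0 _] := h01.
have hp : 0 < h `^ nu by rewrite powR_gt0.
have -> : h `^ (3 * nu) = (h `^ nu) ^+ 3 by rewrite mulrC powRrM powR_mulrn// powR_ge0.
move=> hG; have {}hG : `|D h z / h `^ nu| ^+ 3 <= G z.
  by rewrite normrM normfV (gtr0_norm hp) exprMn exprVn.
apply: (@le_trans _ _ (1 + `|D h z / h `^ nu| ^+ 3)); last by rewrite lerD2l.
rewrite -real_normK ?num_real//; set y := `|_|; have y0 : 0 <= y by exact: normr_ge0.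
have [y1|/ltW y1] := leP y 1.
  by apply: (@le_trans _ _ 1); [rewrite expr_le1|rewrite lerDl exprn_ge0].
by apply: (@le_trans _ _ (y ^+ 3)); [exact: ler_weXn2l|rewrite lerDr].
Qed.

Lemma scaled_energy_cvg z : D (u n) z / u n `^ nu @[n --> \oo] --> alpha z.
Proof.
have rhou : rho (u n) z @[n --> \oo] --> (0 : R).
  have /cvg_at_rightP := @rho0 z; apply; split => // n.
  by have /andP[] := u01 n.
have -> : (fun n => D (u n) z / u n `^ nu) = (fun n => alpha z + rho (u n) z).
  apply/funext => n; have /andP[un0 _] := u01 n; rewrite DE//.
  by rewrite -mulrDr mulrC mulKf// gt_eqF// powR_gt0.
by rewrite -[X in _ --> X]addr0; apply: cvgD => //; exact: cvg_cst.
Qed.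

(** Condition 1 provides [alpha] as a bare function; measurability is inherited from the scaled
    energy errors, of which it is the pointwise limit. *)
Lemma measurable_leading_coefficient : measurable_fun setT alpha.
Proof.
apply: (measurable_fun_cvg (h := fun n z => D (u n) z / u n `^ nu)).
  by move=> n; apply: measurable_funM => //; apply: mD; have /andP[] := u01 n.
by move=> z _; exact: scaled_energy_cvg.
Qed.

Lemma leading_coefficient_bound z : alpha z ^+ 2 <= 1 + G z.
Proof.
have h := cvg_comp _ _ (@scaled_energy_cvg z) (@exprn_continuous R 2 _).
by apply: (cvgr_to_le h); apply: nearW => n; exact: scaled_energy_bound.
Qed.

(** Dominated convergence: the integrand is the squared scaled error times [tilt_quotient], which
    tends to [alpha^2] times [tilt_rate t] and is bounded by [C * (1 + G)]. *)
Lemma tilt_asymptotics_seq :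
  \int[mu]_z ((1 - tilted_cos t (D (u n) z)) / u n `^ (2 * nu) * expR (- H z))
    @[n --> \oo] --> \int[mu]_z (tilt_rate t * alpha z ^+ 2 * expR (- H z)).
Proof.
have [C C0 hC] := tilt_quotient_bounded t.
have up n : 0 < u n `^ nu by rewrite powR_gt0//; have /andP[] := u01 n.
have E n z : (1 - tilted_cos t (D (u n) z)) / u n `^ (2 * nu) =
   (D (u n) z / u n `^ nu) ^+ 2 * tilt_quotient t (D (u n) z).
  by rewrite tilt_quotientE powR_sqr_nu exprMn exprVn mulrAC.
have Du z := scaled_energy_cvg z.
have Du0 z : D (u n) z @[n --> \oo] --> (0 : R).
  have -> : (fun n => D (u n) z) = (fun n => (D (u n) z / u n `^ nu) * u n `^ nu).
    by apply/funext => n; rewrite divfK// gt_eqF.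
  rewrite -(mulr0 (alpha z)); apply: cvgM; first exact: Du.
  apply: powR_cvg0 => // n.
  by have /andP[] := u01 n.
apply: (@dominated_cvgR _ _ _ _ _ _ (fun z => C * ((1 + G z) * expR (- H z)))).
- move=> n; apply: measurable_funM; last exact: measurable_boltzmann.
  apply: measurable_funM => //; apply: measurable_funB => //.
  apply: measurableT_comp; first exact: measurable_tilted_cos.
  by apply: mD; have /andP[] := u01 n.
- move=> z; apply: cvgM; last exact: cvg_cst.
  rewrite (funext (E ^~ z)) mulrC; apply: cvgM.
    exact: (cvg_comp _ _ (Du z) (@exprn_continuous R 2 _)).
  exact: continuous_tilt_quotient0.
- have -> : EFin \o (fun z => C * ((1 + G z) * expR (- H z))) =
    (fun z => C%:E * ((expR (- H z))%:E + (G z * expR (- H z))%:E))%E.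
    by apply/funext => z /=; rewrite -EFinD -EFinM mulrDl mul1r.
  by apply: integrableZl => //; exact: integrableD.
- move=> n z; rewrite normrM (ger0_norm (expR_ge0 _)) mulrA ler_wpM2r ?expR_ge0//.
  rewrite E normrM [leRHS]mulrC; apply: ler_pM => //.
  by rewrite ger0_norm ?sqr_ge0//; exact: scaled_energy_bound.
Qed.

End along_sequence.

Lemma integrable_leading_coefficient :
  mu.-integrable setT (EFin \o (fun z => alpha z ^+ 2 * expR (- H z))).
Proof.
(* Any sequence of steps in []0, 1]] tending to 0 would do; the facts about [alpha] do not mention
   it. *)
have hv n : 0 < (@harmonic R) n <= 1 by rewrite invr_gt0 ltr0n invf_le1 ?ler1n ?ltr0n.
have hc : (@harmonic R) n @[n --> \oo] --> (0 : R) by exact: cvg_harmonic.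
apply: (@le_integrableR _ _ _ _ _ (fun z => (1 + G z) * expR (- H z))).
- apply: measurable_funM; last exact: measurable_boltzmann.
  by apply: measurable_funX; exact: (measurable_leading_coefficient hv hc).
- move=> z; rewrite normrM (ger0_norm (expR_ge0 _)) ler_wpM2r ?expR_ge0// ger0_norm ?sqr_ge0//.
  exact: (leading_coefficient_bound hv hc).
- have -> : EFin \o (fun z => (1 + G z) * expR (- H z)) =
    (fun z => (expR (- H z))%:E + (G z * expR (- H z))%:E)%E.
    by apply/funext => z /=; rewrite -EFinD mulrDl mul1r.
  exact: integrableD.
Qed.

Lemma tilt_asymptotics t :
  (\int[mu]_z ((1 - tilted_cos t (D h z)) * expR (- H z))) / h `^ (2 * nu)
    @[h --> 0^'+] --> tilt_rate t * \int[mu]_z (alpha z ^+ 2 * expR (- H z)).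
Proof.
apply/cvg_at_rightP => u [u0 uc].
(* The majorant is available only for steps up to 1; truncation changes finitely many terms. *)
pose v n := Num.min (u n) 1.
have v01 n : 0 < v n <= 1 by rewrite lt_min u0 ltr01 ge_min lexx orbT.
have uv : \forall n \near \oo, v n = u n.
  have h01 : (0 : R) < 1 by [].
  have un1 : \forall n \near \oo, u n <= 1 by exact: (cvgr_le _ uc _ h01).
  by apply: filterS un1 => n un1; rewrite /v min_l.
have vc : v n @[n --> \oo] --> (0 : R).
  by apply: cvg_trans uc; apply: near_eq_cvg; apply: filterS uv => n ->.
rewrite -RintegralZl//; last exact: integrable_leading_coefficient.
under [X in _ --> X]eq_Rintegral do rewrite mulrA.
apply: cvg_trans (@tilt_asymptotics_seq t v v01 vc).
apply: near_eq_cvg; apply: filterS uv => n ->.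
have -> : (fun z => (1 - tilted_cos t (D (u n) z)) / u n `^ (2 * nu) * expR (- H z)) =
   (fun z => ((1 - tilted_cos t (D (u n) z)) * expR (- H z)) * (u n `^ (2 * nu))^-1).
  by apply/funext => z; rewrite mulrAC.
rewrite RintegralZr//.
apply: (@integrable_bounded_boltzmann _ _ _ _ _ mH iH _ 2).
  apply: measurable_funB => //; apply: measurableT_comp; first exact: measurable_tilted_cos.
  exact: mD.
move=> z; apply: le_trans (ler_normB _ _) _.
by rewrite normr1; have := tilted_cos_norm_le1 t (D (u n) z); lra.
Qed.

End tilt_asymptotics.

(** * Products of many factors close to one *)

Section product_limit.
Context (R : realType).

(** Telescoping: the factors are exchanged one at a time, and all others have absolute value at most
    1. *)
Lemma prod_sub_le (I : Type) (r : seq I) (a b : I -> R) :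
  (forall i, `|a i| <= 1) -> (forall i, `|b i| <= 1) ->
  `|\prod_(i <- r) a i - \prod_(i <- r) b i| <= \sum_(i <- r) `|a i - b i|.
Proof.
move=> a1 b1; elim: r => [|i r IH]; first by rewrite !big_nil subrr normr0.
rewrite !big_cons.
set A := \prod_(j <- r) a j in IH *; set B := \prod_(j <- r) b j in IH *.
have -> : a i * A - b i * B = (a i - b i) * A + b i * (A - B) by ring.
apply: le_trans (ler_normD _ _) _; rewrite !normrM; apply: lerD.
  rewrite ler_piMr// /A; elim: r {IH A B} => [|j r IH]; first by rewrite big_nil normr1.
  by rewrite big_cons normrM mulr_ile1.
by apply: le_trans IH; rewrite ler_piMl.
Qed.

(** From [1 - u <= e^(-u) <= 1 / (1 + u) <= 1 - u + u^2]. *)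
Lemma expRN_sub_le (u : R) : 0 <= u -> `|1 - u - expR (- u)| <= u ^+ 2.
Proof.
move=> u0; have h1 := expR_ge1Dx (- u); rewrite distrC ger0_norm; last lra.
have h2 : expR (- u) <= (1 + u)^-1.
  by rewrite expRN lef_pV2 ?posrE ?expR_gt0 ?expR_ge1Dx//; lra.
have h3 : (1 + u)^-1 <= 1 - u + u ^+ 2.
  rewrite -[leLHS]mul1r ler_pdivrMr; last lra.
  have : 0 <= u ^+ 3 by rewrite exprn_ge0.
  nra.
lra.
Qed.

Variables (U : R -> R) (c nu : R) (h_ : nat -> nat -> R) (S : R).
Local Notation x d i := (h_ d i `^ (2 * nu)).
Hypotheses (nu0 : 0 < nu) (h0 : forall d i, (0 < d)%N -> 0 < h_ d i).
Hypothesis U01 : forall h, 0 < h -> 0 <= U h <= 2.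
Hypothesis Uc : U h / h `^ (2 * nu) @[h --> 0^'+] --> c.
Hypothesis sumx : \sum_(i < d) x d i @[d --> \oo] --> S.
Hypothesis maxx : \big[Num.max/0]_(i < d) x d i @[d --> \oo] --> (0 : R).

(** The condition on the maximum makes all steps [h_ d i] of row [d] small at once, so the single
    limit [Uc] applies to them uniformly in [i]. *)
Lemma uniformly_small (e : R) : 0 < e -> \forall d \near \oo,
  forall i : 'I_d, `|U (h_ d i) - c * x d i| <= e * x d i.
Proof.
move=> e0; have nu2 : 0 < 2 * nu by rewrite mulr_gt0.
have : \forall h \near (0 : R)^'+, `|c - U h / h `^ (2 * nu)| <= e.
  by move/cvgrPdist_le : Uc; apply.
rewrite near_withinE => /nbhs_ballP[r /= r0 hr].
have r2 : 0 < r `^ (2 * nu) by rewrite powR_gt0.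
have dm : \forall d \near \oo, \big[Num.max/0]_(i < d) x d i < r `^ (2 * nu).
  exact: (cvgr_lt _ maxx).
apply: filterS2 dm (nbhs_infty_gt 0) => d dm d0 i.
have hd := h0 i d0.
have xp : 0 < x d i by rewrite powR_gt0.
have xr : h_ d i < r.
  have lt1 : x d i < r `^ (2 * nu).
    by apply: le_lt_trans dm; exact: (le_bigmax _ (fun j : 'I_d => x d j) i).
  rewrite ltNge; apply/negP => rh.
  have : r `^ (2 * nu) <= x d i by apply: ge0_ler_powR; rewrite ?nnegrE// ltW.
  by rewrite leNgt lt1.
have := hr (h_ d i); rewrite /ball /= sub0r normrN (gtr0_norm hd) => /(_ xr hd).
rewrite distrC => H.
have -> : U (h_ d i) - c * x d i = (U (h_ d i) / x d i - c) * x d i.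
  by rewrite mulrBl divfK// gt_eqF.
by rewrite normrM (gtr0_norm xp) ler_wpM2r// ltW.
Qed.

Lemma sum_rate_cvg : \sum_(i < d) U (h_ d i) @[d --> \oo] --> c * S.
Proof.
have : (\sum_(i < d) U (h_ d i) - c * \sum_(i < d) x d i) @[d --> \oo] --> (0 : R).
  apply/cvgrPdist_le => e e0.
  have S1 : 0 < `|S| + 1 by rewrite ltr_wpDl.
  have sb : \forall d \near \oo, \sum_(i < d) x d i <= `|S| + 1.
    have lt1 : S < `|S| + 1 by rewrite (le_lt_trans (ler_norm S))// ltrDl.
    exact: (cvgr_le _ sumx _ lt1).
  have := uniformly_small (divr_gt0 e0 S1).
  apply: filterS2 sb => d sb hd.
  rewrite sub0r normrN mulr_sumr -sumrB; apply: le_trans (ler_norm_sum _ _ _) _.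
  apply: (@le_trans _ _ (\sum_(i < d) e / (`|S| + 1) * x d i)).
    by apply: ler_sum => i _; exact: hd.
  by rewrite -mulr_sumr mulrAC ler_pdivrMr// ler_wpM2l// ltW.
move=> h; rewrite -[X in _ --> X]add0r.
have h2 : c * \sum_(i < d) x d i @[d --> \oo] --> c * S by apply: cvgM; [exact: cvg_cst|exact: sumx].
apply: cvg_trans (cvgD h h2); apply: near_eq_cvg; apply: nearW => d /=.
by rewrite !fctE; ring.
Qed.

(** Replacing each factor [1 - U] by [e^(-U)] costs at most the sum of the [U^2], which is bounded
    by a constant times the maximum of the [h^(2 nu)] times their sum, and tends to 0. *)
Lemma prod_rate_cvg : \prod_(i < d) (1 - U (h_ d i)) @[d --> \oo] --> expR (- (c * S)).
Proof.
have h1 : expR (- \sum_(i < d) U (h_ d i)) @[d --> \oo] --> expR (- (c * S)).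
  exact: (cvg_comp _ _ (cvgN sum_rate_cvg) (@continuous_expR R _)).
suff h2 : (\prod_(i < d) (1 - U (h_ d i)) - expR (- \sum_(i < d) U (h_ d i)))
    @[d --> \oo] --> (0 : R).
  rewrite -[X in _ --> X]add0r.
  apply: cvg_trans (cvgD h2 h1); apply: near_eq_cvg; apply: nearW => d /=.
  by rewrite !fctE; ring.
have h3 : (`|c| + 1) ^+ 2 * ((\big[Num.max/0]_(i < d) x d i) * \sum_(i < d) x d i)
    @[d --> \oo] --> (0 : R).
  have E : 0 = (`|c| + 1) ^+ 2 * (0 * S) by rewrite mul0r mulr0.
  rewrite [X in _ --> X]E; apply: cvgM; first exact: cvg_cst.
  by apply: cvgM; [exact: maxx|exact: sumx].
apply/cvgrPdist_le => e e0; have /cvgrPdist_le/(_ e e0) := h3.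
have := uniformly_small ltr01; apply: filterS3 (nbhs_infty_gt 0) => d d0 hd.
rewrite !sub0r !normrN; apply: le_trans; apply: le_trans (ler_norm _).
rewrite (big_morph _ (@opprD R) (@oppr0 R)) expR_sum.
apply: le_trans (prod_sub_le _ _ _) _.
- move=> i; have := U01 (h0 i d0); rewrite ler_norml => /andP[? ?]; apply/andP; split; lra.
- move=> i; rewrite ger0_norm ?expR_ge0// -expR0 ler_expR oppr_le0.
  by have /andP[] := U01 (h0 i d0).
rewrite mulr_sumr mulr_sumr; apply: ler_sum => i _.
have /andP[Ui _] := U01 (h0 i d0).
apply: le_trans (expRN_sub_le Ui) _.
have xp : 0 <= x d i by exact: powR_ge0.
have Ux : U (h_ d i) <= (`|c| + 1) * x d i.
  have := hd i; rewrite mul1r ler_norml => /andP[_ H].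
  have : c * x d i <= `|c| * x d i by rewrite ler_wpM2r// ler_norm.
  lra.
apply: (@le_trans _ _ (((`|c| + 1) * x d i) ^+ 2)).
  by rewrite ler_sqr ?nnegrE// (le_trans Ui).
rewrite exprMn ler_wpM2l ?sqr_ge0// expr2 ler_wpM2r//.
exact: (le_bigmax _ (fun j : 'I_d => x d j) i).
Qed.

End product_limit.

Section Rintegral_product.
Context d1 d2 (X : measurableType d1) (Y : measurableType d2) (R : realType).
Variables (m1 : {sigma_finite_measure set X -> \bar R})
  (m2 : {sigma_finite_measure set Y -> \bar R}).

Lemma Rintegral_product (a : X -> R) (b : Y -> R) :
  m1.-integrable setT (EFin \o a) -> m2.-integrable setT (EFin \o b) ->
  (m1 \x m2)%E.-integrable setT (fun z => (a z.1 * b z.2)%:E) /\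
  \int[(m1 \x m2)%E]_z (a z.1 * b z.2) = \int[m1]_x a x * \int[m2]_y b y.
Proof.
move=> ia ib.
have ma : measurable_fun setT a by apply/measurable_EFinP; exact: measurable_int ia.
have mb : measurable_fun setT b by apply/measurable_EFinP; exact: measurable_int ib.
have mab : measurable_fun setT (fun z : X * Y => (a z.1 * b z.2)%:E).
  by apply/measurable_EFinP; apply: measurable_funM; apply: measurableT_comp.
have iab : (m1 \x m2)%E.-integrable setT (fun z => (a z.1 * b z.2)%:E).
  apply/integrable12ltyP => //=.
  have -> : (fun x => \int[m2]_y `|(a x * b y)%:E|)%E =
      (fun x => `|(a x)%:E| * \int[m2]_y `|(b y)%:E|)%E.
    apply/funext => x; rewrite -ge0_integralZl//; last first.
      by apply/measurable_EFinP; exact: measurableT_comp.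
    by apply: eq_integral => y _; rewrite EFinM abseM.
  rewrite ge0_integralZr//; last first.
  - exact: integral_ge0.
  - by apply/measurable_EFinP; exact: measurableT_comp.
  apply: lte_mul_pinfty; first exact: integral_ge0.
  - rewrite ge0_fin_numE; last exact: integral_ge0.
    by move/integrableP : ia => [].
  - by move/integrableP : ib => [].
split => //; rewrite /Rintegral -integral12_prod_meas1//= /fubini_F /=.
have fa := integrable_fin_num measurableT ia.
have fb := integrable_fin_num measurableT ib.
have -> : (fun x => \int[m2]_y (a x * b y)%:E)%E = (fun x => (a x)%:E * \int[m2]_y (b y)%:E)%E.
  by apply/funext => x; rewrite -integralZl.
by rewrite -(fineK fb) integralZr//= -(fineK fa).
Qed.

End Rintegral_product.

(** * Integrals over many independent components *)

Section product_phase.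
Context (R : realType) (m : nat).
Local Notation mxpair d := ('M[R]_(d, m) * 'M[R]_(d, m))%type.

Definition row_pair d (i : 'I_d) (Z : phase R d m) : phase R 1 m :=
  (row i Z.1, row i Z.2).

Lemma row_pair_cons0 d (zZ : (phase R 1 m * phase R d m)%type) :
  row_pair ord0 (phase_cons zZ) = zZ.1.
Proof.
case: zZ => [[q p] [Q P]]; congr pair; apply/rowP => j; rewrite mxE /=.
  by rewrite -[RHS](col_mxEu q Q); congr (_ _ _); exact/val_inj.
by rewrite -[RHS](col_mxEu p P); congr (_ _ _); exact/val_inj.
Qed.

Lemma row_pair_consS d (zZ : (phase R 1 m * phase R d m)%type) (i : 'I_d) :
  row_pair (lift ord0 i) (phase_cons zZ) = row_pair i zZ.2.
Proof.
case: zZ => [[q p] [Q P]]; congr pair; apply/rowP => j; rewrite mxE /= [RHS]mxE.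
  by rewrite -[RHS](col_mxEd q Q); congr (_ _ _); exact/val_inj.
by rewrite -[RHS](col_mxEd p P); congr (_ _ _); exact/val_inj.
Qed.

Lemma measurable_row_pair d (i : 'I_d) :
  measurable_fun setT (row_pair i : mxpair d -> mxpair 1).
Proof.
apply/measurable_fun_pairP; split; apply: measurable_fun_mx => k j;
  under eq_fun do rewrite /= mxE;
  by apply: (measurableT_comp (measurable_mx_coord (i, j))).
Qed.

(** Base of the induction on components: a single point, which is a box with an empty product of
    sides. *)
Lemma phase_measure0_setT : phase_measure (setT : set (mxpair 0)) = 1%E.
Proof.
rewrite (_ : setT = coordinate_box (@phase_coord R 0 m) (fun=> 0) (fun=> 0)).
  rewrite /phase_measure lebesgue_phase_coordinate_box !lebesgue_mx_coordinate_box.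
  by rewrite !big_ord0 mule1.
by apply/seteqP; split => // Z _ [] [[]].
Qed.

Lemma integrable_bounded_mul dX (X : measurableType dX) (mu : {measure set X -> \bar R})
    (k w : X -> R) : measurable_fun setT k -> (forall x, `|k x| <= 1) ->
  mu.-integrable setT (EFin \o w) -> mu.-integrable setT (EFin \o (fun x => k x * w x)).
Proof.
move=> mk k1 iw; have mw : measurable_fun setT w by apply/measurable_EFinP; exact: measurable_int iw.
apply: (@le_integrableR _ _ _ _ _ (fun x => `|w x|)); first exact: measurable_funM.
  by move=> x; rewrite normrM ler_piMl.
have := integrable_abse iw; by apply: eq_integrable.
Qed.

Lemma measurable_cos_mul dX (X : measurableType dX) (t : R) (f : X -> R) :
  measurable_fun setT f -> measurable_fun setT (fun x => cos (t * f x)).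
Proof.
move=> mf; apply: measurableT_comp; first exact: continuous_measurable_fun (@continuous_cos R).
exact: measurable_funM.
Qed.

Lemma measurable_sin_mul dX (X : measurableType dX) (t : R) (f : X -> R) :
  measurable_fun setT f -> measurable_fun setT (fun x => sin (t * f x)).
Proof.
move=> mf; apply: measurableT_comp; first exact: continuous_measurable_fun (@continuous_sin R).
exact: measurable_funM.
Qed.

Lemma cos_norm_le1 (x : R) : `|cos x| <= 1.
Proof. by rewrite ler_norml cos_geN1 cos_le1. Qed.

Lemma sin_norm_le1 (x : R) : `|sin x| <= 1.
Proof. by rewrite ler_norml sin_geN1 sin_le1. Qed.

Definition row_sum d (D : nat -> phase R 1 m -> R) (Z : phase R d m) : R :=
  \sum_(i < d) D i (row_pair i Z).

Definition row_prod d (w : nat -> phase R 1 m -> R) (Z : phase R d m) : R :=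
  \prod_(i < d) w i (row_pair i Z).

Lemma row_sum_cons d D (zZ : (phase R 1 m * phase R d m)%type) :
  row_sum D (phase_cons zZ) = D 0 zZ.1 + row_sum (D \o succn) zZ.2.
Proof.
rewrite /row_sum big_ord_recl row_pair_cons0; congr (_ + _).
by apply: eq_bigr => i _; rewrite row_pair_consS.
Qed.

Lemma row_prod_cons d w (zZ : (phase R 1 m * phase R d m)%type) :
  row_prod w (phase_cons zZ) = w 0 zZ.1 * row_prod (w \o succn) zZ.2.
Proof.
rewrite /row_prod big_ord_recl row_pair_cons0; congr (_ * _).
by apply: eq_bigr => i _; rewrite row_pair_consS.
Qed.

Lemma measurable_row_sum d (D : nat -> phase R 1 m -> R) :
  (forall i, measurable_fun setT (D i : mxpair 1 -> R)) ->
  measurable_fun setT (row_sum D : mxpair d -> R).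
Proof.
move=> mD; apply: measurable_sum => i.
by apply: (measurableT_comp (mD i)); exact: measurable_row_pair.
Qed.

Lemma measurable_row_prod d (D : nat -> phase R 1 m -> R) :
  (forall i, measurable_fun setT (D i : mxpair 1 -> R)) ->
  measurable_fun setT (row_prod D : mxpair d -> R).
Proof.
move=> mD; apply: measurable_prod => i _.
by apply: (measurableT_comp (mD i)); exact: measurable_row_pair.
Qed.

(** Multiplicativity of characteristic functions, in real form: in
    [cos (a + b) = cos a cos b - sin a sin b] the second term integrates to 0, and the addition
    formula for the sine shows that the vanishing of sine integrals is inherited by the sum. *)
Lemma product_tilted_integrals (t : R) d (D w : nat -> phase R 1 m -> R) :
  (forall i, measurable_fun setT (D i : mxpair 1 -> R)) ->
  (forall i, (@phase_measure R 1 m).-integrable setT (EFin \o w i)) ->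
  (forall i, \int[@phase_measure R 1 m]_z (sin (t * D i z) * w i z) = 0) ->
  [/\ (@phase_measure R d m).-integrable setT (EFin \o row_prod w),
   \int[@phase_measure R d m]_Z (cos (t * row_sum D Z) * row_prod w Z) =
     \prod_(i < d) \int[@phase_measure R 1 m]_z (cos (t * D i z) * w i z) &
   \int[@phase_measure R d m]_Z (sin (t * row_sum D Z) * row_prod w Z) = 0].
Proof.
elim: d D w => [|d IH] D w mD iw hsin.
  have W1 : row_prod w = (fun=> 1) :> (phase R 0 m -> R) by apply/funext => Z; rewrite /row_prod big_ord0.
  have S0 : row_sum D = (fun=> 0) :> (phase R 0 m -> R) by apply/funext => Z; rewrite /row_sum big_ord0.
  have fin0 : (@phase_measure R 0 m setT < +oo)%E by rewrite phase_measure0_setT ltry.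
  split.
  - rewrite W1; apply/integrableP; split; first exact/measurable_EFinP.
    by under eq_integral do rewrite /= normr1; rewrite integral_cst// mul1e.
  - rewrite W1 S0 big_ord0; under eq_Rintegral do rewrite mulr0 cos0 mulr1.
    by rewrite Rintegral_cst// [X in fine X]phase_measure0_setT mulr1.
  - rewrite W1 S0; under eq_Rintegral do rewrite mulr0 sin0 mul0r.
    by rewrite Rintegral_cst// mul0r.
have [iW' hcos' hsin'] := IH (D \o succn) (w \o succn) (fun i => mD i.+1)
  (fun i => iw i.+1) (fun i => hsin i.+1).
have mw i : measurable_fun setT (w i : mxpair 1 -> R).
  by apply/measurable_EFinP; exact: measurable_int (iw i).
have mS k := measurable_row_sum (d := k) mD.
have mS' := measurable_row_sum (d := d) (fun i => mD i.+1).
have mW k := measurable_row_prod (d := k) mw.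
have PC := measure_preserving_phase_cons R d m.
have c0 := integrable_bounded_mul (measurable_cos_mul t (mD 0)) (fun=> cos_norm_le1 _) (iw 0).
have s0 := integrable_bounded_mul (measurable_sin_mul t (mD 0)) (fun=> sin_norm_le1 _) (iw 0).
have c1 := integrable_bounded_mul (measurable_cos_mul t mS') (fun=> cos_norm_le1 _) iW'.
have s1 := integrable_bounded_mul (measurable_sin_mul t mS') (fun=> sin_norm_le1 _) iW'.
have iW : (@phase_measure R d.+1 m).-integrable setT (EFin \o row_prod w).
  rewrite (integrable_measure_preserving PC); last by apply/measurable_EFinP; exact: (mW d.+1).
  have [+ _] := Rintegral_product (iw 0) iW'.
  by apply: eq_integrable => // zZ _ /=; rewrite row_prod_cons.
have ic := integrable_bounded_mul (measurable_cos_mul t (mS d.+1)) (fun=> cos_norm_le1 _) iW.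
have is_ := integrable_bounded_mul (measurable_sin_mul t (mS d.+1)) (fun=> sin_norm_le1 _) iW.
have [icc Ecc] := Rintegral_product c0 c1.
have [iss Ess] := Rintegral_product s0 s1.
have [ics Ecs] := Rintegral_product c0 s1.
have [isc Esc] := Rintegral_product s0 c1.
split => //.
  rewrite (Rintegral_measure_preserving PC)//; last first.
    by apply: measurable_funM; [exact: (measurable_cos_mul t (mS d.+1))|exact: (mW d.+1)].
  rewrite big_ord_recl -hcos' -Ecc -[RHS]subr0.
  have <- : \int[(@phase_measure R 1 m \x @phase_measure R d m)%E]_zZ
     (sin (t * D 0 zZ.1) * w 0 zZ.1 * (sin (t * row_sum (D \o succn) zZ.2) * row_prod (w \o succn) zZ.2)) = 0.
    by rewrite Ess hsin mul0r.
  rewrite -RintegralB//; apply: eq_Rintegral => zZ _.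
  by rewrite row_prod_cons row_sum_cons mulrDr cosD; ring.
rewrite (Rintegral_measure_preserving PC)//; last first.
  by apply: measurable_funM; [exact: (measurable_sin_mul t (mS d.+1))|exact: (mW d.+1)].
transitivity (\int[(@phase_measure R 1 m \x @phase_measure R d m)%E]_zZ
   (sin (t * D 0 zZ.1) * w 0 zZ.1 * (cos (t * row_sum (D \o succn) zZ.2) * row_prod (w \o succn) zZ.2)) +
  \int[(@phase_measure R 1 m \x @phase_measure R d m)%E]_zZ
   (cos (t * D 0 zZ.1) * w 0 zZ.1 * (sin (t * row_sum (D \o succn) zZ.2) * row_prod (w \o succn) zZ.2))).
  rewrite -RintegralD//; apply: eq_Rintegral => zZ _.
  by rewrite row_prod_cons row_sum_cons mulrDr sinD; ring.
by rewrite Esc Ecs hsin hsin' mul0r mulr0 addr0.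
Qed.

End product_phase.

(** * The normal law and continuity of laws *)

Section real_line_maps.
Context (R : realType).
Local Notation leb := (@lebesgue_measure R).

(** The line is treated as a space with one coordinate, indexed by [unit], so that the box criterion
    covers shifts and reflection. *)
Lemma id_coordinate_generated :
  coordinate_generated (fun (_ : unit) => (@id R : measurableTypeR R -> R)).
Proof. by move=> G sG hG A mA; exact: (hG tt A mA). Qed.

Lemma lebesgue_coordinate_box (a b : unit -> R) :
  leb (coordinate_box (fun _ => id) a b) = (Num.max 0 (b tt - a tt))%:E.
Proof.
rewrite (_ : coordinate_box _ a b = `]a tt, b tt]%classic).
  rewrite lebesgue_measure_itv /= lte_fin; case: ltP => [ab|ba].
    by rewrite max_r ?subr_ge0 1?ltW.
  by rewrite max_l// subr_le0.
apply/seteqP; split=> x /=; rewrite in_itv /=; first by move/(_ tt).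
by move=> h [].
Qed.

Lemma measure_preserving_shift (v : R) : measure_preserving leb leb (fun x => x + v).
Proof.
apply: (@measure_preserving_boxes _ _ _ _ R leb leb _ unit (fun _ => id)).
- by move=> _; exact: measurable_id.
- exact: id_coordinate_generated.
- exact: measurable_funD.
- by move=> a b; rewrite [X in (X < _)%E]lebesgue_coordinate_box ltry.
move=> a b; rewrite (_ : _ @^-1` _ =
    coordinate_box (fun _ => id) (fun i => a i - v) (fun i => b i - v)).
  rewrite [LHS]lebesgue_coordinate_box [RHS]lebesgue_coordinate_box.
  congr (Num.max _ _)%:E; ring.
by apply/seteqP; split => x h i; have := h i; rewrite /= ltrBlDr lerBrDr.
Qed.

Lemma measure_preserving_opp : measure_preserving leb leb (fun x => - x).
Proof.
apply: (@measure_preserving_boxes _ _ _ _ R leb leb _ unit (fun _ => id)).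
- by move=> _; exact: measurable_id.
- exact: id_coordinate_generated.
- by apply: measurableT_comp => //; exact: measurable_id.
- by move=> a b; rewrite [X in (X < _)%E]lebesgue_coordinate_box ltry.
move=> a b; rewrite [RHS]lebesgue_coordinate_box.
rewrite (_ : _ @^-1` _ = `[- b tt, - a tt[%classic).
  rewrite [LHS]lebesgue_measure_itv /= lte_fin ltrN2; case: ltP => [ab|ba].
    by rewrite max_r ?subr_ge0 1?ltW// -EFinB opprK addrC.
  by rewrite max_l// subr_le0.
apply/seteqP; split=> x /=; rewrite in_itv /=.
  by move/(_ tt) => /andP[h1 h2]; rewrite lerNl h2 ltrNr h1.
by move=> /andP[h1 h2] []; rewrite ltrNr h2 lerNl h1.
Qed.

End real_line_maps.

Section gaussian.
Context (R : realType).
Local Notation leb := (@lebesgue_measure R).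
Local Notation N := (@normal_pdf R).

Lemma normal_pdf_expR (x e y : R) : 0 < e ->
  N x e y = normal_peak e * expR (- (y - x) ^+ 2 / (e ^+ 2 *+ 2)).
Proof. by move=> e0; rewrite normal_pdfE// gt_eqF. Qed.

(** With [v = |y - x| / e], half of the exponent in [e^(-v^2/2)] absorbs the factor [v], since
    [v <= 1 + v^2/4 <= e^(v^2/4)]; the other half is a normal density with standard deviation
    [sqrt 2 * e], whose integral is known. *)
Lemma normal_pdf_first_moment_le (x e y : R) : 0 < e ->
  `|y - x| * N x e y <= e *+ 2 * N x (Num.sqrt 2 * e) y.
Proof.
move=> e0; have s2 : 0 < Num.sqrt 2 :> R by rewrite sqrtr_gt0.
have s22 : Num.sqrt 2 ^+ 2 = 2 :> R by rewrite sqr_sqrtr.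
have s2l : Num.sqrt 2 <= 2 :> R.
  rewrite -(ler_pXn2r (_ : (0 < 2)%N)) ?nnegrE ?sqrtr_ge0// s22; lra.
have pE : normal_peak e = normal_peak (Num.sqrt 2 * e) * Num.sqrt 2.
  rewrite /normal_peak exprMn s22.
  rewrite (_ : 2 * e ^+ 2 * pi *+ 2 = 2 * (e ^+ 2 * pi *+ 2)); last by ring.
  rewrite sqrtrM//.
  have h : 0 < Num.sqrt (e ^+ 2 * pi *+ 2).
    by rewrite sqrtr_gt0 mulrn_wgt0// mulr_gt0 ?pi_gt0// exprn_gt0.
  rewrite invfM [RHS]mulrAC mulVf ?mul1r// gt_eqF//.
rewrite !normal_pdf_expR ?mulr_gt0// pE exprMn s22.
set v := `|y - x| / e; have v0 : 0 <= v by rewrite divr_ge0// ltW.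
have yv : `|y - x| = e * v by rewrite /v mulrC divfK// gt_eqF.
have E1 : - (y - x) ^+ 2 / (e ^+ 2 *+ 2) = - (v ^+ 2 / 4) - v ^+ 2 / 4.
  by rewrite -(real_normK (num_real (y - x))) yv; field; rewrite gt_eqF.
have E2 : - (y - x) ^+ 2 / (2 * e ^+ 2 *+ 2) = - (v ^+ 2 / 4).
  by rewrite -(real_normK (num_real (y - x))) yv; field; rewrite gt_eqF.
rewrite E1 E2 expRD yv.
have hv : v * expR (- (v ^+ 2 / 4)) <= 1.
  rewrite expRN ler_pdivrMr ?expR_gt0// mul1r.
  apply: le_trans (expR_ge1Dx _); have := sqr_ge0 (v / 2 - 1); lra.
have p0 : 0 <= normal_peak (Num.sqrt 2 * e) by exact: normal_peak_ge0.
have x0 := expR_ge0 (- (v ^+ 2 / 4)).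
set p := normal_peak (Num.sqrt 2 * e) in p0 *; set E := expR (- (v ^+ 2 / 4)) in x0 hv *.
set r := Num.sqrt 2 in s2 s2l *.
have -> : e * v * (p * r * (E * E)) = (e * p * E) * (r * (v * E)) by ring.
have -> : e *+ 2 * (p * E) = (e * p * E) * 2 by ring.
rewrite ler_wpM2l//; first by rewrite !mulr_ge0// ltW.
by rewrite -[leRHS]mulr1; apply: ler_pM => //; [exact: ltW|rewrite mulr_ge0].
Qed.

Lemma integrable_normal_first_moment :
  leb.-integrable setT (EFin \o (fun z => `|z| * N 0 1 z)).
Proof.
apply: (@le_integrableR _ _ R leb _ (fun z : R => 2 * N 0 (Num.sqrt 2 * 1) z)).
- by apply: measurable_funM; [exact: normr_measurable|exact: measurable_normal_pdf].
- move=> z; rewrite ger0_norm ?mulr_ge0 ?normal_pdf_ge0//.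
  by have := @normal_pdf_first_moment_le 0 1 z ltr01; rewrite subr0.
- have -> : EFin \o (fun z => 2 * N 0 (Num.sqrt 2 * 1) z) =
     (fun z => 2%:E * (N 0 (Num.sqrt 2 * 1) z)%:E)%E by apply/funext.
  by apply: integrableZl => //; exact: integrable_normal_pdf.
Qed.

Definition normal_cf (t : R) : R := \int[leb]_z (cos (t * z) * N 0 1 z).

Lemma is_derive_normal_pdf (z : R) : is_derive z (1 : R) (N 0 1) (- (z * N 0 1 z)).
Proof.
have NE : N 0 1 = (fun z => normal_peak 1 * expR (- (2^-1 * z ^+ 2))).
  apply/funext => y; rewrite normal_pdf_expR//; congr (_ * expR _).
  by rewrite subr0 expr1n; field.
rewrite [X in is_derive _ _ X _]NE.
have d1 : is_derive z (1 : R) (fun y : R => y ^+ 2) (z *+ 2).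
  by apply: is_derive_eq; rewrite /= scaler1.
have d2 : is_derive z (1 : R) (fun y : R => - (2^-1 * y ^+ 2)) (- z).
  apply: (is_derive_eq (is_deriveN (is_deriveZ (2^-1) d1))).
  by rewrite -mulr_natl /GRing.scale /=; field.
have d3 := @is_derive1_comp R expR (fun y : R => - (2^-1 * y ^+ 2)) z _ _ (is_derive_expR _) d2.
apply: (is_derive_eq (is_deriveZ (normal_peak 1) d3)).
by rewrite NE /GRing.scale /=; ring.
Qed.

Lemma integrable_normal_pdf01 : leb.-integrable setT (EFin \o N 0 1).
Proof. exact: integrable_normal_pdf. Qed.

Lemma integrable_sin_moment (t : R) :
  leb.-integrable setT (EFin \o (fun z => sin (t * z) * z * N 0 1 z)).
Proof.
apply: (@le_integrableR _ _ R leb _ (fun z : R => `|z| * N 0 1 z)).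
- apply: measurable_funM; last exact: measurable_normal_pdf.
  by apply: measurable_funM => //; exact: (@measurable_sin_mul R _ R t id).
- move=> z; rewrite normrM (ger0_norm (normal_pdf_ge0 _ _ _)) ler_wpM2r ?normal_pdf_ge0//.
  by rewrite normrM ler_piMl// sin_norm_le1.
- exact: integrable_normal_first_moment.
Qed.

Lemma integrable_cos_normal (t : R) :
  leb.-integrable setT (EFin \o (fun z => cos (t * z) * N 0 1 z)).
Proof.
apply: (@integrable_bounded_mul R _ _ leb (fun z : R => cos (t * z)) (N 0 1)).
- exact: (@measurable_cos_mul R _ R t id).
- by move=> z; exact: cos_norm_le1.
- exact: integrable_normal_pdf01.
Qed.

(** The difference of the two sides is the integral of the derivative of [sin (t z)] times the
    density; over [[-(n+1), n+1]] it is a boundary term that tends to 0. *)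
Lemma normal_by_parts (t : R) :
  \int[leb]_z (sin (t * z) * z * N 0 1 z) = t * normal_cf t.
Proof.
pose G z := sin (t * z) * N 0 1 z.
pose g z := t * (cos (t * z) * N 0 1 z) - sin (t * z) * z * N 0 1 z.
have dG z : is_derive z (1 : R) G (g z).
  have d1 : is_derive z (1 : R) (fun y => sin (t * y)) (t * cos (t * z)).
    exact: is_derive1_scale.
  apply: (is_derive_eq (is_deriveM d1 (is_derive_normal_pdf z))).
  by rewrite /GRing.scale /= /g; ring.
have icos : leb.-integrable setT (EFin \o (fun z => t * (cos (t * z) * N 0 1 z))).
  have -> : EFin \o (fun z => t * (cos (t * z) * N 0 1 z)) =
    (fun z => t%:E * (cos (t * z) * N 0 1 z)%:E)%E by apply/funext.
  by apply: integrableZl => //; exact: integrable_cos_normal.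
have ig : leb.-integrable setT (EFin \o g).
  have -> : EFin \o g = (fun z => (t * (cos (t * z) * N 0 1 z))%:E - (sin (t * z) * z * N 0 1 z)%:E)%E.
    by apply/funext.
  by apply: integrableB => //; exact: integrable_sin_moment.
suff : \int[leb]_z g z = 0.
  rewrite RintegralB//; last exact: integrable_sin_moment.
  by rewrite RintegralZl//; [move/subr0_eq|exact: integrable_cos_normal].
have mg : measurable_fun setT g by apply/measurable_EFinP; exact: measurable_int ig.
have cg : continuous g.
  move=> z; have cN : N 0 1 y @[y --> z] --> N 0 1 z.
    exact: continuous_normal_pdf (oner_neq0 _) z.
  have ct : t * y @[y --> z] --> t * z by apply: cvgM; [exact: cvg_cst|exact: cvg_id].
  have ccos := cvg_comp _ _ ct (@continuous_cos R _).
  have csin := cvg_comp _ _ ct (@continuous_sin R _).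
  apply: cvgB.
    by apply: cvgM; [exact: cvg_cst|apply: cvgM; [exact: ccos|exact: cN]].
  by apply: cvgM => //; apply: cvgM; [exact: csin|exact: cvg_id].
have h1 : \int[leb]_(z in `[- n.+1%:R, n.+1%:R]) g z @[n --> \oo] --> \int[leb]_z g z.
  under eq_fun do rewrite Rintegral_mkcond.
  apply: (@dominated_cvgR _ _ R leb (fun n => g \_ `[- n.+1%:R, n.+1%:R]) g (fun z : R => `|g z|)).
  - move=> n; apply/measurable_restrict => //; exact: measurable_funS mg.
  - move=> z; apply: (cvg_near_cst); exists (Num.truncn `|z|) => // n /= zn.
    rewrite patchE ifT// inE /= in_itv /= -ler_norml.
    have := truncnS_gt `|z|; move=> /ltW /le_trans; apply; by rewrite ler_nat.
  - have := integrable_abse ig; by apply: eq_integrable.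
  - by move=> n z; rewrite patchE; case: ifP => _//; rewrite normr0.
have h2 n : \int[leb]_(z in `[- n.+1%:R, n.+1%:R]) g z = G n.+1%:R - G (- n.+1%:R).
  rewrite /Rintegral (@continuous_FTC2 _ g G)//.
  - by rewrite gtrN.
  - exact: continuous_subspaceT.
  - split; first by move=> x _; have [] := dG x.
    + apply: cvg_at_right_filter; apply: differentiable_continuous.
      by apply/derivable1_diffP; have [] := dG (- n.+1%:R).
    + apply: cvg_at_left_filter; apply: differentiable_continuous.
      by apply/derivable1_diffP; have [] := dG n.+1%:R.
  - by move=> x _; rewrite derive1E; have [_ ->] := dG x.
have h3 : \int[leb]_(z in `[- n.+1%:R, n.+1%:R]) g z @[n --> \oo] --> (0 : R).
  rewrite (funext h2); apply/cvgr0Pnorm_le => e e0.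
  have p0 : 0 < normal_peak 1 :> R by rewrite normal_peak_gt0.
  (* Each boundary value is at most [normal_peak 1 * 2 / n.+1], by [e^x >= 1 + x]; the two together
     give the 4. *)
  exists (Num.truncn (normal_peak 1 *+ 4 / e)) => // n /= hn.
  have Nn (y : R) : y ^+ 2 = n.+1%:R ^+ 2 -> N 0 1 y <= normal_peak 1 * (2 / n.+1%:R).
    move=> y2; rewrite normal_pdf_expR// ler_pM2l// subr0 expr1n y2 mulNr expRN.
    have n0 : 0 < n.+1%:R :> R by [].
    rewrite -[leRHS]invrK lef_pV2 ?posrE ?expR_gt0 ?invr_gt0 ?divr_gt0// invf_div.
    apply: le_trans (expR_ge1Dx _); have := sqr_ge0 (n.+1%:R - 1 : R).
    lra.
  have Gn (y : R) : y ^+ 2 = n.+1%:R ^+ 2 -> `|G y| <= normal_peak 1 * (2 / n.+1%:R).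
    move=> y2; apply: le_trans (Nn y y2).
    by rewrite normrM (ger0_norm (normal_pdf_ge0 _ _ _)) ler_piMl ?normal_pdf_ge0// sin_norm_le1.
  apply: le_trans (ler_normB _ _) _.
  apply: le_trans (lerD (Gn _ erefl) (Gn _ (sqrrN _))) _.
  have n0 : 0 < n.+1%:R :> R by [].
  have : normal_peak 1 *+ 4 / e < n.+1%:R.
    by apply: lt_le_trans (truncnS_gt _) _; rewrite ler_nat.
  rewrite ltr_pdivrMr// => h.
  rewrite !mulrA -mulrDl ler_pdivrMr//; lra.
exact: (cvg_unique _ h1 h3).
Qed.

Lemma is_derive_normal_cf (t : R) : is_derive t (1 : R) normal_cf (- t * normal_cf t).
Proof.
pose f t z := cos (t * z) * N 0 1 z.
have df x z : is_derive x (1 : R) (f ^~ z) (- (sin (x * z) * z * N 0 1 z)).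
  have d1 : is_derive x (1 : R) (fun y => cos (z * y)) (z * - sin (z * x)).
    exact: is_derive1_scale.
  have -> : f ^~ z = N 0 1 z *: (fun y => cos (z * y)).
    by apply/funext => y; rewrite /f /= mulrC [y * z]mulrC.
  apply: (is_derive_eq (is_deriveZ (N 0 1 z) d1)).
  by rewrite /GRing.scale /= [x * z]mulrC; ring.
have df1 x z : partial1of2 f x z = - (sin (x * z) * z * N 0 1 z).
  by rewrite partial1of2E; have [_ ->] := df x z.
have It : `]t - 1, t + 1[%classic t by rewrite /= in_itv /=; apply/andP; split; lra.
have if_ x : leb.-integrable setT (EFin \o f x) by exact: integrable_cos_normal.
have G0 z : 0 <= `|z| * N 0 1 z by rewrite mulr_ge0// normal_pdf_ge0.
have Gub x z : `|partial1of2 f x z| <= `|z| * N 0 1 z.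
  rewrite df1 normrN normrM (ger0_norm (normal_pdf_ge0 _ _ _)) ler_wpM2r ?normal_pdf_ge0//.
  by rewrite normrM ler_piMl// sin_norm_le1.
have d1 := @derivable_under_integral R _ _ leb f setT measurableT t (t - 1) (t + 1) It
  (fun x _ => if_ x) (fun x z _ _ => @ex_derive _ _ _ _ _ _ _ (df x z)) _ G0
  integrable_normal_first_moment (fun x z _ _ => Gub x z).
have d2 := @differentiation_under_integral R _ _ leb f setT measurableT t (t - 1) (t + 1) It
  (fun x _ => if_ x) (fun x z _ _ => @ex_derive _ _ _ _ _ _ _ (df x z)) _ G0
  integrable_normal_first_moment (fun x z _ _ => Gub x z).
apply: DeriveDef => //.
rewrite -derive1E [LHS]d2 mulNr -normal_by_parts -mulN1r -RintegralZl//.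
  by apply: eq_Rintegral => z _; rewrite df1 mulN1r.
exact: integrable_sin_moment.
Qed.

(** The equation [f' = - t f], obtained under the integral sign and by parts, says that
    [f(t) e^(t^2/2)] is constant; its value at 0 is the total mass. *)
Lemma normal_cfE (t : R) : normal_cf t = expR (- (t ^+ 2 / 2)).
Proof.
pose h t := normal_cf t * expR (t ^+ 2 / 2).
have dh x : is_derive x (1 : R) h 0.
  have d1 : is_derive x (1 : R) (fun y : R => y ^+ 2) (x *+ 2).
    by apply: is_derive_eq; rewrite /= scaler1.
  have d2 : is_derive x (1 : R) (fun y : R => y ^+ 2 / 2) x.
    have -> : (fun y : R => y ^+ 2 / 2) = 2^-1 *: (fun y : R => y ^+ 2).
      by apply/funext => y; rewrite mulrC.
    apply: (is_derive_eq (is_deriveZ (2^-1) d1)).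
    by rewrite /GRing.scale /=; field.
  have d3 := @is_derive1_comp R expR (fun y : R => y ^+ 2 / 2) x _ _ (is_derive_expR _) d2.
  apply: (is_derive_eq (is_deriveM (is_derive_normal_cf x) d3)).
  by rewrite /GRing.scale /=; ring.
have := is_derive_0_is_cst t 0 dh.
have -> : h 0 = 1.
  rewrite /h expr0n mul0r expR0 mulr1 /normal_cf.
  under eq_Rintegral do rewrite mul0r cos0 mul1r.
  by rewrite /Rintegral integral_normal_pdf.
move=> h1; apply: (mulIf (lt0r_neq0 (expR_gt0 (t ^+ 2 / 2)))).
by rewrite [LHS]h1 -expRD addNr expR0.
Qed.

End gaussian.

Section Rfubini.
Context d1 d2 (X : measurableType d1) (Y : measurableType d2) (R : realType).
Variables (m1 : {sigma_finite_measure set X -> \bar R})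
  (m2 : {sigma_finite_measure set Y -> \bar R}).

Lemma Rfubini (F : X -> Y -> R) :
  (m1 \x m2)%E.-integrable setT (fun z => (F z.1 z.2)%:E) ->
  (forall x, m2.-integrable setT (EFin \o F x)) ->
  (forall y, m1.-integrable setT (EFin \o F^~ y)) ->
  \int[m1]_x \int[m2]_y F x y = \int[m2]_y \int[m1]_x F x y.
Proof.
move=> iF i2 i1; rewrite /Rintegral; congr fine.
have E := Fubini iF.
transitivity (\int[m1]_x \int[m2]_y (F x y)%:E)%E.
  by apply: eq_integral => x _; rewrite fineK// (integrable_fin_num measurableT (i2 x)).
transitivity (\int[m2]_y \int[m1]_x (F x y)%:E)%E; first exact: E.
by apply: eq_integral => y _; rewrite fineK// (integrable_fin_num measurableT (i1 y)).
Qed.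

End Rfubini.

(** * Cosine transforms as test functions *)

Section cosine_transform.
Context (R : realType).
Local Notation leb := (@lebesgue_measure R).

(** The frequency scale [a] is separate from the kernel, so that smoothing at width [e] can use
    frequencies [z / e] with a standard normal factor in [z], without a change of variables. *)
Definition cosine_transform (k : R -> R) (a x : R) : R :=
  \int[leb]_z (k z * cos (a * z * x)).

Variable k : R -> R.
Hypothesis ik : leb.-integrable setT (EFin \o k).

Let mk : measurable_fun setT k.
Proof. by apply/measurable_EFinP; exact: measurable_int ik. Qed.

Lemma integrable_cosine (b : R -> R) : measurable_fun setT b ->
  leb.-integrable setT (EFin \o (fun z => k z * cos (b z))).
Proof.
move=> mb; apply: (@le_integrableR _ _ R leb _ (fun z : R => `|k z|)).
- apply: measurable_funM => //; apply: measurableT_comp => //.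
  exact: continuous_measurable_fun (@continuous_cos R).
- by move=> z; rewrite normrM ler_piMr// cos_norm_le1.
- by have := integrable_abse ik; apply: eq_integrable.
Qed.

Lemma cosine_transform_le (a x : R) : `|cosine_transform k a x| <= \int[leb]_z `|k z|.
Proof.
have ic : leb.-integrable setT (EFin \o (fun z => k z * cos (a * z * x))).
  apply: integrable_cosine => //; apply: measurable_funM => //; exact: measurable_funM.
apply: le_trans (le_normr_Rintegral _ ic) _ => //.
apply: le_Rintegral => //.
- by have := integrable_abse ic; apply: eq_integrable.
- by have := integrable_abse ik; apply: eq_integrable.
- by move=> z _; rewrite normrM ler_piMr// cos_norm_le1.
Qed.

Lemma continuous_cosine_transform (a : R) : continuous (cosine_transform k a).
Proof.
move=> x; apply/(@cvg_nbhsP _ R^o) => u ux.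
apply: (@dominated_cvgR _ _ R leb (fun n z => k z * cos (a * z * u n)) _ (fun z : R => `|k z|)).
- move=> n; apply: measurable_funM => //; apply: measurableT_comp.
    exact: continuous_measurable_fun (@continuous_cos R).
  by apply: measurable_funM => //; exact: measurable_funM.
- move=> z; apply: cvgM; first exact: cvg_cst.
  have h : a * z * u n @[n --> \oo] --> a * z * x by apply: cvgM; [exact: cvg_cst|exact: ux].
  exact: (cvg_comp _ _ h (@continuous_cos R _)).
- by have := integrable_abse ik; apply: eq_integrable.
- by move=> n z; rewrite normrM ler_piMr// cos_norm_le1.
Qed.

Lemma measurable_cosine_transform (a : R) : measurable_fun setT (cosine_transform k a).
Proof. exact: continuous_measurable_fun (@continuous_cosine_transform a). Qed.

Section law.
Context d (X : measurableType d) (mu : {sigma_finite_measure set X -> \bar R}).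
Variables (S W : X -> R).
Hypotheses (mS : measurable_fun setT S) (iW : mu.-integrable setT (EFin \o W)).

Lemma integral_cosine_transform (a : R) :
  \int[mu]_x (cosine_transform k a (S x) * W x) =
  \int[leb]_z (k z * \int[mu]_x (cos (a * z * S x) * W x)).
Proof.
have mW : measurable_fun setT W by apply/measurable_EFinP; exact: measurable_int iW.
pose F x z := k z * cos (a * z * S x) * W x.
have mF : measurable_fun setT (fun u : X * R => F u.1 u.2).
  apply: measurable_funM; last exact: measurableT_comp.
  apply: measurable_funM; first exact: measurableT_comp.
  apply: measurableT_comp; first exact: continuous_measurable_fun (@continuous_cos R).
  apply: measurable_funM; last exact: measurableT_comp.
  by apply: measurable_funM => //; exact: measurable_snd.
have [iWk _] := Rintegral_product iW ik.
have iF : (mu \x leb)%E.-integrable setT (fun u => (F u.1 u.2)%:E).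
  refine (@le_integrableR _ _ R (mu \x leb)%E (fun u => F u.1 u.2) (fun u => `|W u.1 * k u.2|) mF _ _).
    move=> u; rewrite /F normrM [leRHS]normrM [leRHS]mulrC ler_wpM2r//.
    by rewrite normrM ler_piMr// cos_norm_le1.
  by have := integrable_abse iWk; apply: eq_integrable.
have i2 x : leb.-integrable setT (EFin \o F x).
  have -> : EFin \o F x = (fun z => (k z * cos (a * z * S x))%:E * (W x)%:E)%E by apply/funext.
  apply: integrableZr => //; apply: integrable_cosine.
  by apply: measurable_funM => //; exact: measurable_funM.
have i1c z : mu.-integrable setT (EFin \o (fun x => cos (a * z * S x) * W x)).
  by apply: integrable_bounded_mul => //; [exact: measurable_cos_mul|move=> x; exact: cos_norm_le1].
have FE x z : F x z = k z * (cos (a * z * S x) * W x) by rewrite /F mulrA.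
have i1 z : mu.-integrable setT (EFin \o F^~ z).
  have -> : EFin \o F^~ z = (fun x => (k z)%:E * (cos (a * z * S x) * W x)%:E)%E.
    by apply/funext => x /=; rewrite FE.
  by apply: integrableZl => //; exact: i1c.
have := @Rfubini _ _ _ _ R mu leb F iF i2 i1.
under [X in X = _]eq_Rintegral => x _.
  rewrite RintegralZr//; last first.
    by apply: integrable_cosine; apply: measurable_funM => //; exact: measurable_funM.
over.
move=> ->; apply: eq_Rintegral => z _.
by under eq_Rintegral do rewrite FE; rewrite RintegralZl.
Qed.

(** Total mass at most 1, rather than equal to 1, is the form that fits the tilted laws and their
    limit, both of which may have lost mass. *)
Lemma law_close (f g : R -> R) (e : R) : measurable_fun setT f -> measurable_fun setT g ->
  (forall x, 0 <= W x) -> \int[mu]_x W x <= 1 ->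
  (forall x, `|g x| <= 1) -> (forall x, `|g x - f x| <= e) ->
  `|\int[mu]_x (g (S x) * W x) - \int[mu]_x (f (S x) * W x)| <= e.
Proof.
move=> mf mg W0 W1 g1 gf.
have e0 : 0 <= e by exact: le_trans (gf 0).
have mW : measurable_fun setT W by apply/measurable_EFinP; exact: measurable_int iW.
have ib (h : R -> R) (C : R) : measurable_fun setT h -> (forall x, `|h x| <= C) ->
    mu.-integrable setT (EFin \o (fun x => h (S x) * W x)).
  move=> mh hC; apply: (@le_integrableR _ _ _ _ _ (fun x => C * W x)).
  - by apply: measurable_funM => //; exact: measurableT_comp.
  - by move=> x; rewrite normrM (ger0_norm (W0 x)) ler_wpM2r.
  - have -> : EFin \o (fun x => C * W x) = (fun x => C%:E * (W x)%:E)%E by apply/funext.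
    exact: integrableZl.
have ig := ib g 1 mg g1.
have if_ : mu.-integrable setT (EFin \o (fun x => f (S x) * W x)).
  apply: (ib f (1 + e) mf) => x.
  have -> : f x = g x - (g x - f x) by ring.
  by apply: le_trans (ler_normB _ _) _; exact: lerD.
rewrite -RintegralB//.
have igf : mu.-integrable setT (EFin \o (fun x => g (S x) * W x - f (S x) * W x)).
  have -> : EFin \o (fun x => g (S x) * W x - f (S x) * W x) =
    (fun x => (g (S x) * W x)%:E - (f (S x) * W x)%:E)%E by apply/funext.
  exact: integrableB.
apply: le_trans (le_normr_Rintegral _ igf) _ => //.
apply: (@le_trans _ _ (\int[mu]_x (e * W x))).
  apply: le_Rintegral => //.
  - by have := integrable_abse igf; apply: eq_integrable.
  - have -> : EFin \o (fun x => e * W x) = (fun x => e%:E * (W x)%:E)%E by apply/funext.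
    exact: integrableZl.
  - by move=> x _; rewrite -mulrBl normrM (ger0_norm (W0 x)) ler_wpM2r.
by rewrite RintegralZl// ler_piMr.
Qed.

End law.
End cosine_transform.

Section laplace_function.
Context (R : realType).
Local Notation leb := (@lebesgue_measure R).
Local Notation N := (@normal_pdf R).

Definition laplace_fun (x : R) : R := expR (- (`|x| / 2)).

Lemma measurable_laplace_fun : measurable_fun setT laplace_fun.
Proof.
apply: measurableT_comp => //; apply: measurableT_comp => //.
by apply: measurable_funM => //; exact: normr_measurable.
Qed.

Lemma laplace_fun_norm_le1 x : `|laplace_fun x| <= 1.
Proof.
rewrite ger0_norm ?expR_ge0// -expR0 ler_expR oppr_le0.
by rewrite divr_ge0.
Qed.

Lemma laplace_fun_lipschitz x y : `|laplace_fun y - laplace_fun x| <= `|y - x|.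
Proof.
wlog xy : x y / `|x| <= `|y|.
  move=> h; have [|/ltW] := leP `|x| `|y|; first exact: h.
  by move=> /h; rewrite distrC [X in _ <= X -> _]distrC.
have d : `|y| - `|x| <= `|y - x| by exact: lerB_dist.
rewrite distrC ger0_norm; last first.
  by rewrite subr_ge0 ler_expR lerN2 ler_pM2r.
have E : laplace_fun y = laplace_fun x * expR (- ((`|y| - `|x|) / 2)).
  by rewrite /laplace_fun -expRD; congr expR; field.
rewrite E -{1}[laplace_fun x]mulr1 -mulrBr.
apply: le_trans (_ : 1 - expR (- ((`|y| - `|x|) / 2)) <= _).
  rewrite ler_piMl ?subr_ge0//; last first.
    by have := laplace_fun_norm_le1 x; rewrite ger0_norm// expR_ge0.
  by rewrite -expR0 ler_expR oppr_le0 divr_ge0// subr_ge0.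
have := expR_ge1Dx (- ((`|y| - `|x|) / 2)).
have : 0 <= `|y| - `|x| by rewrite subr_ge0.
lra.
Qed.

Lemma integrable_laplace_fun : leb.-integrable setT (EFin \o laplace_fun).
Proof.
have r0 : 0 < 2^-1 :> R by rewrite invr_gt0.
have ie := integrable_exponential_pdf r0.
have ieN : leb.-integrable setT (EFin \o (fun y => exponential_pdf (2^-1) (- y))).
  have := ie; rewrite (integrable_measure_preserving (measure_preserving_opp R))//.
  by apply/measurable_EFinP; exact: measurable_exponential_pdf.
apply: (@le_integrableR _ _ R leb _
  (fun y : R => 2 * (exponential_pdf (2^-1) y + exponential_pdf (2^-1) (- y)))).
- exact: measurable_laplace_fun.
- move=> y; rewrite ger0_norm ?expR_ge0//.
  have e0 (x : R) : 0 <= exponential_pdf (2^-1) x by exact: exponential_pdf_ge0 (ltW r0) _.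
  have E (x : R) : 0 <= x -> laplace_fun x = 2 * exponential_pdf (2^-1) x.
    move=> x0; rewrite exponential_pdfE// /laplace_fun ger0_norm// mulrA divff// mul1r.
    by congr expR; field.
  have [y0|/ltW y0] := leP 0 y; first by rewrite E// ler_pM2l// lerDl.
  rewrite /laplace_fun -normrN -/(laplace_fun (- y)) E ?oppr_ge0//.
  by rewrite ler_pM2l// lerDr.
- have -> : EFin \o (fun y : R => 2 * (exponential_pdf (2^-1) y + exponential_pdf (2^-1) (- y))) =
    (fun y => 2%:E * ((exponential_pdf (2^-1) y)%:E + (exponential_pdf (2^-1) (- y))%:E))%E.
    by apply/funext => y /=; rewrite -EFinD -EFinM.
  by apply: integrableZl => //; exact: integrableD.
Qed.

(** The Gaussian is its own Fourier transform up to scaling; this is what brings cosines into the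
    smoothing integral. *)
Lemma normal_pdf_cf (x e y : R) : 0 < e ->
  N x e y = normal_peak e * normal_cf (e^-1 * (y - x)).
Proof.
move=> e0; rewrite normal_pdf_expR// normal_cfE; congr (_ * expR _).
by field; rewrite gt_eqF.
Qed.

Definition laplace_smooth (e x : R) : R := \int[leb]_y (laplace_fun y * N x e y).

Lemma integrable_laplace_normal (e x : R) :
  leb.-integrable setT (EFin \o (fun y => laplace_fun y * N x e y)).
Proof.
apply: (@integrable_bounded_mul R _ _ leb laplace_fun (N x e)).
- exact: measurable_laplace_fun.
- exact: laplace_fun_norm_le1.
- exact: integrable_normal_pdf.
Qed.

(** A 1-Lipschitz function moves by at most the first absolute moment of the smoothing law, which is
    at most [e *+ 2]. *)
Lemma laplace_smooth_close (e x : R) : 0 < e ->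
  `|laplace_fun x - laplace_smooth e x| <= e *+ 2.
Proof.
move=> e0; have iN s : leb.-integrable setT (EFin \o N x s) by exact: integrable_normal_pdf.
have N1 s : \int[leb]_y N x s y = 1 by rewrite /Rintegral integral_normal_pdf.
have iZ c s : leb.-integrable setT (EFin \o (fun y => c * N x s y)).
  have -> : EFin \o (fun y => c * N x s y) = (fun y => c%:E * (N x s y)%:E)%E by apply/funext.
  by apply: integrableZl => //; exact: iN.
have -> : laplace_fun x = \int[leb]_y (laplace_fun x * N x e y).
  by rewrite RintegralZl// N1 mulr1.
rewrite -RintegralB//; last exact: integrable_laplace_normal.
have id_ : leb.-integrable setT (EFin \o (fun y => laplace_fun x * N x e y - laplace_fun y * N x e y)).
  have -> : EFin \o (fun y => laplace_fun x * N x e y - laplace_fun y * N x e y) =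
    (fun y => (laplace_fun x * N x e y)%:E - (laplace_fun y * N x e y)%:E)%E by apply/funext.
  by apply: integrableB; [by []|exact: iZ|exact: integrable_laplace_normal].
apply: le_trans (le_normr_Rintegral _ id_) _ => //.
rewrite -[leRHS]mulr1 -(N1 (Num.sqrt 2 * e)) -RintegralZl//.
apply: le_Rintegral => //.
  by have := integrable_abse id_; apply: eq_integrable.
move=> y _; rewrite -mulrBl normrM (ger0_norm (normal_pdf_ge0 _ _ _)).
apply: le_trans (normal_pdf_first_moment_le _ _ e0).
by rewrite ler_wpM2r ?normal_pdf_ge0// distrC laplace_fun_lipschitz.
Qed.

Lemma laplace_sin_eq0 (c : R) : \int[leb]_y (laplace_fun y * sin (c * y)) = 0.
Proof.
have ms : measurable_fun setT (fun y : R => sin (c * y)) by exact: (@measurable_sin_mul R _ _ c id).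
have is_ : leb.-integrable setT (EFin \o (fun y => laplace_fun y * sin (c * y))).
  have := @integrable_bounded_mul R _ _ leb (fun y => sin (c * y)) laplace_fun ms
    (fun y => sin_norm_le1 _) integrable_laplace_fun.
  by apply: eq_integrable => // y _ /=; rewrite mulrC.
have mf : measurable_fun setT (fun y => laplace_fun y * sin (c * y)).
  by apply: measurable_funM => //; exact: measurable_laplace_fun.
have : \int[leb]_y (laplace_fun y * sin (c * y)) =
    (-1) * \int[leb]_y (laplace_fun y * sin (c * y)).
  rewrite {1}(Rintegral_measure_preserving (measure_preserving_opp R))//.
  rewrite -RintegralZl//; apply: eq_Rintegral => y _.
  by rewrite /laplace_fun normrN mulrN sinN mulrN mulN1r.
lra.
Qed.

(* The normal density of variance e^2 is the cosine transform of a normal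
   density, so smoothing by it turns laplace_fun into a cosine transform. *)
Definition laplace_kernel (e z : R) : R :=
  N 0 1 z * (normal_peak e * cosine_transform laplace_fun e^-1 z).

Lemma integrable_laplace_kernel e : leb.-integrable setT (EFin \o laplace_kernel e).
Proof.
set C := normal_peak e * \int[leb]_y `|laplace_fun y|.
apply: (@le_integrableR _ _ R leb _ (fun z : R => C * N 0 1 z)).
- apply: measurable_funM; first exact: measurable_normal_pdf.
  by apply: measurable_funM => //; apply: measurable_cosine_transform; exact: integrable_laplace_fun.
- move=> z; rewrite normrM (ger0_norm (normal_pdf_ge0 _ _ _)) mulrC ler_wpM2r ?normal_pdf_ge0//.
  rewrite normrM ger0_norm ?normal_peak_ge0// ler_wpM2l ?normal_peak_ge0//.
  by apply: cosine_transform_le; exact: integrable_laplace_fun.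
- have -> : EFin \o (fun z : R => C * N 0 1 z) = (fun z => C%:E * (N 0 1 z)%:E)%E by apply/funext.
  by apply: integrableZl => //; exact: integrable_normal_pdf.
Qed.

(** After exchanging the integrals, [cos (a z (y - x))] is expanded; its sine part integrates to 0
    in [y] because [laplace_fun] is even. *)
Lemma laplace_smoothE (e x : R) : 0 < e ->
  laplace_smooth e x = cosine_transform (laplace_kernel e) e^-1 x.
Proof.
move=> e0; set a := e^-1; set p := normal_peak e.
pose F y z := p * (laplace_fun y * (N 0 1 z * cos (a * z * (y - x)))).
have ilap := integrable_laplace_fun; have iN := @integrable_normal_pdf01 R.
have mcos (b : R -> R) : measurable_fun setT b -> measurable_fun setT (fun z => cos (b z)).
  move=> mb; apply: measurableT_comp => //; exact: continuous_measurable_fun (@continuous_cos R).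
have mF : measurable_fun setT (fun u : R * R => F u.1 u.2).
  apply: measurable_funM => //; apply: measurable_funM.
    exact: (measurableT_comp measurable_laplace_fun measurable_fst).
  apply: measurable_funM.
    exact: (measurableT_comp (measurable_normal_pdf 0 1) measurable_snd).
  apply: measurableT_comp; first exact: continuous_measurable_fun (@continuous_cos R).
  apply: measurable_funM; last by apply: measurable_funB => //; exact: measurable_fst.
  by apply: measurable_funM => //; exact: measurable_snd.
have [ilN _] := @Rintegral_product _ _ _ _ R leb leb _ _ ilap iN.
have iF : (leb \x leb)%E.-integrable setT (fun u => (F u.1 u.2)%:E).
  refine (@le_integrableR _ _ R (leb \x leb)%E (fun u => F u.1 u.2)
    (fun u => p * `|laplace_fun u.1 * N 0 1 u.2|) mF _ _).
    move=> u; rewrite /F normrM ger0_norm ?normal_peak_ge0// ler_wpM2l ?normal_peak_ge0//.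
    by rewrite !normrM ler_wpM2l// ler_piMr// cos_norm_le1.
  have iab := integrableZl measurableT p (integrable_abse ilN).
  by move: iab; apply: eq_integrable.
have i2 y : leb.-integrable setT (EFin \o F y).
  have ic : leb.-integrable setT (EFin \o (fun z => N 0 1 z * cos (a * z * (y - x)))).
    apply: integrable_cosine => //; apply: measurable_funM => //; exact: measurable_funM.
  have := integrableZl measurableT (p * laplace_fun y) ic.
  by apply: eq_integrable => // z _; rewrite /= /F -EFinM; congr (_%:E); ring.
have i1 z : leb.-integrable setT (EFin \o F^~ z).
  have ic : leb.-integrable setT (EFin \o (fun y => laplace_fun y * cos (a * z * (y - x)))).
    apply: integrable_cosine => //; apply: measurable_funM => //; exact: measurable_funB.
  have := integrableZl measurableT (p * N 0 1 z) ic.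
  by apply: eq_integrable => // y _; rewrite /= /F -EFinM; congr (_%:E); ring.
have := @Rfubini _ _ _ _ R leb leb F iF i2 i1.
have -> : \int[leb]_y \int[leb]_z F y z = laplace_smooth e x.
  apply: eq_Rintegral => y _; rewrite normal_pdf_cf// mulrCA -/p.
  rewrite /normal_cf -RintegralZl//; last exact: integrable_cos_normal.
  rewrite -RintegralZl//; last first.
    have -> : EFin \o (fun z => laplace_fun y * (cos (a * (y - x) * z) * N 0 1 z)) =
      (fun z => (laplace_fun y)%:E * (cos (a * (y - x) * z) * N 0 1 z)%:E)%E by apply/funext.
    by apply: integrableZl => //; exact: integrable_cos_normal.
  by apply: eq_Rintegral => z _; rewrite /F [N 0 1 z * _]mulrC [a * z * _]mulrAC.
move=> ->; apply: eq_Rintegral => z _.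
have ic c : leb.-integrable setT (EFin \o (fun y => laplace_fun y * cos (c * y))).
  by apply: integrable_cosine => //; exact: measurable_funM.
have is_ c : leb.-integrable setT (EFin \o (fun y => laplace_fun y * sin (c * y))).
  have := @integrable_bounded_mul R _ _ leb (fun y => sin (c * y)) laplace_fun
    (@measurable_sin_mul R _ _ c id (@measurable_id _ _ setT)) (fun y => sin_norm_le1 _) ilap.
  by apply: eq_integrable => // y _ /=; rewrite mulrC.
have FE y : F y z = p * N 0 1 z * cos (a * z * x) * (laplace_fun y * cos (a * z * y)) +
    p * N 0 1 z * sin (a * z * x) * (laplace_fun y * sin (a * z * y)).
  by rewrite /F mulrBr cosB; ring.
under eq_Rintegral do rewrite FE.
rewrite RintegralD//; last first.
- have -> : EFin \o (fun y => p * N 0 1 z * sin (a * z * x) * (laplace_fun y * sin (a * z * y))) =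
    (fun y => (p * N 0 1 z * sin (a * z * x))%:E * (laplace_fun y * sin (a * z * y))%:E)%E by apply/funext.
  by apply: integrableZl => //; exact: is_.
- have -> : EFin \o (fun y => p * N 0 1 z * cos (a * z * x) * (laplace_fun y * cos (a * z * y))) =
    (fun y => (p * N 0 1 z * cos (a * z * x))%:E * (laplace_fun y * cos (a * z * y))%:E)%E by apply/funext.
  by apply: integrableZl => //; exact: ic.
rewrite !RintegralZl ?laplace_sin_eq0 ?mulr0 ?addr0 /laplace_kernel; [|by []|exact: is_|by []|exact: ic].
rewrite -/p -/a /cosine_transform.
under [X in _ = _ * (_ * X) * _]eq_Rintegral do rewrite mulrAC.
by ring.
Qed.

Lemma laplace_fun_approx (e : R) : 0 < e -> exists k a,
  leb.-integrable setT (EFin \o k) /\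
  forall x, `|laplace_fun x - cosine_transform k a x| <= e.
Proof.
move=> e0; have e2 : 0 < e / 2 by rewrite divr_gt0.
exists (laplace_kernel (e / 2)), (e / 2)^-1; split; first exact: integrable_laplace_kernel.
move=> x; rewrite -laplace_smoothE//.
apply: le_trans (laplace_smooth_close _ e2) _.
by rewrite (_ : e / 2 *+ 2 = e)//; field.
Qed.

End laplace_function.

Section levy.
Context (R : realType).
Local Notation leb := (@lebesgue_measure R).

(* [E_ n] stands for the expectation under the n-th law.  Only test functions
   that are uniform limits of cosine transforms of integrable kernels occur,
   for which neither tightness nor Prokhorov's theorem is needed. *)
Lemma levy_continuity (E_ : nat -> (R -> R) -> R) (E : (R -> R) -> R)
    (phi_ : nat -> R -> R) (phi g : R -> R) :
  (forall n k a, leb.-integrable setT (EFin \o k) ->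
    E_ n (cosine_transform k a) = \int[leb]_z (k z * phi_ n (a * z))) ->
  (forall k a, leb.-integrable setT (EFin \o k) ->
    E (cosine_transform k a) = \int[leb]_z (k z * phi (a * z))) ->
  (forall n (f : R -> R) (e : R), measurable_fun setT f -> (forall x, `|g x - f x| <= e) ->
    `|E_ n g - E_ n f| <= e) ->
  (forall (f : R -> R) (e : R), measurable_fun setT f -> (forall x, `|g x - f x| <= e) ->
    `|E g - E f| <= e) ->
  (forall n, measurable_fun setT (phi_ n)) ->
  (forall n t, `|phi_ n t| <= 1) ->
  (forall t, phi_ n t @[n --> \oo] --> phi t) ->
  (forall e, 0 < e -> exists k a, leb.-integrable setT (EFin \o k) /\
    forall x, `|g x - cosine_transform k a x| <= e) ->
  E_ n g @[n --> \oo] --> E g.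
Proof.
move=> ctn ct cln cl mphi phi1 phic happrox; apply/cvgrPdist_le => e e0.
have e3 : 0 < e / 3 by rewrite divr_gt0.
have [k [a [ik hk]]] := happrox _ e3.
have mct := measurable_cosine_transform ik a.
have : \int[leb]_z (k z * phi_ n (a * z)) @[n --> \oo] --> \int[leb]_z (k z * phi (a * z)).
  have mk : measurable_fun setT k by apply/measurable_EFinP; exact: measurable_int ik.
  apply: (@dominated_cvgR _ _ R leb (fun n z => k z * phi_ n (a * z)) _ (fun z : R => `|k z|)).
  - move=> n; apply: measurable_funM => //.
    apply: (measurableT_comp (mphi n)); exact: measurable_funM.
  - by move=> z; apply: cvgM; [exact: cvg_cst|exact: phic].
  - by have := integrable_abse ik; apply: eq_integrable.
  - by move=> n z; rewrite normrM ler_piMr.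
move=> /cvgrPdist_le/(_ _ e3); apply: filterS => n hn.
rewrite -ctn// -ct// in hn.
have h1 := cln n _ _ mct hk; have h2 := cl _ _ mct hk.
have -> : E g - E_ n g = (E g - E (cosine_transform k a)) +
   (E (cosine_transform k a) - E_ n (cosine_transform k a)) -
   (E_ n g - E_ n (cosine_transform k a)) by ring.
apply: le_trans (ler_normB _ _) _; apply: (@le_trans _ _ (e / 3 + e / 3 + e / 3)).
  by apply: lerD => //; apply: le_trans (ler_normD _ _) _; exact: lerD.
lra.
Qed.

End levy.

Section gaussian_limit.
Context (R : realType).
Local Notation leb := (@lebesgue_measure R).
Local Notation N := (@normal_pdf R).

(** For [z <= 0] the exponents complete the square, [s z/2 - s^2/8 - z^2/2 = -(z - s/2)^2/2], so the
    integrand is the normal density with mean [s/2]. The integrand is even, whence the factor 2. *)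
Lemma laplace_gaussian_cdf (s : R) : 0 <= s ->
  \int[leb]_z (laplace_fun (s * z) * (expR (- (s ^+ 2 / 8)) * N 0 1 z)) =
  2 * normal_cdf (- s / 2).
Proof.
move=> s0; pose Q z := N (s / 2) 1 z.
have iQ : leb.-integrable setT (EFin \o Q) by exact: integrable_normal_pdf.
have mQ : measurable_fun setT Q by exact: measurable_normal_pdf.
have EQ z : z <= 0 ->
    laplace_fun (s * z) * (expR (- (s ^+ 2 / 8)) * N 0 1 z) = Q z.
  move=> z0; rewrite /Q !normal_pdf_expR// /laplace_fun ler0_norm; last first.
    by rewrite mulr_ge0_le0.
  set p := normal_peak 1; set x := expR _; set y := expR _; set w := expR _.
  rewrite (_ : x * (y * (p * w)) = p * (x * y * w)); last by ring.
  by congr (_ * _); rewrite -!expRD; congr expR; field.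
have QN z : laplace_fun (s * - z) * (expR (- (s ^+ 2 / 8)) * N 0 1 (- z)) =
    laplace_fun (s * z) * (expR (- (s ^+ 2 / 8)) * N 0 1 z).
  by rewrite /laplace_fun mulrN normrN !normal_pdf_expR// !subr0 sqrrN.
(* [A] contains the point 0 and [B] does not, so the splitting into [A z + B (- z)] is exact at
   every [z]. *)
pose A := Q \_ `]-oo, 0]; pose B := Q \_ `]-oo, 0[.
have mA : measurable_fun setT A by apply/measurable_restrict => //; exact: measurable_funS mQ.
have mB : measurable_fun setT B by apply/measurable_restrict => //; exact: measurable_funS mQ.
have ir (D : set R) : measurable D -> leb.-integrable setT (EFin \o (Q \_ D)).
  move=> mD; apply: (@le_integrableR _ _ R leb _ Q) => //.
    by apply/measurable_restrict => //; exact: measurable_funS mQ.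
  move=> z; rewrite patchE; case: ifP => _; first by rewrite ger0_norm// normal_pdf_ge0.
  by rewrite normr0 normal_pdf_ge0.
have iA := ir _ (measurable_itv `]-oo, (0 : R)]).
have iB := ir _ (measurable_itv `]-oo, (0 : R)[).
have iBN : leb.-integrable setT (EFin \o (fun z => B (- z))).
  have := iB; rewrite (integrable_measure_preserving (measure_preserving_opp R))//.
  exact/measurable_EFinP.
have AB z : laplace_fun (s * z) * (expR (- (s ^+ 2 / 8)) * N 0 1 z) = A z + B (- z).
  rewrite /A /B !patchE; case: (ltP 0 z) => z0.
    rewrite ifF; last by apply/negP; rewrite inE /= in_itv /= leNgt z0.
    rewrite ifT; last by rewrite inE /= in_itv /= oppr_lt0.
    by rewrite add0r -EQ ?oppr_le0 1?ltW// QN.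
  rewrite ifT; last by rewrite inE /= in_itv.
  rewrite ifF; last by apply/negP; rewrite inE /= in_itv /= oppr_lt0 ltNge z0.
  by rewrite addr0 EQ.
under eq_Rintegral do rewrite AB.
rewrite RintegralD// -(Rintegral_measure_preserving (measure_preserving_opp R) mB iB).
have AE : \int[leb]_z B z = \int[leb]_z A z.
  rewrite /A /B -!Rintegral_mkcond; apply: Rintegral_itv_bndo_bndc.
  exact: integrableS iQ.
rewrite AE (_ : \int[leb]_z A z + \int[leb]_z A z = 2 * \int[leb]_z A z); last by ring.
congr (_ * _).
(* Shifting by [s / 2] recentres the density and moves the end of the half-line from 0 to
   [- s / 2]. *)
rewrite (Rintegral_measure_preserving (measure_preserving_shift (s / 2)) mA iA).
rewrite /normal_cdf /normal_prob -/(Rintegral _ _ _) [RHS]Rintegral_mkcond.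
apply: eq_Rintegral => z _; rewrite /A !patchE.
have [zs|zs] := leP z (- s / 2).
  rewrite ifT; last by rewrite inE /= in_itv /= -lerBrDr sub0r -mulNr.
  rewrite ifT; last by rewrite inE /= in_itv.
  rewrite /Q normal_pdf_expR// -/(normal_pdf 0 1 z) normal_pdf_expR//.
  by congr (_ * expR _); rewrite addrK subr0.
rewrite ifF; last by apply/negP; rewrite inE /= in_itv /= -lerBrDr sub0r -mulNr leNgt zs.
by rewrite ifF//; apply/negP; rewrite inE /= in_itv /= leNgt zs.
Qed.

End gaussian_limit.

Section Rintegral_mscale.
Context d (X : measurableType d) (R : realType) (mu : {measure set X -> \bar R}).
Variable k : {nonneg R}.
Local Open Scope ereal_scope.

Lemma integrable_mscale (f : X -> \bar R) :
  mu.-integrable setT f -> (mscale k mu).-integrable setT f.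
Proof.
move=> /integrableP[mf foo]; apply/integrableP; split => //.
rewrite ge0_integral_mscale//; last exact: measurableT_comp.
by rewrite lte_mul_pinfty.
Qed.

Lemma Rintegral_mscale (f : X -> R) : mu.-integrable setT (EFin \o f) ->
  (\int[mscale k mu]_x f x = k%:num * \int[mu]_x f x)%R.
Proof.
move=> fi; rewrite /Rintegral -[X in (_ = X * _)%R]/(fine k%:num%:E) -fineM//; last exact: integrable_fin_num.
congr fine; rewrite integralE.
have mf := measurable_int _ fi.
rewrite ge0_integral_mscale//; last exact: measurable_funepos.
rewrite ge0_integral_mscale//; last exact: measurable_funeneg.
rewrite -muleBr//; first by congr (_ * _)%E; rewrite [RHS]integralE.
exact: (integrable_add_def measurableT fi).
Qed.

End Rintegral_mscale.

(** * Integrability of the kinetic part of the Boltzmann weight *)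

Section gaussian_momentum.
Context (R : realType).
Local Notation leb := (@lebesgue_measure R).

Definition row_cons m (xp : R * 'rV[R]_m) : 'rV[R]_m.+1 :=
  row_mx (const_mx xp.1 : 'rV[R]_1) xp.2 : 'rV[R]_(1 + m).

Lemma row_cons0 m (xp : R * 'rV[R]_m) i : row_cons xp i ord0 = xp.1.
Proof.
have -> : ord0 = lshift m (ord0 : 'I_1) :> 'I_(1 + m) by exact/val_inj.
by rewrite /row_cons; apply: etrans (row_mxEl (const_mx xp.1 : 'rV[R]_1) xp.2 i ord0) _; rewrite mxE.
Qed.

Lemma row_consS m (xp : R * 'rV[R]_m) i j : row_cons xp i (lift ord0 j) = xp.2 i j.
Proof.
have -> : lift ord0 j = rshift 1 j :> 'I_(1 + m) by exact/val_inj.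
exact: (row_mxEr (const_mx xp.1 : 'rV[R]_1) xp.2 i j).
Qed.

Lemma measure_preserving_row_cons m :
  measure_preserving (leb \x @lebesgue_mx R 1 m)%E (@lebesgue_mx R 1 m.+1)
    (@row_cons m).
Proof.
apply: (measure_preserving_boxes (@measurable_mx_coord R 1 m.+1) (@mx_coord_generated R 1 m.+1)).
- apply: measurable_fun_mx => i j; case: (unliftP ord0 j) => [k ->|->].
    under eq_fun do rewrite row_consS.
    by apply: (measurableT_comp (measurable_mx_coord (i, k))).
  by under eq_fun do rewrite row_cons0; exact: measurable_fst.
- exact: lebesgue_mx_coordinate_box_lty.
move=> a b.
pose tl (c : 'I_1 * 'I_m.+1 -> R) (ij : 'I_1 * 'I_m) := c (ij.1, lift ord0 ij.2).
rewrite (_ : _ @^-1` _ = `]a (ord0, ord0), b (ord0, ord0)]%classic `*`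
    coordinate_box (@mx_coord R 1 m) (tl a) (tl b)); last first.
  apply/seteqP; split => -[x p].
    move=> h; split => [|[i j]]; rewrite /= ?in_itv /=.
      by have := h (ord0, ord0); rewrite /mx_coord /= row_cons0.
    by have := h (i, lift ord0 j); rewrite /mx_coord /= row_consS.
  move=> [/= h1 h2] [i j]; rewrite /mx_coord /=.
  case: (unliftP ord0 j) => [k ->|->].
    by rewrite row_consS; exact: (h2 (i, k)).
  by rewrite row_cons0 (ord1 i); move: h1; rewrite in_itv.
rewrite [LHS]product_measure1E//; last first.
  exact: measurable_coordinate_box (@measurable_mx_coord R 1 m) _ _.
rewrite [RHS]lebesgue_mx_coordinate_box /= lebesgue_mx_coordinate_box !big_ord1 big_ord_recl.
congr (_ * _)%E; rewrite lebesgue_measure_itv /= lte_fin; case: ltP => [ab|ba].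
  by rewrite max_r ?subr_ge0 1?ltW.
by rewrite max_l// subr_le0.
Qed.

Lemma lebesgue_mx0_setT : @lebesgue_mx R 1 0 setT = 1%E.
Proof.
rewrite (_ : setT = coordinate_box (@mx_coord R 1 0) (fun=> 0) (fun=> 0)).
  by rewrite lebesgue_mx_coordinate_box big_ord1 big_ord0.
by apply/seteqP; split => // Z _ [? []].
Qed.

Lemma integrable_gaussian_momentum m : (@lebesgue_mx R 1 m).-integrable setT
  (fun p => (expR (- (2^-1 * enorm p ^+ 2)))%:E).
Proof.
have sq k (p : 'rV[R]_k) : enorm p ^+ 2 = \sum_j p 0 j ^+ 2.
  by rewrite /enorm sqr_sqrtr// sumr_ge0// => j _; exact: sqr_ge0.
have mE k : measurable_fun setT (fun p : 'rV[R]_k => expR (- (2^-1 * enorm p ^+ 2))).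
  apply: measurableT_comp => //; apply: measurableT_comp => //; apply: measurable_funM => //.
  under eq_fun do rewrite sq; apply: measurable_sum => j.
  by apply: measurable_funX; exact: (measurable_mx_coord (ord0, j)).
elim: m => [|m IH].
  apply: (@le_integrableR _ _ _ _ _ (fun=> 1)).
  - exact: mE.
  - move=> p; rewrite ger0_norm ?expR_ge0// -expR0 ler_expR oppr_le0 mulr_ge0//.
    exact: sqr_ge0.
  - apply/integrableP; split; first exact/measurable_EFinP.
    by under eq_integral do rewrite /= normr1; rewrite integral_cst// mul1e [X in (X < _)%E]lebesgue_mx0_setT ltry.
rewrite (integrable_measure_preserving (measure_preserving_row_cons m)); last by apply/measurable_EFinP; exact: mE.
have i1 : leb.-integrable setT (EFin \o (fun x => expR (- (2^-1 * x ^+ 2)))).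
  have p0 : 0 < normal_peak 1 :> R by rewrite normal_peak_gt0.
  have := integrableZl measurableT (normal_peak 1)^-1 (@integrable_normal_pdf01 R).
  apply: eq_integrable => // x _ /=; rewrite normal_pdf_expR// -EFinM mulrA mulVf ?gt_eqF//.
  by rewrite mul1r subr0 expr1n; congr (expR _)%:E; field.
have [+ _] := Rintegral_product i1 IH.
apply: eq_integrable => // -[x p] _ /=; rewrite -expRD; congr (expR _)%:E.
rewrite !sq big_ord_recl row_cons0 /=.
under [in RHS]eq_bigr do rewrite row_consS.
by ring.
Qed.

End gaussian_momentum.

(** * The product Hamiltonian *)

(** If the integral were 0, [f] would vanish almost everywhere; as it vanishes nowhere, the whole
    space would be null. *)
Lemma Rintegral_gt0 d (X : measurableType d) (R : realType)
    (mu : {measure set X -> \bar R}) (f : X -> R) :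
  (0 < mu setT)%E -> (forall x, 0 < f x) -> mu.-integrable setT (EFin \o f) ->
  0 < \int[mu]_x f x.
Proof.
move=> muT f0 fi.
have I0 : 0 <= \int[mu]_x f x by apply: Rintegral_ge0 => x _; exact: ltW.
rewrite lt_neqAle I0 andbT eq_sym; apply/negP => /eqP h.
have mf := measurable_int _ fi.
have : (\int[mu]_x `|(f x)%:E| = 0)%E.
  under eq_integral do rewrite gee0_abs ?lee_fin ?(ltW (f0 _))//.
  by rewrite -[LHS]fineK ?(integrable_fin_num measurableT fi)// [fine _]h.
move=> /(ae_eq_integral_abs mu measurableT mf)[A [mA A0 hA]].
have AT : A = setT.
  apply/seteqP; split => // x _; apply: hA => /(_ I) /= [] /eqP.
  by rewrite gt_eqF.
by move: muT; rewrite -AT A0 ltxx.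
Qed.

Section phase_space.
Context (R : realType) (m : nat).
Local Notation mxpair d := ('M[R]_(d, m) * 'M[R]_(d, m))%type.

Lemma phase_measure_setT_gt0 : (0 < @phase_measure R 1 m setT)%E.
Proof.
pose B := coordinate_box (@phase_coord R 1 m) (fun=> 0) (fun=> 1).
have mB : measurable B by exact: measurable_coordinate_box (@measurable_phase_coord R 1 m) _ _.
apply: (@lt_le_trans _ _ (phase_measure B)); last by apply: le_measure; rewrite ?inE.
rewrite /B /phase_measure lebesgue_phase_coordinate_box !lebesgue_mx_coordinate_box !big_ord1 /=.
by rewrite subr0 max_r// !big1.
Qed.

Lemma enormN (p : 'rV[R]_m) : enorm (- p) = enorm p.
Proof.
by rewrite /enorm; congr Num.sqrt; apply: eq_bigr => j _; rewrite mxE sqrrN.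
Qed.

Lemma measurable_enorm : measurable_fun setT (@enorm R m).
Proof.
apply: measurableT_comp.
  exact: continuous_measurable_fun (@sqrt_continuous R).
apply: measurable_sum => j; apply: measurable_funX.
exact: (measurable_mx_coord (ord0, j)).
Qed.

Section potential.
Variable V : 'rV[R]_m -> R.
Hypothesis dV : forall q, differentiable V q.
Hypothesis iV : (@lebesgue_mx R 1 m).-integrable setT (fun q => (expR (- V q))%:E).

Lemma measurable_hamiltonian : measurable_fun setT (hamiltonian V : mxpair 1 -> R).
Proof.
apply: measurable_funD.
  apply: measurable_funM => //; apply: measurable_funX.
  exact: (measurableT_comp measurable_enorm measurable_snd).
apply: (measurableT_comp _ measurable_fst); apply: continuous_measurable_mx => q.
exact: differentiable_continuous.
Qed.

Lemma integrable_boltzmann : (@phase_measure R 1 m).-integrable setT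
  (fun z => (expR (- hamiltonian V z))%:E).
Proof.
have [+ _] := Rintegral_product iV (integrable_gaussian_momentum R m).
apply: eq_integrable => // z _ /=; rewrite -expRD; congr (expR _)%:E.
by rewrite /hamiltonian; ring.
Qed.

Definition partition_function : R := \int[@phase_measure R 1 m]_z expR (- hamiltonian V z).

Lemma partition_function_gt0 : 0 < partition_function.
Proof.
apply: Rintegral_gt0 => [|z|]; [exact: phase_measure_setT_gt0|exact: expR_gt0|].
exact: integrable_boltzmann.
Qed.

Lemma hamiltonian_flip (z : phase R 1 m) :
  hamiltonian V (z.1, - z.2) = hamiltonian V z.
Proof. by rewrite /hamiltonian /= enormN. Qed.

Section flow.
Variable psi : phase R 1 m -> phase R 1 m.
Hypothesis m0 : (0 < m)%N.
Hypothesis psi_diff : forall x, differentiable (row_phase psi) x /\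
  `|\det ('J (row_phase psi) x)| = 1.
Hypothesis psi_rev : forall q p q' p',
  psi (q, p) = (q', p') <-> psi (q', - p') = (q, - p).
Let En (z : phase R 1 m) := hamiltonian V (psi z) - hamiltonian V z.

Lemma hamiltonian_flip_flow z : hamiltonian V (flip_flow psi z) = hamiltonian V z + En z.
Proof. by rewrite /flip_flow hamiltonian_flip /En addrC subrK. Qed.

Lemma energy_flip_flow z : En (flip_flow psi z) = - En z.
Proof.
rewrite {1}/En; have := hamiltonian_flip (psi (flip_flow psi z)).
rewrite -/(flip_flow psi (flip_flow psi z)) flip_flowK// => <-.
by rewrite hamiltonian_flip_flow; ring.
Qed.

(** The momentum flip does not change the Hamiltonian, so measurability comes from that of the
    flipped step. *)
Lemma measurable_energy : measurable_fun setT (En : mxpair 1 -> R).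
Proof.
have [mT _] := measure_preserving_flip_flow m0 psi_diff psi_rev.
have -> : En = (fun z => hamiltonian V (flip_flow psi z) - hamiltonian V z).
  by apply/funext => z; rewrite hamiltonian_flip_flow; ring.
apply: measurable_funB; last exact: measurable_hamiltonian.
exact: (measurableT_comp measurable_hamiltonian mT).
Qed.

End flow.
End potential.

Lemma hamiltonian_scaled V l (z : phase R 1 m) :
  hamiltonian (scaled V l) z = hamiltonian V (phase_scale l z).
Proof. by []. Qed.

(** Equivariance reduces every component to the unscaled potential: the constant [l] then enters
    only through the step [h / l] and a dilation of positions. *)
Lemma energy_error_scaled (V : 'rV[R]_m -> R) Psi l h z : equivariant V Psi ->
  0 < l -> 0 < h ->
  energy_error (scaled V l) (Psi (scaled V l)) h z =
  energy_error V (Psi V) (h / l) (phase_scale l z).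
Proof.
move=> eqv l0 h0; case: z => q p; rewrite /energy_error hamiltonian_scaled.
rewrite hamiltonian_scaled; congr (hamiltonian V _ - _).
case E : (Psi (scaled V l) h (q, p)) => [q' p'].
exact: (eqv l l0 h h0 q p q' p').1 (esym E).
Qed.

(** The factor [l ^+ m] also appears in the partition function of the component, so it cancels in
    expectations. *)
Lemma Rintegral_phase_scale (l : R) (f : phase R 1 m -> R) : 0 < l ->
  (@phase_measure R 1 m).-integrable setT (EFin \o f) ->
  (@phase_measure R 1 m).-integrable setT (EFin \o (f \o phase_scale l)) /\
  \int[@phase_measure R 1 m]_z f (phase_scale l z) =
    l ^+ m * \int[@phase_measure R 1 m]_z f z.
Proof.
move=> l0 fi; have SP := measure_preserving_phase_scale m l0.
have mf : measurable_fun setT (f : mxpair 1 -> R) by apply/measurable_EFinP; exact: measurable_int fi.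
have fi' := integrable_mscale (NngNum (exprn_ge0 m (ltW l0))) fi.
split.
  by have := fi'; rewrite (integrable_measure_preserving SP)//; exact/measurable_EFinP.
by rewrite -(Rintegral_measure_preserving SP mf fi') Rintegral_mscale.
Qed.

End phase_space.

(** * The energy error of one component under the tilted law *)

Section energy_law.
Context (R : realType) (m : nat) (V : 'rV[R]_m -> R).
Variables (psi : R -> phase R 1 m -> phase R 1 m) (nu : R) (alpha : phase R 1 m -> R).
Hypothesis m0 : (0 < m)%N.
Hypothesis dV : forall q, differentiable V q.
Hypothesis iV : (@lebesgue_mx R 1 m).-integrable setT (fun q => (expR (- V q))%:E).
Hypothesis vol : volume_preserving psi.
Hypothesis rev : reversible psi.
Hypothesis nu0 : 0 < nu.
Hypothesis cond1 : condition1 V psi nu alpha.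
Hypothesis cond2 : condition2 V psi nu.

Local Notation mu := (@phase_measure R 1 m).
Local Notation H := (hamiltonian V).
Local Notation Z0 := (partition_function V).
Local Notation En := (energy_error V psi).
Local Notation mxpair d := ('M[R]_(d, m) * 'M[R]_(d, m))%type.

Let mH : measurable_fun setT (H : mxpair 1 -> R) := measurable_hamiltonian dV.
Let iH := integrable_boltzmann iV.
Let Z0_gt0 : 0 < Z0 := partition_function_gt0 iV.

Lemma measurable_energy_error h : 0 < h -> measurable_fun setT (En h : mxpair 1 -> R).
Proof. by move=> h0; apply: measurable_energy => //; [exact: vol|exact: rev]. Qed.

Let TP h (h0 : 0 < h) := measure_preserving_flip_flow m0 (vol h0) (rev h0).
Let ET h (h0 : 0 < h) := energy_flip_flow V (rev h0).

(** The characteristic function of the energy error under the tilted weight, divided by the Gibbs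
    partition function and written in its bounded even form. Its value at [t = 0] is the remaining
    mass. *)
Definition energy_cf (t h : R) : R :=
  (\int[mu]_z (tilted_cos t (En h z) * expR (- H z))) / Z0.

Lemma integrable_tilted_cos t h : 0 < h ->
  mu.-integrable setT (EFin \o (fun z => tilted_cos t (En h z) * expR (- H z))).
Proof.
move=> h0; apply: (@integrable_bounded_boltzmann _ _ R mu H mH iH
  (fun z => tilted_cos t (En h z)) 1).
  exact: (measurableT_comp (measurable_tilted_cos t) (measurable_energy_error h0)).
by move=> z; exact: tilted_cos_norm_le1.
Qed.

Lemma energy_cf_norm_le1 t h : 0 < h -> `|energy_cf t h| <= 1.
Proof.
move=> h0; rewrite /energy_cf normrM normfV (gtr0_norm Z0_gt0) ler_pdivrMr// mul1r.
apply: le_trans (le_normr_Rintegral measurableT (integrable_tilted_cos t h0)) _.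
apply: le_Rintegral => //.
- have := integrable_tilted_cos t h0.
  by move=> /integrable_abse; apply: eq_integrable.
- move=> z _; rewrite normrM (ger0_norm (expR_ge0 _)).
  by rewrite -[leRHS]mul1r ler_wpM2r ?expR_ge0// tilted_cos_norm_le1.
Qed.

Lemma one_sub_energy_cf t h : 0 < h -> 1 - energy_cf t h =
  (\int[mu]_z ((1 - tilted_cos t (En h z)) * expR (- H z))) / Z0.
Proof.
move=> h0; under eq_Rintegral do rewrite mulrBl mul1r.
rewrite RintegralB//; last exact: integrable_tilted_cos.
by rewrite mulrBl divff// gt_eqF.
Qed.

Lemma energy_cf_cvg t : ((1 - energy_cf t h) / h `^ (2 * nu)) @[h --> 0^'+] -->
  tilt_rate t * gibbs_expectation mu H (fun z => alpha z ^+ 2).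
Proof.
have [rho [DE rho0]] := cond1; have [G iG DG] := cond2.
(* Condition 2 is stated for the normalized density; multiplying by [Z0] removes the
   normalization. *)
have iG' : mu.-integrable setT (fun z => (G z * expR (- H z))%:E).
  have := integrableZl measurableT Z0 iG; apply: eq_integrable => // z _ /=.
  rewrite -EFinM; congr (_%:E); rewrite /gibbs_density -/Z0; field.
  by rewrite gt_eqF.
have DG' h : 0 < h <= 1 -> forall z, `|En h z| ^+ 3 / h `^ (3 * nu) <= G z.
  move=> h01 z; rewrite -lee_fin; apply: le_trans (DG z); apply: ereal_sup_ubound.
  by exists h => //=; rewrite in_itv.
have ia := integrable_leading_coefficient mH measurable_energy_error iH iG' DE rho0 DG'.
rewrite [X in _ --> tilt_rate t * X](_ : _ = (\int[mu]_z (alpha z ^+ 2 * expR (- H z))) / Z0); last first.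
  rewrite /gibbs_expectation /gibbs_density; under eq_Rintegral do rewrite mulrA.
  by rewrite RintegralZr.
rewrite mulrA.
have L := tilt_asymptotics mH measurable_energy_error iH iG' nu0 DE rho0 DG' (t := t).
apply: cvg_trans (cvgM L (cvg_cst Z0^-1)).
apply: near_eq_cvg; near=> h.
by rewrite one_sub_energy_cf// mulrAC.
Unshelve. all: by end_near.
Qed.

Lemma tilted_energy_integrals t h : 0 < h ->
  [/\ mu.-integrable setT (EFin \o tilted_weight H (En h)),
   \int[mu]_z (sin (t * En h z) * tilted_weight H (En h) z) = 0 &
   \int[mu]_z (cos (t * En h z) * tilted_weight H (En h) z) = Z0 * energy_cf t h].
Proof.
move=> h0; have mE := measurable_energy_error h0.
have HT z : H (flip_flow (psi h) z) = H z + En h z by exact: hamiltonian_flip_flow.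
have DT z : En h (flip_flow (psi h) z) = - En h z by exact: ET.
split.
- exact: (integrable_tilted_weight mH mE (TP h0) HT iH).
- exact: (tilted_sin_eq0 mH mE (TP h0) HT DT iH).
- rewrite (tilted_cosE mH mE (TP h0) HT DT iH) /energy_cf mulrC divfK//.
  by rewrite gt_eqF.
Qed.

End energy_law.

(* min(1, e^-x) = e^-|x|/2 e^-x/2: after tilting the Gibbs density by e^-x/2,
   the acceptance probability becomes an even function of the energy error. *)
Lemma min1_expR (R : realType) (x : R) :
  Num.min 1 (expR (- x)) = laplace_fun x * expR (- (x / 2)).
Proof.
rewrite /laplace_fun -expRD; have [x0|x0] := leP 0 x.
  rewrite min_r; last by rewrite -[leRHS](expR0 R) ler_expR oppr_le0.
  by rewrite ger0_norm//; congr expR; field.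
rewrite min_l; last by rewrite -[leLHS](expR0 R) ler_expR oppr_ge0 ltW.
by rewrite ltr0_norm// -[LHS](expR0 R); congr expR; field.
Qed.

(** * The total energy error under the product of tilted laws *)

Section product_law.
Context (R : realType) (m : nat) (V : 'rV[R]_m -> R).
Variable Psi : ('rV[R]_m -> R) -> R -> phase R 1 m -> phase R 1 m.
Hypothesis m0 : (0 < m)%N.
Hypothesis dV : forall q, differentiable V q.
Hypothesis iV : (@lebesgue_mx R 1 m).-integrable setT (fun q => (expR (- V q))%:E).
Hypothesis eqv : equivariant V Psi.
Hypothesis vol : volume_preserving (Psi V).
Hypothesis rev : reversible (Psi V).
Variable lam : nat -> R.
Hypothesis lam0 : forall i, 0 < lam i.
Variables (h : R) (d : nat).
Hypothesis h0 : 0 < h.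

Local Notation mu := (@phase_measure R 1 m).
Local Notation mud := (@phase_measure R d m).
Local Notation H := (hamiltonian V).
Local Notation Z0 := (partition_function V).
Local Notation En := (energy_error V (Psi V)).
Local Notation cf := (energy_cf V (Psi V)).
Local Notation mxpair d := ('M[R]_(d, m) * 'M[R]_(d, m))%type.

Let hl i : 0 < h / lam i. Proof. exact: divr_gt0. Qed.

Definition rescaled_energy i : phase R 1 m -> R := En (h / lam i) \o phase_scale (lam i).
Definition rescaled_weight i : phase R 1 m -> R :=
  tilted_weight H (En (h / lam i)) \o phase_scale (lam i).
Definition rescaled_boltzmann i : phase R 1 m -> R :=
  (fun z => expR (- H z)) \o phase_scale (lam i).

Lemma measurable_rescaled_energy i : measurable_fun setT (rescaled_energy i : mxpair 1 -> R).
Proof.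
have [mS _] := measure_preserving_phase_scale m (lam0 i).
exact: (measurableT_comp (measurable_energy_error m0 dV vol rev (hl i)) mS).
Qed.

Lemma rescaled_energy_integrals t i :
  [/\ mu.-integrable setT (EFin \o rescaled_weight i),
   \int[mu]_z (sin (t * rescaled_energy i z) * rescaled_weight i z) = 0 &
   \int[mu]_z (cos (t * rescaled_energy i z) * rescaled_weight i z) =
     lam i ^+ m * Z0 * cf t (h / lam i)].
Proof.
have [iw sw cw] := tilted_energy_integrals m0 dV iV vol rev t (hl i).
have mE := measurable_energy_error m0 dV vol rev (hl i).
have is_ := integrable_bounded_mul (measurable_sin_mul t mE) (fun _ => sin_norm_le1 _) iw.
have ic := integrable_bounded_mul (measurable_cos_mul t mE) (fun _ => cos_norm_le1 _) iw.
have [iw' _] := Rintegral_phase_scale (lam0 i) iw.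
have [_ sw'] := Rintegral_phase_scale (lam0 i) is_.
have [_ cw'] := Rintegral_phase_scale (lam0 i) ic.
split; first exact: iw'.
- by rewrite [LHS]sw' sw mulr0.
- by rewrite [LHS]cw' cw mulrA.
Qed.

Lemma row_prod_rescaled_boltzmann (Z : phase R d m) :
  row_prod rescaled_boltzmann Z = expR (- product_hamiltonian V lam Z).
Proof.
rewrite /product_hamiltonian mulr_sumr -big_split -sumrN expR_sum.
by apply: eq_bigr => i _.
Qed.

Definition product_partition : R := \prod_(i < d) (lam i ^+ m * Z0).

Lemma product_partition_gt0 : 0 < product_partition.
Proof.
by apply: prodr_gt0 => i _; rewrite mulr_gt0 ?exprn_gt0// partition_function_gt0.
Qed.

Lemma product_partitionE :
  \int[mud]_Z expR (- product_hamiltonian V lam Z) = product_partition.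
Proof.
have ib i : mu.-integrable setT (EFin \o rescaled_boltzmann i).
  by have [] := Rintegral_phase_scale (lam0 i) (integrable_boltzmann iV).
(* With [t = 0] and zero energies the cosines are 1, and the product formula becomes the
   factorization of the partition function. *)
have [||_ + _] := @product_tilted_integrals R m 0 d (fun _ _ => 0) rescaled_boltzmann _ ib _.
- by move=> i; exact: measurable_cst.
- by move=> i; rewrite (@eq_Rintegral _ _ _ mu setT (cst 0)) ?Rintegral_cst ?mul0r// => z _ /=; rewrite sin0 mul0r.
under eq_Rintegral do rewrite mul0r cos0 mul1r row_prod_rescaled_boltzmann.
move=> ->; apply: eq_bigr => i _.
under eq_Rintegral do rewrite mulr0 cos0 mul1r.
by have [_ ->] := Rintegral_phase_scale (lam0 i) (integrable_boltzmann iV).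
Qed.

Definition product_energy : phase R d m -> R := row_sum rescaled_energy.
Definition product_density (Z : phase R d m) : R :=
  row_prod rescaled_weight Z / product_partition.

Lemma measurable_product_energy : measurable_fun setT (product_energy : mxpair d -> R).
Proof. by apply: measurable_row_sum => i; exact: measurable_rescaled_energy. Qed.

Lemma product_density_ge0 Z : 0 <= product_density Z.
Proof.
apply: divr_ge0; last exact: ltW product_partition_gt0.
by apply: prodr_ge0 => i _; exact: tilted_weight_ge0.
Qed.

Let tilted t := @product_tilted_integrals R m t d rescaled_energy rescaled_weight
  measurable_rescaled_energy (fun i => let: And3 a _ _ := rescaled_energy_integrals t i in a)
  (fun i => let: And3 _ a _ := rescaled_energy_integrals t i in a).

Lemma integrable_product_density : mud.-integrable setT (EFin \o product_density).
Proof.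
have [iw _ _] := tilted 0.
by have := integrableZr measurableT product_partition^-1 iw; apply: eq_integrable.
Qed.

Lemma product_cf t :
  \int[mud]_Z (cos (t * product_energy Z) * product_density Z) =
  \prod_(i < d) cf t (h / lam i).
Proof.
have [iw cw _] := tilted t.
have ic := integrable_bounded_mul (measurable_cos_mul t measurable_product_energy)
  (fun _ => cos_norm_le1 _) iw.
under eq_Rintegral do rewrite /product_density mulrA.
rewrite RintegralZr// [X in X / _]cw.
under eq_bigr do rewrite (let: And3 _ _ a := rescaled_energy_integrals t _ in a).
by rewrite big_split /= -/product_partition mulrAC divff ?mul1r// gt_eqF// product_partition_gt0.
Qed.

Lemma product_cf_norm_le1 t : `|\prod_(i < d) cf t (h / lam i)| <= 1.
Proof.
rewrite normr_prod; apply: prodr_ile1 => i _; rewrite normr_ge0.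
exact: energy_cf_norm_le1.
Qed.

(** The mass is the characteristic function at [t = 0], a product of numbers of absolute value at
    most 1. *)
Lemma product_density_le1 : \int[mud]_Z product_density Z <= 1.
Proof.
have := product_cf 0; under eq_Rintegral do rewrite mul0r cos0 mul1r.
by move=> ->; apply: le_trans (ler_norm _) (product_cf_norm_le1 0).
Qed.

Lemma product_energyE Z : product_energy_error V Psi lam h Z = product_energy Z.
Proof.
rewrite product_energy_errorE; apply: eq_bigr => i _.
exact: energy_error_scaled.
Qed.

Lemma row_prod_rescaled_weight Z : row_prod rescaled_weight Z =
  expR (- (product_energy Z / 2)) * expR (- product_hamiltonian V lam Z).
Proof.
rewrite -row_prod_rescaled_boltzmann /product_energy /row_sum mulr_suml -sumrN expR_sum.
by rewrite -big_split.
Qed.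

Lemma expected_acceptance :
  gibbs_expectation mud (@product_hamiltonian R m V lam d)
    (@acceptance_probability R m V Psi lam d h) =
  \int[mud]_Z (laplace_fun (product_energy Z) * product_density Z).
Proof.
apply: eq_Rintegral => Z _; rewrite /gibbs_density product_partitionE.
rewrite /product_density row_prod_rescaled_weight /acceptance_probability product_energyE.
by rewrite min1_expR !mulrA.
Qed.

End product_law.

Lemma measurable_cf d (X : measurableType d) (R : realType) (mu : {measure set X -> \bar R})
    (S W : X -> R) : measurable_fun setT S -> mu.-integrable setT (EFin \o W) ->
  measurable_fun setT (fun t : R => \int[mu]_x (cos (t * S x) * W x)).
Proof.
move=> mS iW; apply: continuous_measurable_fun => t.
apply/(@cvg_nbhsP _ R^o) => u ut.
have mW : measurable_fun setT W by apply/measurable_EFinP; exact: measurable_int iW.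
apply: (@dominated_cvgR _ _ _ _ _ _ (fun x => `|W x|)).
- by move=> n; apply: measurable_funM => //; exact: measurable_cos_mul.
- move=> x; apply: cvgM; last exact: cvg_cst.
  have h : u n * S x @[n --> \oo] --> t * S x by apply: cvgM; [exact: ut|exact: cvg_cst].
  exact: (cvg_comp _ _ h (@continuous_cos R _)).
- by have := integrable_abse iW; apply: eq_integrable.
- by move=> n x; rewrite normrM -[leRHS]mul1r ler_wpM2r// cos_norm_le1.
Qed.

Lemma bigmaxr_pMr (R : realType) (c : R) (d : nat) (x : 'I_d -> R) : 0 <= c ->
  \big[Num.max/0]_(i < d) (c * x i) = c * \big[Num.max/0]_(i < d) x i.
Proof.
move=> c0; rewrite (big_morph (fun y => c * y) (id1 := 0) (op1 := Num.max))//.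
  by move=> y z; rewrite maxr_pMr.
by rewrite mulr0.
Qed.

(** * Step sizes in the scaling regime *)

Section optimal_scaling.
Context (R : realType) (lam : nat -> R) (nu gamma K ell : R).
Hypotheses (nu0 : 0 < nu) (lam0 : forall i, 0 < lam i) (ell0 : 0 < ell).

Definition step_size (d i : nat) : R := ell / d%:R `^ (gamma / (2 * nu)) / lam i.

Lemma step_size_gt0 d i : (0 < d)%N -> 0 < step_size d i.
Proof. by move=> d0; rewrite !divr_gt0// powR_gt0// ltr0n. Qed.

(** The exponent [gamma / (2 * nu)] is chosen so that the power [2 * nu] leaves [d ^ (- gamma)], the
    normalization in both assumptions on [lam]. *)
Lemma powR_step_size d i : step_size d i `^ (2 * nu) =
  ell `^ (2 * nu) * (d%:R `^ (- gamma)) * (1 / lam i `^ (2 * nu)).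
Proof.
have VE (x : R) a : 0 <= x -> x^-1 `^ a = (x `^ a)^-1.
  by move=> x0; rewrite -powR_inv1// -powRrM mulN1r powRN.
have nn : 2 * nu != 0 by rewrite gt_eqF// mulr_gt0.
rewrite /step_size powRM; [|by rewrite divr_ge0 ?powR_ge0// ltW|by rewrite invr_ge0 ltW].
rewrite powRM; [|exact: ltW|by rewrite invr_ge0 powR_ge0].
rewrite !VE ?powR_ge0//; last exact: ltW.
by rewrite -powRrM divfK// mul1r powRN.
Qed.

Hypothesis sum_cvg : (d%:R `^ (- gamma) * \sum_(i < d) 1 / lam i `^ (2 * nu))
    @[d --> \oo] --> K.
Hypothesis max_cvg :
  (d%:R `^ (- gamma) * \big[Num.max/0]_(i < d) (1 / lam i `^ (2 * nu)))
    @[d --> \oo] --> (0 : R).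

Lemma sum_step_size_cvg :
  \sum_(i < d) step_size d i `^ (2 * nu) @[d --> \oo] --> ell `^ (2 * nu) * K.
Proof.
rewrite (_ : (fun d => _) = (fun d => ell `^ (2 * nu) *
  (d%:R `^ (- gamma) * \sum_(i < d) 1 / lam i `^ (2 * nu)))); last first.
  apply/funext => d; rewrite mulrA mulr_sumr; apply: eq_bigr => i _; exact: powR_step_size.
by apply: cvgM; [exact: cvg_cst|exact: sum_cvg].
Qed.

Lemma max_step_size_cvg :
  \big[Num.max/0]_(i < d) step_size d i `^ (2 * nu) @[d --> \oo] --> (0 : R).
Proof.
rewrite (_ : (fun d => _) = (fun d => ell `^ (2 * nu) *
  (d%:R `^ (- gamma) * \big[Num.max/0]_(i < d) (1 / lam i `^ (2 * nu))))); last first.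
  apply/funext => d; rewrite mulrA -bigmaxr_pMr ?mulr_ge0 ?powR_ge0//.
  by apply: eq_bigr => i _; exact: powR_step_size.
by rewrite -[X in _ --> X](mulr0 (ell `^ (2 * nu))); apply: cvgM; [exact: cvg_cst|exact: max_cvg].
Qed.

End optimal_scaling.

Unset Implicit Arguments.

Theorem theorem3p1 (R : realType) (m : nat) (V : 'rV[R]_m -> R)
    (Psi : ('rV[R]_m -> R) -> R -> phase R 1 m -> phase R 1 m)
    (nu : R) (alpha : phase R 1 m -> R)
    (lam : nat -> R) (gamma K ell : R) :
  (0 < m)%N ->
  (forall q, differentiable V q) ->
  (@lebesgue_mx R 1 m).-integrable setT (fun q => (expR (- V q))%:E) ->
  is_integrator V (Psi V) ->
  equivariant V Psi ->
  volume_preserving (Psi V) ->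
  reversible (Psi V) ->
  0 < nu ->
  condition1 V (Psi V) nu alpha ->
  condition2 V (Psi V) nu ->
  (forall i, 0 < lam i) ->
  0 < gamma -> 0 < K ->
  (d%:R `^ (- gamma) * \sum_(i < d) 1 / lam i `^ (2 * nu))
    @[d --> \oo] --> K ->
  (d%:R `^ (- gamma) * \big[Num.max/0]_(i < d) (1 / lam i `^ (2 * nu)))
    @[d --> \oo] --> (0 : R) ->
  0 < ell ->
  let h (d : nat) := ell / d%:R `^ (gamma / (2 * nu)) in
  let Sigma := gibbs_expectation (lebesgue_phase R 1 m) (hamiltonian V)
                 (fun z => alpha z ^+ 2) in
  gibbs_expectation (lebesgue_phase R d m) (@product_hamiltonian R m V lam d)
      (@acceptance_probability R m V Psi lam d (h d))
    @[d --> \oo] -->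
  2 * normal_cdf (- (ell `^ nu * Num.sqrt (K * Sigma)) / 2).
Proof.
move=> m0 dV iV _ eqv vol rev nu0 cond1 cond2 lam0 gamma0 K0 sum_cvg max_cvg ell0 h Sigma.
have Sigma0 : 0 <= Sigma.
  apply: Rintegral_ge0 => z _; rewrite mulr_ge0 ?sqr_ge0// divr_ge0 ?expR_ge0//.
  exact: ltW (partition_function_gt0 iV).
set s := ell `^ nu * Num.sqrt (K * Sigma).
have s0 : 0 <= s by rewrite mulr_ge0 ?powR_ge0 ?sqrtr_ge0.
have sE : s ^+ 2 = ell `^ (2 * nu) * (K * Sigma).
  by rewrite exprMn sqr_sqrtr ?mulr_ge0// ?(ltW K0)// powR_sqr_nu.
(* At d = 0 the junk value h 0 = ell / 0 = 0 is not a step size. *)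
rewrite -laplace_gaussian_cdf// -(cvg_shiftS _).
have h0 n : 0 < h n.+1 by rewrite divr_gt0// powR_gt0.
pose S n := @product_energy R m V Psi lam (h n.+1) n.+1.
pose W n := @product_density R m V Psi lam (h n.+1) n.+1.
have mS n : measurable_fun setT (S n) by exact: measurable_product_energy.
have iW n : (@phase_measure R n.+1 m).-integrable setT (EFin \o W n).
  exact: integrable_product_density.
under eq_fun do rewrite (expected_acceptance iV eqv lam0 _ (h0 _)).
pose E_ n (f : R -> R) := \int[@phase_measure R n.+1 m]_Z (f (S n Z) * W n Z).
pose E (f : R -> R) :=
  \int[@lebesgue_measure R]_z (f (s * z) * (expR (- (s ^+ 2 / 8)) * normal_pdf 0 1 z)).
pose phi_ n t := \prod_(i < n.+1) energy_cf V (Psi V) t (h n.+1 / lam i).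
(* The limit law is that of [s Z], with [Z] standard normal, and mass [e^(-s^2/8)] instead of 1. *)
pose phi t := expR (- (s ^+ 2 / 8)) * normal_cf (t * s).
have cfE n t : \int[@phase_measure R n.+1 m]_Z (cos (t * S n Z) * W n Z) = phi_ n t.
  exact: product_cf.
have ms : measurable_fun setT (fun z : R => s * z) by exact: measurable_funM.
have iN : (@lebesgue_measure R).-integrable setT
    (EFin \o (fun z => expR (- (s ^+ 2 / 8)) * normal_pdf 0 1 z)).
  have -> : EFin \o (fun z => expR (- (s ^+ 2 / 8)) * normal_pdf 0 1 z) =
    (fun z => (expR (- (s ^+ 2 / 8)))%:E * (normal_pdf 0 1 z)%:E)%E by apply/funext.
  by apply: integrableZl => //; exact: integrable_normal_pdf01.
apply: (@levy_continuity R E_ E phi_ phi (@laplace_fun R)).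
- move=> n k a ik; rewrite /E_ (integral_cosine_transform ik (mS n) (iW n)).
  by under eq_Rintegral do rewrite cfE.
- move=> k a ik; rewrite /E (@integral_cosine_transform R k ik _ _ (@lebesgue_measure R) _ _ ms iN).
  apply: eq_Rintegral => z _; congr (_ * _); rewrite /phi /normal_cf -RintegralZl//.
    by apply: eq_Rintegral => y _; rewrite !mulrA [cos _ * _]mulrC.
  exact: integrable_cos_normal.
- move=> n f e mf fe; apply: (law_close (mS n) (iW n)) => //.
  + exact: measurable_laplace_fun.
  + by move=> Z; exact: product_density_ge0.
  + exact: product_density_le1.
  + by move=> x; exact: laplace_fun_norm_le1.
- move=> f e mf fe; apply: (@law_close R _ _ (@lebesgue_measure R) _ _ ms iN) => //.
  + exact: measurable_laplace_fun.
  + by move=> z; rewrite mulr_ge0 ?expR_ge0// normal_pdf_ge0.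
  + rewrite RintegralZl//; last exact: integrable_normal_pdf01.
    rewrite [X in _ * X](_ : _ = 1); last by rewrite /Rintegral integral_normal_pdf.
    by rewrite mulr1 -[leRHS](expR0 R) ler_expR oppr_le0 divr_ge0// sqr_ge0.
  + by move=> x; exact: laplace_fun_norm_le1.
- move=> n; rewrite -(funext (cfE n)); exact: (measurable_cf (mS n) (iW n)).
- by move=> n t; exact: product_cf_norm_le1.
- move=> t; rewrite /phi normal_cfE -expRD.
  (* Lost mass and variance are the two terms of [tilt_rate t * s^2], where [s^2] is [Sigma] times
     the limit of the sum of the powers [step_size d i] to [2 nu]. *)
  have -> : - (s ^+ 2 / 8) + - ((t * s) ^+ 2 / 2) =
      - (tilt_rate t * Sigma * (ell `^ (2 * nu) * K)).
    by rewrite [(t * s) ^+ 2]exprMn sE /tilt_rate; field.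
  (* Back from [n.+1] to all [d]: the product limit asks for positive steps only when [0 < d]. *)
  rewrite /phi_ (cvg_shiftS (fun d => \prod_(i < d) energy_cf V (Psi V) t (h d / lam i))).
  under eq_fun do under eq_bigr do rewrite -[energy_cf _ _ _ _](subKr 1).
  apply: (@prod_rate_cvg R (fun x => 1 - energy_cf V (Psi V) t x) _ nu (step_size lam nu gamma ell)) => //.
  + by move=> d i d0; exact: step_size_gt0.
  + move=> x x0; have := energy_cf_norm_le1 m0 dV iV vol rev t x0.
    by rewrite ler_norml; lra.
  + exact: energy_cf_cvg.
  + exact: sum_step_size_cvg.
  + exact: max_step_size_cvg.
- exact: laplace_fun_approx.
Qed.
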